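(* Set $\Gamma=\Gamma(1/4)$ and write $R_n=R_n(1/2)$ and $R_n^{(k)}=R_n^{(k)}(1/2)$ (the $k$-th derivative of the polynomial $R_n$ evaluated at $1/2$; $R_n'$, $R_n''$ denote $k=1,2$). For every integer $m>1$: $$\sum_{n=1}^{\infty}\frac{(-1)^nn^{4m-3}}{\sinh^3(n\pi)}=-\frac{(4m-6)!\,\Gamma^{8m}}{2^{8m+3}\pi^{6m}}\Big\{4\Big(\frac{64(m-1)(4m-3)\pi^4}{\Gamma^8}+m-3\Big)R_{4m-6}+R''_{4m-6}\Big\},$$ $$\sum_{n=1}^{\infty}\frac{(-1)^nn^{4m-1}}{\sinh^3(n\pi)}=-\frac{(4m-4)!\,\Gamma^{8m}}{2^{8m+3}\pi^{6m+1}}\Big\{(4m-1)R'_{4m-4}-2\left(3+2m(4m-5)\right)\pi R_{4m-2}\Big\},$$ $$\sum_{n=1}^{\infty}\frac{(-1)^nn^{4m-2}\cosh(n\pi)}{\sinh^4(n\pi)}=-\frac{(4m-6)!\,\Gamma^{8m}}{3\cdot2^{8m+3}\pi^{6m}}\Big\{\frac{256(m-1)(2m-1)(4m-3)\pi^3R_{4m-6}}{\Gamma^8}-4(m-1)(4m-5)R'_{4m-4}$$ $$\qquad+\frac{3(2m-1)}{\pi}\left[4(m-3)R_{4m-6}+R''_{4m-6}\right]\Big\},$$ $$\sum_{n=1}^{\infty}\frac{(-1)^nn^{4m-1}}{\sinh^5(n\pi)}=-\frac{(4m-1)!\,\Gamma^{8m-8}R_{4m-6}}{2^{8m+1}\cdot3(4m-5)\pi^{6m-2}}-\frac{(4m-6)!\,\Gamma^{8m}}{3\cdot2^{8m+13}\pi^{6m+6}}\Big\{256\pi^4\Big[72(m-1)(2m-1)(4m-5)(4m-3)\pi^2R_{4m-2}$$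 $$\qquad-40(m-1)(4m-5)(4m-1)\pi R'_{4m-4}+3(8m^2-6m+1)\big(4(m-3)R_{4m-6}+R''_{4m-6}\big)\Big]$$ $$\qquad+\Gamma^8\big[8(6m^2-37m+55)R_{4m-6}+24(m-4)R''_{4m-6}+R^{(4)}_{4m-6}\big]\Big\}.$$
   Context: $\Gamma(1/4)$ is the value of the Euler Gamma function. For a modulus $k$ with $0<k<1$, the Jacobi elliptic function $\mathrm{sn}(u,k)=\sin\varphi$ is defined by inverting $u=\int_0^{\varphi}\frac{dt}{\sqrt{1-k^2\sin^2t}}$. With $x=k^2$, its Maclaurin expansion in $u$ has the form $\mathrm{sn}(u,k)=\sum_{n=1}^\infty \frac{g_{2n-1}(x)}{(2n-1)!}u^{2n-1}$ with polynomials $g_{2n-1}(x)\in\mathbb{Q}[x]$. Define, for $n\ge1$, $$q_{2n}(x):=\sum_{j=1}^n\binom{2n}{2j-1}g_{2j-1}(x)\,g_{2n-2j+1}(x)\in\mathbb{Q}[x],$$ so that $\mathrm{sn}^2(u,k)=\sum_{n\ge1}\frac{q_{2n}(x)}{(2n)!}u^{2n}$, and for $n\ge1$ define $$R_{2n}(x):=\frac{(x-1)^{n-1}}{(2n)!}\,q_{2n}\Big(\frac{x}{x-1}\Big),$$ which is a polynomial in $x$ with rational coefficients (for instance $R_2(x)=1$, $R_4(x)=(1-2x)/3$). *)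

(* Defs.v *)
(* Stdlib reals with Coquelicot. MathComp supplies only the polynomials over Q,
   which are evaluated in R through the ring structure on R given by Rstruct. *)
From Stdlib Require Import Reals ClassicalEpsilon.
From Coquelicot Require Import Coquelicot.
From mathcomp Require Import all_boot all_order all_algebra.
From mathcomp Require Import Rstruct.

Set Implicit Arguments.
Unset Strict Implicit.
Unset Printing Implicit Defensive.

Import GRing.Theory.

Local Open Scope ring_scope.

(* Sequences [g : nat -> {poly rat}] below are indexed by the actual subscript:
   [g (2 * j - 1)] is g_{2j-1}, and the values at even indices are never used. *)

(* The natural number [n] stands for the subscript 2n: this is q_{2n}. *)
Definition q_poly (g : nat -> {poly rat}) (n : nat) : {poly rat} :=
  \sum_(1 <= j < n.+1)
    'C((2 * n)%N, (2 * j - 1)%N)%:R *: (g (2 * j - 1)%N * g (2 * n - 2 * j + 1)%N).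

Definition evalR (p : {poly rat}) (x : R) : R := (map_poly ratr p).[x].

Local Close Scope ring_scope.
Local Open Scope R_scope.

Definition Gamma (s : R) : R :=
  RInt_gen (fun t => Rpower t (s - 1) * exp (- t))
           (at_right 0) (Rbar_locally p_infty).

Definition ellF (k phi : R) : R :=
  RInt (fun t => / sqrt (1 - k ^ 2 * sin t ^ 2)) 0 phi.

(* For 0 < k < 1 the map [ellF k] is a bijection of R, so the amplitude is its
   only preimage of [u]; other values of [k] play no role. *)
Definition am (u k : R) : R :=
  epsilon (inhabits 0) (fun phi => ellF k phi = u).

Definition sn (u k : R) : R := sin (am u k).

(* This determines every g_{2i+1}, since a polynomial is determined by its values
   at the infinitely many points k^2. *)
Definition sn_maclaurin (g : nat -> {poly rat}) : Prop :=
  forall k : R, 0 < k < 1 ->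
    locally 0 (fun u : R =>
      is_series
        (fun i : nat => evalR (g (2 * i + 1)%N) (k ^ 2)
                        / INR (2 * i + 1)`!%N * u ^ (2 * i + 1)%N)
        (sn u k)).

(* R_{2n} as a function; the formula agrees with the polynomial away from x = 1,
   hence so do the derivatives at 1/2. *)
Definition R_even (g : nat -> {poly rat}) (n : nat) (x : R) : R :=
  (x - 1) ^ (n - 1)%N / INR (2 * n)`!%N * evalR (q_poly g n) (x / (x - 1)).

(* Main.v *)
(** With [theta(x,y) = sum_n e^(-n^2 y) cos(n x)], the Lambert series
    [F_(2j+1)(y) = sum_(n>=1) (-1)^n n^(2j+1) / sinh(n y)] are, up to sign, the
    derivatives at [x = 0] of [theta_x / theta].  The bilinear identity
    [theta(x+h) theta(x-h) = T0(x) T0(h) + T1(x) T1(h)] forces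
    [(log theta)_xx - const] to solve [u'' = r + s u - 6 u^2], which is also, up to
    scaling, the equation of [sn^2] at the modulus [x/(x-1)]; hence
    [F_(2j+1) = - (2j)! Z^(j+1) X (1-X) R_(2j)(X)].  The heat equation turns into
    a differential system in [y] for [X], [Z] and [p = F_1], and the series of the
    theorem are combinations of derivatives of the [F_(2j+1)] in [y] of order at
    most four.  It remains to evaluate [X], [Z], [p] at [y = PI].  There
    [theta(x)] and [theta(ix)] both have quarter period [PI]; comparing the two
    period integrals gives [X = 1/2], comparing the two quasi-periods gives
    [p = -1/(4 PI)], and the period itself is a lemniscate integral, which the
    Gaussian trick expresses by [Gamma(1/4)]. *)

Require Import Defs.
From Stdlib Require Import Reals ZArith Lra Lia ClassicalEpsilon.
From Coquelicot Require Import Coquelicot.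

Local Open Scope R_scope.

(** The argument stays on the real line: a boolean [e] switches between theta(x) and theta(ix), and
    the equality of their quarter periods at [y = PI] takes the place of the transformation of theta
    under y -> PI^2 / y. The bilinear identity rests on m^2 + n^2 = ((m+n)^2 + (m-n)^2) / 2, where m
    - n runs through the integers of the parity of m + n. Two parity classes mean that three Hirota
    derivatives of theta are linearly dependent; the orders 4, 2, 0 give the equation for u. The
    condition [3 <= y], which [PI] meets, makes e^(-y) at most 1/16. This yields the positivity of
    theta and of r, and Z < 1. The last bound shows that a critical point of u in (0, PI] is the
    first one, so it equals the quarter period and not a multiple of it. The polynomials q_(2n) are
    tied to sn for k^2 in (0, 1) only, whereas R_(2n)(x) with 0 < x < 1 evaluates them at x/(x-1) <
    0. The recursion crosses this gap as an identity between polynomials, and the resulting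
    recursion for R_(2n) is all that the analytic part uses. *)

(** * Real series: domination, interchange of sums, termwise differentiation *)

Lemma ex_series_le_abs (a b : nat -> R) :
  (forall n, Rabs (a n) <= b n) -> ex_series b -> ex_series a.
Proof. intros H Hb. apply (@ex_series_le R_AbsRing R_CompleteNormedModule a b); auto. Qed.

Lemma Series_abs_le (a b : nat -> R) :
  (forall n, Rabs (a n) <= b n) -> ex_series b -> Rabs (Series a) <= Series b.
Proof.
intros H Hb.
assert (Ha : ex_series (fun n => Rabs (a n))).
{ apply (ex_series_le_abs _ b); auto. intros n. rewrite Rabs_Rabsolu. auto. }
apply Rle_trans with (Series (fun n => Rabs (a n))).
- apply Series_Rabs; auto.
- apply Series_le; auto. intros n; split; auto. apply Rabs_pos.
Qed.

Lemma ex_series_Rplus (a b : nat -> R) :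
  ex_series a -> ex_series b -> ex_series (fun n => a n + b n).
Proof. exact (ex_series_plus (V := R_NormedModule) a b). Qed.

Lemma ex_series_Rscal (c : R) (a : nat -> R) :
  ex_series a -> ex_series (fun n => c * a n).
Proof. exact (ex_series_scal (V := R_NormedModule) c a). Qed.

Lemma ex_series_tail (a : nat -> R) (N : nat) : ex_series a -> ex_series (fun n => a (S N + n)%nat).
Proof. exact (proj1 (ex_series_incr_n (V := R_NormedModule) a (S N))). Qed.

Lemma Series_tail (a : nat -> R) (N : nat) : ex_series a ->
  Series a = sum_f_R0 a N + Series (fun n => a (S N + n)%nat).
Proof. intros H. apply (Series_incr_n a (S N)); [lia|auto]. Qed.

Lemma Series_sum_swap (a : nat -> nat -> R) (N : nat) :
  (forall m, ex_series (a m)) ->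
  is_series (fun n => sum_n (fun m => a m n) N) (sum_n (fun m => Series (a m)) N).
Proof.
intros H; induction N as [|N IH].
- rewrite sum_O. apply is_series_ext with (a 0%nat).
  + intros n; now rewrite sum_O.
  + apply Series_correct, H.
- rewrite sum_Sn. apply is_series_ext with
    (fun n => plus (sum_n (fun m => a m n) N) (a (S N) n)).
  + intros n; now rewrite sum_Sn.
  + apply (is_series_plus (V := R_NormedModule)); auto. apply Series_correct, H.
Qed.

(** Finite outer sums commute with [Series]; after the rows up to [N] the remainder is at most the
    tail of [al] times the sum of [be], which tends to [0]. *)
Lemma Series_fubini (a : nat -> nat -> R) (al be : nat -> R) :
  (forall m n, Rabs (a m n) <= al m * be n) -> ex_series al -> ex_series be ->
  Series (fun m => Series (fun n => a m n)) = Series (fun n => Series (fun m => a m n)).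
Proof.
intros H Hal Hbe.
assert (E1 : forall m, ex_series (a m)).
{ intros m. apply ex_series_le_abs with (fun n => al m * be n); auto.
  apply ex_series_Rscal; auto. }
assert (E2 : forall n, ex_series (fun m => a m n)).
{ intros n. apply ex_series_le_abs with (fun m => be n * al m).
  - intros m; rewrite Rmult_comm; auto.
  - apply ex_series_Rscal; auto. }
apply is_series_unique.
change (is_lim_seq (sum_n (fun m => Series (fun n => a m n)))
  (Series (fun n => Series (fun m => a m n)))).
assert (Ex : ex_series (fun n => Series (fun m => a m n))).
{ apply ex_series_le_abs with (fun n => Series al * be n).
  - intros n. rewrite Rmult_comm, <- Series_scal_l. apply Series_abs_le.
    + intros m; rewrite Rmult_comm; auto.
    + apply ex_series_Rscal; auto.
  - apply ex_series_Rscal; auto. }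
apply is_lim_seq_ext_loc with
  (fun N => Series (fun n => Series (fun m => a m n))
     - Series (fun n => Series (fun m => a (S N + m)%nat n))).
{ exists 0%nat; intros N _.
  transitivity (Series (fun n => sum_n (fun m => a m n) N));
    [|exact (is_series_unique _ _ (Series_sum_swap a N E1))].
  rewrite <- Series_minus.
  - apply Series_ext; intros n.
    rewrite (Series_tail (fun m => a m n) N) by auto.
    rewrite sum_n_Reals. simpl pred. ring_simplify. reflexivity.
  - exact Ex.
  - apply ex_series_le_abs with (fun n => Series (fun m => al (S N + m)%nat) * be n).
    + intros n. rewrite Rmult_comm, <- Series_scal_l. apply Series_abs_le.
      * intros m; rewrite Rmult_comm; auto.
      * apply ex_series_Rscal. apply ex_series_tail; auto.
    + apply ex_series_Rscal; auto. }
replace (Finite (Series (fun n => Series (fun m => a m n)))) with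
  (Rbar_minus (Series (fun n => Series (fun m => a m n))) 0) by (simpl; f_equal; ring).
apply is_lim_seq_minus'; [apply is_lim_seq_const|].
apply is_lim_seq_abs_0.
apply is_lim_seq_le_le with (fun _ => 0)
  (fun N => (Series al - sum_n al N) * Series be).
- intros N; split; [apply Rabs_pos|].
  replace (Series al - sum_n al N) with (Series (fun m => al (S N + m)%nat)).
  2:{ rewrite (Series_tail al N) by auto. rewrite sum_n_Reals. simpl pred. ring. }
  rewrite <- Series_scal_l. apply Series_abs_le.
  + intros n. rewrite Rmult_comm, <- Series_scal_l. apply Series_abs_le.
    * intros m; rewrite Rmult_comm; auto.
    * apply ex_series_Rscal. apply ex_series_tail; auto.
  + apply ex_series_Rscal; auto.
- apply is_lim_seq_const.
- replace (Finite 0) with (Rbar_mult (Series al - Series al) (Series be))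
    by (simpl; f_equal; ring).
  apply (is_lim_seq_scal_r _ (Series be) (Finite (Series al - Series al))).
  apply is_lim_seq_minus'; [apply is_lim_seq_const|].
  apply Series_correct; auto.
Qed.

(** One tail of [b] controls both the tail of the difference quotients, by the mean value theorem,
    and the tail of the derivatives. The step [h] is then chosen for the finite sum up to [N] alone;
    each of the three errors is at most [eps / 4]. *)
Lemma Series_is_derive (f f' : nat -> R -> R) (b : nat -> R) (x0 : R) (d : posreal) :
  (forall n x, Rabs (x - x0) < d -> is_derive (f n) x (f' n x)) ->
  (forall n x, Rabs (x - x0) < d -> Rabs (f' n x) <= b n) ->
  ex_series b -> ex_series (fun n => f n x0) ->
  is_derive (fun x => Series (fun n => f n x)) x0 (Series (fun n => f' n x0)).
Proof.
intros Hd Hb Eb Ex0.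
assert (Dl : forall n x, Rabs (x - x0) < d -> Rabs (f n x - f n x0) <= b n * Rabs (x - x0)).
{ intros n x Hx.
  destruct (MVT_gen (f n) x0 x (f' n)) as [c [Hc E]].
  - intros c Hc; apply Hd. unfold Rmin, Rmax in Hc; destruct (Rle_dec x0 x);
      revert Hx; unfold Rabs; repeat destruct Rcase_abs; lra.
  - intros c Hc. apply derivable_continuous_pt. exists (f' n c).
    apply is_derive_Reals, Hd. unfold Rmin, Rmax in Hc; destruct (Rle_dec x0 x);
      revert Hx; unfold Rabs; repeat destruct Rcase_abs; lra.
  - rewrite E, Rabs_mult. apply Rmult_le_compat_r; [apply Rabs_pos|].
    apply Hb. unfold Rmin, Rmax in Hc; destruct (Rle_dec x0 x);
      revert Hx; unfold Rabs; repeat destruct Rcase_abs; lra. }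
assert (Exx : forall x, Rabs (x - x0) < d -> ex_series (fun n => f n x)).
{ intros x Hx. apply ex_series_ext with (fun n => f n x0 + (f n x - f n x0)).
  - intros n; simpl; ring.
  - apply ex_series_Rplus; auto.
    apply ex_series_le_abs with (fun n => Rabs (x - x0) * b n).
    + intros n; rewrite Rmult_comm; auto.
    + apply ex_series_Rscal; auto. }
assert (H0 : Rabs (x0 - x0) < d) by (rewrite Rminus_diag, Rabs_R0; apply cond_pos).
assert (Ed : ex_series (fun n => f' n x0)) by (apply ex_series_le_abs with b; auto).
apply is_derive_Reals. intros eps Heps.
assert (L : is_lim_seq (fun N => Series b - sum_n b N) 0).
{ replace (Finite 0) with (Finite (Series b - Series b)) by (f_equal; ring).
  apply is_lim_seq_minus'; [apply is_lim_seq_const|apply Series_correct; auto]. }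
apply is_lim_seq_spec in L.
assert (He4 : 0 < eps / 4) by lra.
destruct (L (mkposreal _ He4)) as [N HN]. specialize (HN N (le_n N)). simpl in HN.
rewrite Rminus_0_r in HN.
assert (Tb : Series b - sum_n b N = Series (fun n => b (S N + n)%nat)).
{ rewrite (Series_tail b N) by auto. rewrite sum_n_Reals. simpl pred. ring. }
rewrite Tb in HN.
assert (Dn : is_derive (fun x => sum_n (fun n => f n x) N) x0 (sum_n (fun n => f' n x0) N)).
{ apply (is_derive_sum_n f N x0 (fun n => f' n x0)). intros n _; apply Hd; auto. }
apply is_derive_Reals in Dn.
destruct (Dn (eps / 4) He4) as [d1 Hd1].
assert (Hm : 0 < Rmin d d1) by (apply Rmin_pos; apply cond_pos).
exists (mkposreal _ Hm). simpl. intros h Hh0 Hh.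
assert (Hhd : Rabs (x0 + h - x0) < d).
{ replace (x0 + h - x0) with h by ring. eapply Rlt_le_trans; [exact Hh|apply Rmin_l]. }
specialize (Hd1 h Hh0 (Rlt_le_trans _ _ _ Hh (Rmin_r _ _))).
rewrite (Series_tail (fun n => f n (x0 + h)) N) by auto.
rewrite (Series_tail (fun n => f n x0) N) by auto.
rewrite (Series_tail (fun n => f' n x0) N) by auto.
rewrite <- !sum_n_Reals. simpl pred.
assert (A1 : Rabs (Series (fun k => f (S N + k)%nat (x0 + h)) - Series (fun k => f (S N + k)%nat x0))
   <= Series (fun n => b (S N + n)%nat) * Rabs h).
{ rewrite <- Series_minus.
  - rewrite Rmult_comm, <- Series_scal_l. apply Series_abs_le.
    + intros n. rewrite Rmult_comm. replace h with (x0 + h - x0) at 2 by ring. auto.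
    + apply ex_series_Rscal.
      apply ex_series_tail; auto.
  - apply (ex_series_tail (fun n => f n (x0 + h)) N); auto.
  - apply (ex_series_tail (fun n => f n x0) N); auto. }
assert (A2 : Rabs (Series (fun k => f' (S N + k)%nat x0)) <= Series (fun n => b (S N + n)%nat)).
{ apply Series_abs_le; auto. apply ex_series_tail; auto. }
apply Rle_lt_trans with (eps / 4 + eps / 4 + eps / 4); [|lra].
set (T := Series (fun n => b (S N + n)%nat)) in *.
match goal with |- Rabs ((?a + ?t1 - (?c + ?t2)) / h - (?e + ?t3)) <= _ =>
  replace ((a + t1 - (c + t2)) / h - (e + t3)) with (((a - c) / h - e) + (t1 - t2) / h - t3)
    by (field; auto) end.
assert (HT : T < eps / 4) by (eapply Rle_lt_trans; [apply Rle_abs|exact HN]).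
unfold Rminus at 1. eapply Rle_trans; [apply Rabs_triang|].
rewrite Rabs_Ropp. apply Rplus_le_compat; [|lra].
eapply Rle_trans; [apply Rabs_triang|]. apply Rplus_le_compat; [lra|].
unfold Rdiv; rewrite Rabs_mult, Rabs_inv.
apply Rle_trans with T; [|lra].
apply Rle_trans with (T * Rabs h * / Rabs h).
- apply Rmult_le_compat_r; auto. apply Rlt_le, Rinv_0_lt_compat, Rabs_pos_lt; auto.
- right; field. apply Rabs_no_R0; auto.
Qed.

Lemma Series_ge0 (a : nat -> R) : (forall n, 0 <= a n) -> ex_series a -> 0 <= Series a.
Proof.
intros H E. rewrite <- (Rmult_0_l (Series a)), <- Series_scal_l. apply Series_le; auto.
intros n; rewrite Rmult_0_l; split; [lra|apply H].
Qed.

Lemma is_derive_eq (f : R -> R) (x l l' : R) : is_derive f x l -> l = l' -> is_derive f x l'.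
Proof. now intros H <-. Qed.

(* Coquelicot's canonical structures often leave an equation at a type that is only
   convertible to [R], which [ring] and [field] reject. *)
Ltac Rgoal := match goal with |- @eq _ ?a ?b => change (@eq R a b) end.

Lemma is_derive_Rplus (f g : R -> R) (x lf lg : R) :
  is_derive f x lf -> is_derive g x lg -> is_derive (fun t => f t + g t) x (lf + lg).
Proof. exact (is_derive_plus (V := R_NormedModule) f g x lf lg). Qed.

Lemma is_derive_Rminus (f g : R -> R) (x lf lg : R) :
  is_derive f x lf -> is_derive g x lg -> is_derive (fun t => f t - g t) x (lf - lg).
Proof. exact (is_derive_minus (V := R_NormedModule) f g x lf lg). Qed.

Lemma is_derive_Rconst (c x : R) : is_derive (fun _ => c) x 0.
Proof. exact (is_derive_const (V := R_NormedModule) c x). Qed.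

Lemma ex_derive_Rcontinuous (f : R -> R) (x : R) : ex_derive f x -> continuous f x.
Proof. exact (ex_derive_continuous (V := R_NormedModule) f x). Qed.

Lemma RInt_Rconst (a b c : R) : RInt (fun _ => c) a b = (b - a) * c.
Proof. exact (RInt_const (V := R_CompleteNormedModule) a b c). Qed.

Lemma ex_RInt_Rcontinuous (f : R -> R) a b : (forall x, continuous f x) -> ex_RInt f a b.
Proof. intros H; apply (ex_RInt_continuous (V := R_CompleteNormedModule)); auto. Qed.

Lemma is_derive_inj (f : R -> R) (x l l' : R) : is_derive f x l -> is_derive f x l' -> l = l'.
Proof. intros H H'. apply is_derive_unique in H. apply is_derive_unique in H'. congruence. Qed.

Lemma exp_ge0 x : 0 <= exp x.
Proof. apply Rlt_le, exp_pos. Qed.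

(** * Sums over the integers *)

(** Pairing [n] with [- n - 1] meets every integer exactly once, so that a bilateral sum is a single
    [Series]. *)
Definition Zsum (f : Z -> R) : R :=
  Series (fun n => f (Z.of_nat n) + f (- Z.of_nat n - 1)%Z).

Definition Zsummable (f : Z -> R) : Prop :=
  ex_series (fun n => Rabs (f (Z.of_nat n))) /\
  ex_series (fun n => Rabs (f (- Z.of_nat n - 1)%Z)).

(** The rate may be negative: [expdecay (- K)] bounds an exponential growth, and rates add under
    products. *)
Definition expdecay (k : R) (f : Z -> R) : Prop :=
  exists A, 0 <= A /\ forall n, Rabs (f n) <= A * exp (- (k * IZR (Z.abs n))).

Lemma ex_series_exp (k : R) : 0 < k -> ex_series (fun n => exp (- (k * INR n))).
Proof.
intros Hk. apply ex_series_ext with (fun n => (exp (- k)) ^ n).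
- intros n. induction n as [|n IH].
  + simpl. rewrite Rmult_0_r, Ropp_0, exp_0. reflexivity.
  + simpl pow. rewrite IH, S_INR, <- exp_plus. f_equal; ring.
- apply ex_series_geom. rewrite Rabs_pos_eq; [|apply exp_ge0].
  rewrite <- exp_0. apply exp_increasing; lra.
Qed.

Lemma Zsummable_expdecay (k : R) (f : Z -> R) : 0 < k -> expdecay k f -> Zsummable f.
Proof.
intros Hk [A [HA H]]; split; apply ex_series_le_abs with (fun n => A * exp (- (k * INR n)));
  try (apply ex_series_Rscal, ex_series_exp; auto); intros n; rewrite Rabs_Rabsolu.
- eapply Rle_trans; [apply H|]. rewrite Z.abs_eq by lia. rewrite <- INR_IZR_INZ. lra.
- eapply Rle_trans; [apply H|]. apply Rmult_le_compat_l; auto.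
  replace (Z.abs (- Z.of_nat n - 1)) with (Z.of_nat n + 1)%Z by lia.
  rewrite plus_IZR, <- INR_IZR_INZ.
  destruct (Rle_lt_or_eq_dec (- (k * (INR n + 1))) (- (k * INR n))) as [L|L]; [nra| |].
  + apply Rlt_le, exp_increasing; auto.
  + rewrite L; lra.
Qed.

Lemma Zsummable_ser1 f : Zsummable f -> ex_series (fun n => f (Z.of_nat n)).
Proof. intros [H _]; apply ex_series_Rabs; auto. Qed.
Lemma Zsummable_ser2 f : Zsummable f -> ex_series (fun n => f (- Z.of_nat n - 1)%Z).
Proof. intros [_ H]; apply ex_series_Rabs; auto. Qed.
Lemma Zsummable_ser f : Zsummable f -> ex_series (fun n => f (Z.of_nat n) + f (- Z.of_nat n - 1)%Z).
Proof. intros H; apply ex_series_Rplus; [apply Zsummable_ser1|apply Zsummable_ser2]; auto. Qed.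

Lemma Zsum_split f : Zsummable f ->
  Zsum f = Series (fun n => f (Z.of_nat n)) + Series (fun n => f (- Z.of_nat n - 1)%Z).
Proof. intros H. unfold Zsum. apply Series_plus; [apply Zsummable_ser1|apply Zsummable_ser2]; auto. Qed.

Lemma Zsum_ext f g : (forall n, f n = g n) -> Zsum f = Zsum g.
Proof. intros H; apply Series_ext; intros n; now rewrite !H. Qed.

Lemma Zsummable_ext f g : (forall n, f n = g n) -> Zsummable f -> Zsummable g.
Proof. intros H [A B]; split; eapply ex_series_ext; [|exact A| |exact B]; intros n; simpl; now rewrite H. Qed.

Lemma Zsummable_le f g : (forall n, Rabs (f n) <= g n) -> Zsummable g -> Zsummable f.
Proof.
intros H [A B]; split; [eapply ex_series_le_abs; [|exact A]|eapply ex_series_le_abs; [|exact B]];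
  intros n; rewrite Rabs_Rabsolu;
  (eapply Rle_trans; [apply H|apply Rle_abs]).
Qed.

Lemma Zsummable_plus f g : Zsummable f -> Zsummable g -> Zsummable (fun n => f n + g n).
Proof.
intros [A B] [A' B']; split;
  [apply ex_series_le_abs with (fun n => Rabs (f (Z.of_nat n)) + Rabs (g (Z.of_nat n)))
  |apply ex_series_le_abs with (fun n => Rabs (f (- Z.of_nat n - 1)%Z) + Rabs (g (- Z.of_nat n - 1)%Z))];
  try (apply ex_series_Rplus; auto); intros n; rewrite Rabs_Rabsolu; apply Rabs_triang.
Qed.

Lemma Zsummable_scal c f : Zsummable f -> Zsummable (fun n => c * f n).
Proof.
intros [A B]; split;
  [eapply ex_series_ext; [|exact (ex_series_Rscal (Rabs c) _ A)]
  |eapply ex_series_ext; [|exact (ex_series_Rscal (Rabs c) _ B)]];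
  intros n; simpl; now rewrite Rabs_mult.
Qed.

Lemma Zsum_plus f g : Zsummable f -> Zsummable g -> Zsum (fun n => f n + g n) = Zsum f + Zsum g.
Proof.
intros A B. unfold Zsum. rewrite <- Series_plus; try (apply Zsummable_ser; auto).
apply Series_ext; intros n; ring.
Qed.

Lemma Zsum_scal c f : Zsum (fun n => c * f n) = c * Zsum f.
Proof.
unfold Zsum. rewrite <- Series_scal_l. apply Series_ext; intros n; ring.
Qed.

Lemma Zsum_scal_r c f : Zsum (fun n => f n * c) = Zsum f * c.
Proof. rewrite Rmult_comm, <- Zsum_scal. apply Zsum_ext; intros; ring. Qed.

Lemma Zsum_opp f : Zsum (fun n => - f n) = - Zsum f.
Proof.
replace (- Zsum f) with ((-1) * Zsum f) by ring. rewrite <- Zsum_scal. apply Zsum_ext; intros; ring.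
Qed.

Lemma Zsum_minus f g : Zsummable f -> Zsummable g -> Zsum (fun n => f n - g n) = Zsum f - Zsum g.
Proof.
intros A B. rewrite (Zsum_ext _ (fun n => f n + (-1) * g n)) by (intros; ring).
rewrite Zsum_plus; auto. rewrite Zsum_scal; ring. apply Zsummable_scal; auto.
Qed.

Lemma Zsum_le f g : (forall n, 0 <= f n <= g n) -> Zsummable g -> Zsum f <= Zsum g.
Proof.
intros H E. apply Series_le; [|apply Zsummable_ser; auto].
intros n; generalize (H (Z.of_nat n)) (H (- Z.of_nat n - 1)%Z); lra.
Qed.

Lemma Zsum_abs_le f g : (forall n, Rabs (f n) <= g n) -> Zsummable g -> Rabs (Zsum f) <= Zsum g.
Proof.
intros H E. apply Series_abs_le; [|apply Zsummable_ser; auto].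
intros n; eapply Rle_trans; [apply Rabs_triang|].
generalize (H (Z.of_nat n)) (H (- Z.of_nat n - 1)%Z); lra.
Qed.

Lemma Zsummable_refl f : Zsummable f -> Zsummable (fun n => f (- n)%Z).
Proof.
intros [A B]; split.
- apply ex_series_incr_1. eapply ex_series_ext; [|exact B].
  intros n; simpl; do 2 f_equal; lia.
- apply ex_series_incr_1 in A. eapply ex_series_ext; [|exact A].
  intros n; simpl; do 2 f_equal; lia.
Qed.

Lemma Zsummable_succ f : Zsummable f -> Zsummable (fun n => f (n + 1)%Z).
Proof.
intros H; generalize (Zsummable_refl _ H); intros [A B]; destruct H as [A' B']; split.
- eapply ex_series_ext; [|exact B]. intros n; simpl; do 2 f_equal; lia.
- eapply ex_series_ext; [|exact A]. intros n; simpl; do 2 f_equal; lia.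
Qed.

Lemma Zsum_succ f : Zsummable f -> Zsum (fun n => f (n + 1)%Z) = Zsum f.
Proof.
intros H. rewrite (Zsum_split f H), (Zsum_split _ (Zsummable_succ f H)).
rewrite (Series_incr_1 (fun n => f (Z.of_nat n))); [|apply Zsummable_ser1; auto].
rewrite (Series_incr_1 (fun n => f (- Z.of_nat n - 1 + 1)%Z)).
2:{ apply (Zsummable_ser2 _ (Zsummable_succ f H)). }
rewrite (Series_ext (fun n => f (Z.of_nat n + 1)%Z) (fun n => f (Z.of_nat (S n)))) by (intros; f_equal; lia).
rewrite (Series_ext (fun n => f (- Z.of_nat (S n) - 1 + 1)%Z) (fun n => f (- Z.of_nat n - 1)%Z)) by (intros; f_equal; lia).
simpl. ring.
Qed.

Lemma Zsum_refl f : Zsummable f -> Zsum (fun n => f (- n)%Z) = Zsum f.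
Proof.
intros H. rewrite <- (Zsum_succ f H). unfold Zsum. apply Series_ext; intros n.
rewrite Rplus_comm. f_equal; f_equal; lia.
Qed.


Lemma Zsum_shift_aux f (k : nat) : Zsummable f ->
  Zsummable (fun n => f (n + Z.of_nat k)%Z) /\ Zsum (fun n => f (n + Z.of_nat k)%Z) = Zsum f.
Proof.
intros H; induction k as [|k [IH1 IH2]].
- split; [eapply Zsummable_ext; [|exact H] | apply Zsum_ext]; intros n; f_equal; lia.
- split.
  + generalize (Zsummable_succ _ IH1); apply Zsummable_ext; intros n; f_equal; lia.
  + rewrite <- IH2, <- (Zsum_succ _ IH1). apply Zsum_ext; intros n; f_equal; lia.
Qed.

Lemma Zsummable_shift f (k : Z) : Zsummable f -> Zsummable (fun n => f (n + k)%Z).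
Proof.
intros H. destruct (Z.le_gt_cases 0 k) as [L|L].
- rewrite <- (Z2Nat.id k) by lia. apply Zsum_shift_aux; auto.
- generalize (Zsummable_refl _ (proj1 (Zsum_shift_aux _ (Z.to_nat (- k)) (Zsummable_refl _ H)))).
  apply Zsummable_ext; intros n; f_equal; lia.
Qed.

Lemma Zsum_shift f (k : Z) : Zsummable f -> Zsum (fun n => f (n + k)%Z) = Zsum f.
Proof.
intros H. destruct (Z.le_gt_cases 0 k) as [L|L].
- rewrite <- (Z2Nat.id k) by lia. apply Zsum_shift_aux; auto.
- destruct (Zsum_shift_aux _ (Z.to_nat (- k)) (Zsummable_refl _ H)) as [E1 E2].
  rewrite <- (Zsum_refl _ H), <- E2, <- (Zsum_refl _ E1).
  apply Zsum_ext; intros n; f_equal; lia.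
Qed.

Lemma Zsum_flip f (k : Z) : Zsummable f -> Zsum (fun n => f (k - n)%Z) = Zsum f.
Proof.
intros H. rewrite <- (Zsum_shift f k H), <- (Zsum_refl _ (Zsummable_shift f k H)).
apply Zsum_ext; intros n; f_equal; lia.
Qed.

Lemma Zsum_odd f : Zsummable f -> (forall n, f (- n)%Z = - f n) -> Zsum f = 0.
Proof.
intros H O. generalize (Zsum_refl f H). rewrite (Zsum_ext (fun n => f (- n)%Z) (fun n => - f n)) by auto.
rewrite Zsum_opp. lra.
Qed.

Lemma Zsum_even f : Zsummable f -> (forall n, f (- n)%Z = f n) ->
  Zsum f = f 0%Z + 2 * Series (fun n => f (Z.of_nat (S n))).
Proof.
intros H O. rewrite (Zsum_split f H).
rewrite (Series_incr_1 (fun n => f (Z.of_nat n))); [|apply Zsummable_ser1; auto].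
rewrite (Series_ext (fun n => f (- Z.of_nat n - 1)%Z) (fun n => f (Z.of_nat (S n)))).
2:{ intros n; rewrite <- O; f_equal; lia. }
simpl. ring.
Qed.

Lemma Zsum_fubini (F : Z -> Z -> R) (A d : R) :
  0 < d ->
  (forall m n, Rabs (F m n) <= A * (exp (- (d * IZR (Z.abs m))) * exp (- (d * IZR (Z.abs n))))) ->
  Zsum (fun m => Zsum (fun n => F m n)) = Zsum (fun n => Zsum (fun m => F m n)).
Proof.
intros Hd H.
assert (Hm : forall m, Zsummable (fun n => F m n)).
{ intros m; apply (Zsummable_le _ (fun n => (A * exp (- (d * IZR (Z.abs m)))) * exp (- (d * IZR (Z.abs n))))).
  - intros n. eapply Rle_trans; [apply H|]. lra.
  - apply Zsummable_scal, Zsummable_expdecay with d; auto. exists 1; split; [lra|].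
    intros n; rewrite Rabs_pos_eq; [lra|apply exp_ge0]. }
assert (Hn : forall n, Zsummable (fun m => F m n)).
{ intros n; apply (Zsummable_le _ (fun m => (A * exp (- (d * IZR (Z.abs n)))) * exp (- (d * IZR (Z.abs m))))).
  - intros m. eapply Rle_trans; [apply H|]. right; ring.
  - apply Zsummable_scal, Zsummable_expdecay with d; auto. exists 1; split; [lra|].
    intros m; rewrite Rabs_pos_eq; [lra|apply exp_ge0]. }
unfold Zsum at 1 3.
rewrite (Series_ext (fun n => Zsum (fun n0 => F (Z.of_nat n) n0) + Zsum (fun n0 => F (- Z.of_nat n - 1)%Z n0))
  (fun m => Series (fun n => (F (Z.of_nat m) (Z.of_nat n) + F (Z.of_nat m) (- Z.of_nat n - 1)%Z)
     + (F (- Z.of_nat m - 1)%Z (Z.of_nat n) + F (- Z.of_nat m - 1)%Z (- Z.of_nat n - 1)%Z)))).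
2:{ intros m. symmetry. apply Series_plus; apply (Zsummable_ser (F _)); auto. }
rewrite (Series_ext (fun n => Zsum (fun m => F m (Z.of_nat n)) + Zsum (fun m => F m (- Z.of_nat n - 1)%Z))
  (fun n => Series (fun m => (F (Z.of_nat m) (Z.of_nat n) + F (Z.of_nat m) (- Z.of_nat n - 1)%Z)
     + (F (- Z.of_nat m - 1)%Z (Z.of_nat n) + F (- Z.of_nat m - 1)%Z (- Z.of_nat n - 1)%Z)))).
2:{ intros n. unfold Zsum. rewrite <- Series_plus; [|apply (Zsummable_ser (fun m => F m _))..]; auto.
    apply Series_ext; intros m; ring. }
assert (A0 : 0 <= A).
{ generalize (H 0%Z 0%Z) (Rabs_pos (F 0%Z 0%Z)). simpl. rewrite !Rmult_0_r, Ropp_0, exp_0. lra. }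
(* The factor [4] counts the four sign patterns gathered in the term of index [(m, n)]. *)
apply Series_fubini with (fun m => (4 * A) * exp (- (d * INR m))) (fun n => exp (- (d * INR n)));
  [|apply ex_series_Rscal|]; try (apply ex_series_exp; auto).
assert (L1 : forall m, exp (- (d * IZR (Z.abs (Z.of_nat m)))) = exp (- (d * INR m))).
{ intros m. rewrite Z.abs_eq by lia. now rewrite <- INR_IZR_INZ. }
assert (L2 : forall m, exp (- (d * IZR (Z.abs (- Z.of_nat m - 1)))) <= exp (- (d * INR m))).
{ intros m. replace (Z.abs (- Z.of_nat m - 1)) with (Z.of_nat m + 1)%Z by lia.
  rewrite plus_IZR, <- INR_IZR_INZ. apply Rlt_le, exp_increasing; nra. }
intros m n.
assert (B : forall m' n', (m' = Z.of_nat m \/ m' = (- Z.of_nat m - 1)%Z) ->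
  (n' = Z.of_nat n \/ n' = (- Z.of_nat n - 1)%Z) ->
  Rabs (F m' n') <= A * (exp (- (d * INR m)) * exp (- (d * INR n)))).
{ intros m' n' Em En. eapply Rle_trans; [apply H|]. apply Rmult_le_compat_l; auto.
  apply Rmult_le_compat; try (apply exp_ge0).
  - destruct Em as [-> | ->]; [rewrite L1; lra|apply L2].
  - destruct En as [-> | ->]; [rewrite L1; lra|apply L2]. }
eapply Rle_trans; [apply Rabs_triang|].
eapply Rle_trans; [apply Rplus_le_compat; apply Rabs_triang|].
pose proof (B _ _ (or_introl eq_refl) (or_introl eq_refl)).
pose proof (B _ _ (or_introl eq_refl) (or_intror eq_refl)).
pose proof (B _ _ (or_intror eq_refl) (or_introl eq_refl)).
pose proof (B _ _ (or_intror eq_refl) (or_intror eq_refl)).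
lra.
Qed.

(** Collects a double sum along [s = m + n]. From |s - m| >= |s| - |m| the exponent al |m| + be |s -
    m| - K |s| is at least (al - be) |m| + (be - K) |s|; hence the strict order of the three
    rates. *)
Lemma Zsum_conv (k : Z -> Z -> R) (f : Z -> R) (A al be K : R) :
  0 <= K -> K < be -> be < al ->
  (forall m n, Rabs (k m n) <= A * (exp (- (al * IZR (Z.abs m))) * exp (- (be * IZR (Z.abs n))))) ->
  expdecay (- K) f ->
  Zsum (fun m => Zsum (fun n => k m n * f (m + n)%Z)) =
  Zsum (fun s => Zsum (fun m => k m (s - m)%Z) * f s).
Proof.
intros HK Hb Ha Ek [F [HF Ef]].
assert (HA : 0 <= A).
{ generalize (Ek 0%Z 0%Z) (Rabs_pos (k 0%Z 0%Z)). simpl. rewrite !Rmult_0_r, Ropp_0, exp_0. lra. }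
set (d := Rmin (al - be) (be - K)).
assert (Hd : 0 < d) by (apply Rmin_pos; lra).
assert (Ed : d <= al - be /\ d <= be - K) by (split; [apply Rmin_l|apply Rmin_r]).
assert (Hexp : forall x y, x <= y -> exp x <= exp y).
{ intros x y [L|L]; [apply Rlt_le, exp_increasing; auto|rewrite L; lra]. }
assert (Bd : forall m s, Rabs (k m (s - m)%Z * f s) <=
   A * F * exp (- (al * IZR (Z.abs m)) + - (be * IZR (Z.abs (s - m))) + - (- K * IZR (Z.abs s)))).
{ intros m s. rewrite Rabs_mult, !exp_plus.
  apply Rle_trans with (A * (exp (- (al * IZR (Z.abs m))) * exp (- (be * IZR (Z.abs (s - m)))))
     * (F * exp (- (- K * IZR (Z.abs s))))); [|right; ring].
  apply Rmult_le_compat; auto; apply Rabs_pos. }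
assert (HAF : 0 <= A * F) by (apply Rmult_le_pos; auto).
assert (Tr : forall m s, IZR (Z.abs s) <= IZR (Z.abs (s - m)) + IZR (Z.abs m)
   /\ 0 <= IZR (Z.abs m) /\ 0 <= IZR (Z.abs s) /\ 0 <= IZR (Z.abs (s - m))).
{ intros m s. rewrite <- plus_IZR. repeat split; apply IZR_le; lia. }
transitivity (Zsum (fun m => Zsum (fun s => k m (s - m)%Z * f s))).
{ apply Zsum_ext; intros m.
  rewrite <- (Zsum_shift (fun s => k m (s - m)%Z * f s) m).
  - apply Zsum_ext; intros n.
    replace (n + m - m)%Z with n by lia. replace (m + n)%Z with (n + m)%Z by lia. ring.
  - apply Zsummable_expdecay with (be - K); [lra|].
    exists (A * F * exp (be * IZR (Z.abs m))); split.
    { apply Rmult_le_pos; auto. apply exp_ge0. }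
    intros s. eapply Rle_trans; [apply Bd|]. rewrite (Rmult_assoc (A * F)), <- exp_plus.
    apply Rmult_le_compat_l; auto. apply Hexp.
    destruct (Tr m s) as (T1 & T2 & T3 & T4). nra. }
transitivity (Zsum (fun s => Zsum (fun m => k m (s - m)%Z * f s))).
2:{ apply Zsum_ext; intros s. now rewrite <- Zsum_scal_r. }
apply (Zsum_fubini (fun m s => k m (s - m)%Z * f s)) with (A * F) d; auto.
intros m s. eapply Rle_trans; [apply Bd|]. rewrite <- exp_plus.
apply Rmult_le_compat_l; auto. apply Hexp.
destruct (Tr m s) as (T1 & T2 & T3 & T4). nra.
Qed.

Lemma Zsum_is_derive (f f' : Z -> R -> R) (A k x0 : R) (d : posreal) :
  0 < k ->
  (forall n x, Rabs (x - x0) < d -> is_derive (f n) x (f' n x)) ->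
  (forall n x, Rabs (x - x0) < d -> Rabs (f' n x) <= A * exp (- (k * IZR (Z.abs n)))) ->
  Zsummable (fun n => f n x0) ->
  is_derive (fun x => Zsum (fun n => f n x)) x0 (Zsum (fun n => f' n x0)).
Proof.
intros Hk Hd Hb E.
set (b := fun n : Z => A * exp (- (k * IZR (Z.abs n)))).
assert (Zb : Zsummable b).
{ apply Zsummable_scal, Zsummable_expdecay with k; auto. exists 1; split; [lra|].
  intros n; rewrite Rabs_pos_eq; [lra|apply exp_ge0]. }
apply (Series_is_derive (fun n x => f (Z.of_nat n) x + f (- Z.of_nat n - 1)%Z x)
  (fun n x => f' (Z.of_nat n) x + f' (- Z.of_nat n - 1)%Z x)
  (fun n => b (Z.of_nat n) + b (- Z.of_nat n - 1)%Z) x0 d).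
- intros n x Hx. apply is_derive_Rplus; auto.
- intros n x Hx. eapply Rle_trans; [apply Rabs_triang|]. apply Rplus_le_compat; apply Hb; auto.
- apply Zsummable_ser; auto.
- apply (Zsummable_ser (fun n => f n x0)); auto.
Qed.

Lemma Zsum_delta c : Zsum (fun n => if Z.eqb n 0 then c else 0) = c.
Proof.
assert (E : Zsummable (fun n => if Z.eqb n 0 then c else 0)).
{ apply Zsummable_expdecay with 1; [lra|]. exists (Rabs c); split; [apply Rabs_pos|].
  intros n. destruct (Z.eqb_spec n 0) as [-> |_].
  - simpl. rewrite Rmult_0_r, Ropp_0, exp_0; lra.
  - rewrite Rabs_R0. apply Rmult_le_pos; [apply Rabs_pos|apply exp_ge0]. }
rewrite Zsum_even; auto.
- rewrite (Series_ext _ (fun n => 0 * 0)).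
  + rewrite Series_scal_l. simpl. ring.
  + intros n. replace (Z.eqb (Z.of_nat (S n)) 0) with false; [ring|]. symmetry. apply Z.eqb_neq. lia.
- intros n. destruct (Z.eqb_spec n 0) as [-> |H]; simpl; auto.
  replace (Z.eqb (- n) 0) with false; auto. symmetry; apply Z.eqb_neq; lia.
Qed.

(** * Theta functions and their moments *)

Lemma exp_le x y : x <= y -> exp x <= exp y.
Proof. intros [L|L]; [apply Rlt_le, exp_increasing; auto|rewrite L; lra]. Qed.

Lemma IZR_abs_ge0 n : 0 <= IZR (Z.abs n).
Proof. apply IZR_le; lia. Qed.


Lemma expdecay_mul k l f g : expdecay k f -> expdecay l g -> expdecay (k + l) (fun n => f n * g n).
Proof.
intros [A [HA H]] [B [HB H']]. exists (A * B); split; [apply Rmult_le_pos; auto|].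
intros n. rewrite Rabs_mult.
replace (A * B * exp (- ((k + l) * IZR (Z.abs n)))) with
  (A * exp (- (k * IZR (Z.abs n))) * (B * exp (- (l * IZR (Z.abs n))))).
- apply Rmult_le_compat; auto; apply Rabs_pos.
- replace (- ((k + l) * IZR (Z.abs n))) with (- (k * IZR (Z.abs n)) + - (l * IZR (Z.abs n))) by ring.
  rewrite exp_plus; ring.
Qed.

Lemma expdecay_pow (j : nat) : forall d, 0 < d -> expdecay (- d) (fun n => IZR n ^ j).
Proof.
induction j as [|j IH]; intros d Hd.
- exists 1; split; [lra|]. intros n; simpl. rewrite Rabs_R1, Rmult_1_l, <- exp_0 at 1.
  apply exp_le. generalize (IZR_abs_ge0 n); nra.
- simpl. replace (- d) with (- (d / 2) + - (d / 2)) by field.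
  apply expdecay_mul; [|apply IH; lra].
  exists (2 / d); split; [apply Rlt_le, Rdiv_lt_0_compat; lra|]. intros n.
  rewrite <- abs_IZR. generalize (exp_ineq1_le (d / 2 * IZR (Z.abs n))) (IZR_abs_ge0 n); intros E P.
  replace (- (- (d / 2) * IZR (Z.abs n))) with (d / 2 * IZR (Z.abs n)) by ring.
  apply Rle_trans with (2 / d * (d / 2 * IZR (Z.abs n))); [right; field; lra|].
  apply Rmult_le_compat_l; [apply Rlt_le, Rdiv_lt_0_compat; lra|lra].
Qed.

Definition gauss (y : R) (n : Z) : R := exp (- (IZR n ^ 2 * y)).

Lemma gauss_even y n : gauss y (- n) = gauss y n.
Proof. unfold gauss. rewrite opp_IZR. do 2 f_equal. ring. Qed.

Lemma expdecay_gauss y k : 0 < y -> expdecay k (gauss y).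
Proof.
(* The constant comes from completing the square in y n^2 - k |n|. *)
intros Hy. exists (exp (k ^ 2 / (4 * y))); split; [apply exp_ge0|].
intros n. unfold gauss. rewrite Rabs_pos_eq; [|apply exp_ge0].
rewrite <- exp_plus. apply exp_le.
assert (E : IZR n ^ 2 = IZR (Z.abs n) ^ 2).
{ rewrite abs_IZR. symmetry. apply pow2_abs. }
rewrite E.
assert (0 <= (2 * y * IZR (Z.abs n) - k) ^ 2 / (4 * y)).
{ apply Rdiv_le_0_compat; [apply pow2_ge_0|lra]. }
replace ((2 * y * IZR (Z.abs n) - k) ^ 2 / (4 * y)) with
 (k ^ 2 / (4 * y) + - (k * IZR (Z.abs n)) + IZR (Z.abs n) ^ 2 * y) in H by (field; lra).
lra.
Qed.

Lemma expdecay_pow_gauss y j k : 0 < y -> expdecay k (fun n => IZR n ^ j * gauss y n).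
Proof.
intros Hy. replace k with (Ropp 1 + (k + 1)) by ring.
apply expdecay_mul; [apply expdecay_pow; lra|apply expdecay_gauss; auto].
Qed.

(* [e = true] gives the hyperbolic functions, hence theta at an imaginary argument. *)
Definition eps (e : bool) : R := if e then 1 else -1.
Definition tcos (e : bool) (x : R) : R := if e then cosh x else cos x.
Definition tsin (e : bool) (x : R) : R := if e then sinh x else sin x.


Lemma tcos_plus e u v : tcos e (u + v) = tcos e u * tcos e v + eps e * (tsin e u * tsin e v).
Proof.
destruct e; simpl.
- unfold cosh, sinh. rewrite Ropp_plus_distr, !exp_plus. field.
- rewrite cos_plus; ring.
Qed.


Lemma tcos_opp e u : tcos e (- u) = tcos e u.
Proof.
destruct e; simpl; [unfold cosh; rewrite Ropp_involutive; field|apply cos_neg].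
Qed.
Lemma tsin_opp e u : tsin e (- u) = - tsin e u.
Proof.
destruct e; simpl; [unfold sinh; rewrite Ropp_involutive; field|apply sin_neg].
Qed.
Lemma tcos_0 e : tcos e 0 = 1.
Proof. destruct e; simpl; [apply cosh_0|apply cos_0]. Qed.
Lemma tsin_0 e : tsin e 0 = 0.
Proof. destruct e; simpl; [apply sinh_0|apply sin_0]. Qed.

Lemma tcos_derive e x : is_derive (tcos e) x (eps e * tsin e x).
Proof.
destruct e.
- change (is_derive cosh x (1 * sinh x)). unfold cosh, sinh. auto_derive; [auto|field].
- change (is_derive cos x (-1 * sin x)). auto_derive; [auto|ring].
Qed.
Lemma tsin_derive e x : is_derive (tsin e) x (tcos e x).
Proof.
destruct e.
- change (is_derive sinh x (cosh x)). unfold cosh, sinh. auto_derive; [auto|field].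
- change (is_derive sin x (cos x)). auto_derive; [auto|ring].
Qed.

Lemma exp_cosh_bound x : exp x <= exp (Rabs x) /\ exp (- x) <= exp (Rabs x).
Proof. split; apply exp_le; unfold Rabs; destruct Rcase_abs; lra. Qed.

Lemma one_le_exp_abs x : 1 <= exp (Rabs x).
Proof. rewrite <- exp_0 at 1. apply exp_le, Rabs_pos. Qed.

Lemma tcos_abs e x : Rabs (tcos e x) <= exp (Rabs x).
Proof.
generalize (exp_cosh_bound x) (one_le_exp_abs x) (exp_pos x) (exp_pos (- x)).
destruct e; simpl; intros.
- unfold cosh. apply Rabs_le; lra.
- generalize (COS_bound x); intros; apply Rabs_le; lra.
Qed.
Lemma tsin_abs e x : Rabs (tsin e x) <= exp (Rabs x).
Proof.
generalize (exp_cosh_bound x) (one_le_exp_abs x) (exp_pos x) (exp_pos (- x)).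
destruct e; simpl; intros.
- unfold sinh. apply Rabs_le; lra.
- generalize (SIN_bound x); intros; apply Rabs_le; lra.
Qed.

Lemma tcos_abs_n e x K n : Rabs x <= K -> Rabs (tcos e (IZR n * x)) <= exp (- (- K * IZR (Z.abs n))).
Proof.
intros H; eapply Rle_trans; [apply tcos_abs|]. rewrite Rabs_mult, <- abs_IZR. apply exp_le.
generalize (IZR_abs_ge0 n); nra.
Qed.
Lemma tsin_abs_n e x K n : Rabs x <= K -> Rabs (tsin e (IZR n * x)) <= exp (- (- K * IZR (Z.abs n))).
Proof.
intros H; eapply Rle_trans; [apply tsin_abs|]. rewrite Rabs_mult, <- abs_IZR. apply exp_le.
generalize (IZR_abs_ge0 n); nra.
Qed.

Lemma expdecay_tcos e x : expdecay (- Rabs x) (fun n => tcos e (IZR n * x)).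
Proof. exists 1; split; [lra|]; intros n. rewrite Rmult_1_l. apply tcos_abs_n; lra. Qed.
Lemma expdecay_tsin e x : expdecay (- Rabs x) (fun n => tsin e (IZR n * x)).
Proof. exists 1; split; [lra|]; intros n. rewrite Rmult_1_l. apply tsin_abs_n; lra. Qed.

(** Up to sign, the [k]-th derivative of theta in [x] is [thetac] for even [k] and [thetas] for odd
    [k]; for the other parity each of them vanishes. *)
Definition thetac (e : bool) (y : R) (k : nat) (x : R) : R :=
  Zsum (fun n => IZR n ^ k * gauss y n * tcos e (IZR n * x)).
Definition thetas (e : bool) (y : R) (k : nat) (x : R) : R :=
  Zsum (fun n => IZR n ^ k * gauss y n * tsin e (IZR n * x)).
Definition moment (y : R) (k : nat) : R := Zsum (fun n => IZR n ^ k * gauss y n).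

Lemma Zsummable_gauss_mul y k f K : 0 < y -> expdecay (- K) f -> Zsummable (fun n => IZR n ^ k * gauss y n * f n).
Proof.
intros Hy Hf. apply Zsummable_expdecay with ((K + 1) + - K); [lra|].
apply expdecay_mul; auto. apply expdecay_pow_gauss; auto.
Qed.
Lemma Zsummable_thetac e y k x : 0 < y -> Zsummable (fun n => IZR n ^ k * gauss y n * tcos e (IZR n * x)).
Proof. intros Hy. eapply Zsummable_gauss_mul; eauto. apply expdecay_tcos. Qed.
Lemma Zsummable_thetas e y k x : 0 < y -> Zsummable (fun n => IZR n ^ k * gauss y n * tsin e (IZR n * x)).
Proof. intros Hy. eapply Zsummable_gauss_mul; eauto. apply expdecay_tsin. Qed.
Lemma Zsummable_moment y k : 0 < y -> Zsummable (fun n => IZR n ^ k * gauss y n).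
Proof. intros Hy. apply Zsummable_expdecay with 1; [lra|apply expdecay_pow_gauss; auto]. Qed.

Lemma pow_opp_odd x k : Nat.odd k = true -> (- x) ^ k = - x ^ k.
Proof.
intros H. apply Nat.odd_spec in H. destruct H as [m ->].
rewrite !pow_add, !pow_mult. simpl. replace (- x * (- x * 1)) with (x * (x * 1)) by ring. ring.
Qed.
Lemma pow_opp_even x k : Nat.even k = true -> (- x) ^ k = x ^ k.
Proof.
intros H. apply Nat.even_spec in H. destruct H as [m ->].
rewrite !pow_mult. simpl. now replace (- x * (- x * 1)) with (x * (x * 1)) by ring.
Qed.

Lemma thetac_odd e y k x : 0 < y -> Nat.odd k = true -> thetac e y k x = 0.
Proof.
intros Hy O. apply Zsum_odd; [apply Zsummable_thetac; auto|]. intros n.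
rewrite gauss_even, opp_IZR, pow_opp_odd by auto.
replace (- IZR n * x) with (- (IZR n * x)) by ring. rewrite tcos_opp. ring.
Qed.
Lemma thetas_even e y k x : 0 < y -> Nat.even k = true -> thetas e y k x = 0.
Proof.
intros Hy O. apply Zsum_odd; [apply Zsummable_thetas; auto|]. intros n.
rewrite gauss_even, opp_IZR, pow_opp_even by auto.
replace (- IZR n * x) with (- (IZR n * x)) by ring. rewrite tsin_opp. ring.
Qed.
Lemma moment_odd y k : 0 < y -> Nat.odd k = true -> moment y k = 0.
Proof.
intros Hy O. apply Zsum_odd; [apply Zsummable_moment; auto|]. intros n.
rewrite gauss_even, opp_IZR, pow_opp_odd by auto. ring.
Qed.

Lemma thetac_at0 e y k : thetac e y k 0 = moment y k.
Proof. apply Zsum_ext; intros n. rewrite Rmult_0_r, tcos_0; ring. Qed.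
Lemma thetas_at0 e y k : thetas e y k 0 = 0.
Proof.
unfold thetas. rewrite (Zsum_ext _ (fun n => 0 * 0)); [rewrite Zsum_scal; ring|].
intros n. rewrite Rmult_0_r, tsin_0; ring.
Qed.

Lemma eps_abs e : Rabs (eps e) = 1.
Proof. destruct e; simpl; [apply Rabs_R1|]. rewrite Rabs_left; lra. Qed.

(** Treats the cosine-type and sine-type series at once, the sign of the derivative being carried by
    [c]. *)
Lemma gauss_series_derive y k x c (h h' : R -> R) : 0 < y -> Rabs c = 1 ->
  (forall z, is_derive h z (c * h' z)) -> (forall z, Rabs (h z) <= exp (Rabs z)) ->
  (forall z, Rabs (h' z) <= exp (Rabs z)) ->
  is_derive (fun x => Zsum (fun n => IZR n ^ k * gauss y n * h (IZR n * x))) x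
    (c * Zsum (fun n => IZR n ^ S k * gauss y n * h' (IZR n * x))).
Proof.
intros Hy Hc Hh Bh Bh'. rewrite <- Zsum_scal.
assert (Bn : forall (g : R -> R) K z n, (forall z, Rabs (g z) <= exp (Rabs z)) -> Rabs z <= K ->
   Rabs (g (IZR n * z)) <= exp (- (- K * IZR (Z.abs n)))).
{ intros g K z n Hg Hz. eapply Rle_trans; [apply Hg|]. rewrite Rabs_mult, <- abs_IZR. apply exp_le.
  generalize (IZR_abs_ge0 n); nra. }
(* Within distance [1] of [x] the factor [h'] grows at rate at most [Rabs x + 1], so a decay of rate
   [1] is left. *)
destruct (expdecay_pow_gauss y (S k) (Rabs x + 2) Hy) as [A [HA H]].
apply (Zsum_is_derive (fun n x => IZR n ^ k * gauss y n * h (IZR n * x))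
  (fun n x => c * (IZR n ^ (S k) * gauss y n * h' (IZR n * x))) A 1 x (mkposreal 1 Rlt_0_1)); [lra| | |].
- intros n z _.
  replace (c * (IZR n ^ S k * gauss y n * h' (IZR n * z))) with
    (IZR n ^ k * gauss y n * (IZR n * (c * h' (IZR n * z)))) by (simpl; ring).
  apply (is_derive_scal (fun x => h (IZR n * x))).
  apply (is_derive_comp h (fun x => IZR n * x)); [apply Hh|]. auto_derive; [auto|ring].
- intros n z Hz; change (Rabs (z - x) < 1) in Hz. rewrite Rabs_mult, Hc, Rmult_1_l, Rabs_mult.
  apply Rle_trans with (A * exp (- ((Rabs x + 2) * IZR (Z.abs n))) * exp (- (- (Rabs x + 1) * IZR (Z.abs n)))).
  + apply Rmult_le_compat; try apply Rabs_pos; auto. apply Bn; auto.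
    replace (Rabs z) with (Rabs (x + (z - x))) by (f_equal; ring). eapply Rle_trans; [apply Rabs_triang|lra].
  + rewrite Rmult_assoc, <- exp_plus. right. do 2 f_equal. ring.
- apply (Zsummable_gauss_mul y k _ (Rabs x)); auto. exists 1; split; [lra|]. intros n. rewrite Rmult_1_l. apply Bn; auto; lra.
Qed.

Lemma thetac_derive e y k x : 0 < y -> is_derive (thetac e y k) x (eps e * thetas e y (S k) x).
Proof. intros Hy. apply gauss_series_derive; auto using eps_abs, tcos_derive, tcos_abs, tsin_abs. Qed.

Lemma thetas_derive e y k x : 0 < y -> is_derive (thetas e y k) x (thetac e y (S k) x).
Proof.
intros Hy. rewrite <- (Rmult_1_l (thetac e y (S k) x)). apply gauss_series_derive; auto using Rabs_R1, tcos_abs, tsin_abs.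
intros z. rewrite Rmult_1_l. apply tsin_derive.
Qed.

Lemma moment_derive y k : 0 < y -> is_derive (fun y => moment y k) y (- moment y (k + 2)).
Proof.
intros Hy. unfold moment. rewrite <- Zsum_opp.
(* For |z - y| < y / 2 the weight [gauss z] is dominated by [gauss (y / 2)]. *)
assert (Hy2 : 0 < y / 2) by lra.
destruct (expdecay_pow_gauss (y / 2) (k + 2) 1 Hy2) as [A [HA H]].
apply (Zsum_is_derive (fun n y => IZR n ^ k * gauss y n)
  (fun n y => - (IZR n ^ (k + 2) * gauss y n)) A 1 y (mkposreal _ Hy2)).
- lra.
- intros n z _. unfold gauss. rewrite pow_add. auto_derive; [auto|].
  simpl pow. ring.
- intros n z Hz; change (Rabs (z - y) < y / 2) in Hz. eapply Rle_trans; [|apply H].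
  rewrite Rabs_Ropp, !Rabs_mult. apply Rmult_le_compat_l; [apply Rabs_pos|].
  unfold gauss. rewrite !Rabs_pos_eq by (apply exp_ge0). apply exp_le.
  generalize (pow2_ge_0 (IZR n)). revert Hz; unfold Rabs; destruct Rcase_abs; nra.
- apply Zsummable_moment; auto.
Qed.

(** Raise n + 1 <= 2^n to the power [6], the highest order of a moment that has to be estimated. *)
Lemma pow_le_geom (j n : nat) : (j <= 6)%nat -> INR (S n) ^ j <= 64 ^ n.
Proof.
intros Hj. apply Rle_trans with (INR (S n) ^ 6).
{ apply Rle_pow; auto. rewrite S_INR. generalize (pos_INR n); lra. }
assert (H : INR (S n) <= 2 ^ n).
{ induction n as [|n IH]; [simpl; lra|]. rewrite S_INR. simpl pow.
  assert (1 <= 2 ^ n) by (apply pow_R1_Rle; lra). lra. }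
replace 64 with (2 ^ 6) by ring. rewrite <- pow_mult, Nat.mul_comm, pow_mult.
apply pow_incr; split; auto. apply pos_INR.
Qed.

Lemma exp3_bound y : 3 <= y -> 0 < exp (- y) <= / 16.
Proof.
intros Hy; split; [apply exp_pos|]. rewrite exp_Ropp. apply Rinv_le_contravar; [lra|].
apply Rle_trans with (exp 3); [|apply exp_le; auto].
(* Cutting [3] into twenty pieces makes [exp t >= 1 + t] sharp enough: 1.15^20 > 16. *)
assert (E : exp 3 = exp (3 / 20) ^ 20).
{ simpl pow. rewrite Rmult_1_r, <- !exp_plus. f_equal. field. }
rewrite E. apply Rle_trans with ((1 + 3 / 20) ^ 20); [lra|].
apply pow_incr. generalize (exp_ineq1_le (3 / 20)); lra.
Qed.

(* From [n ^ 2 >= 3 n - 2] and [n ^ j <= 64 ^ (n - 1)]. *)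
Lemma term_geom y j n : 3 <= y -> (j <= 6)%nat ->
  0 <= IZR (Z.of_nat (S n)) ^ j * gauss y (Z.of_nat (S n)) <= exp (- y) * (/ 64) ^ n.
Proof.
intros Hy Hj. rewrite <- INR_IZR_INZ. unfold gauss. rewrite <- INR_IZR_INZ.
split; [apply Rmult_le_pos; [apply pow_le, pos_INR|apply exp_ge0]|].
generalize (exp3_bound y Hy). set (q := exp (- y)). intros Hq.
apply Rle_trans with (64 ^ n * (q * (q ^ 3) ^ n)).
- apply Rmult_le_compat; [apply pow_le, pos_INR|apply exp_ge0|apply pow_le_geom; auto|].
  assert (E : q * (q ^ 3) ^ n = exp (- ((1 + 3 * INR n) * y))).
  { replace (- ((1 + 3 * INR n) * y)) with (- y + INR n * (3 * - y)) by ring.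
    rewrite exp_plus. fold q. f_equal. clear.
    induction n as [|n IH]; [simpl; now rewrite Rmult_0_l, exp_0|].
    rewrite S_INR. change ((q ^ 3) ^ S n) with (q ^ 3 * (q ^ 3) ^ n). rewrite IH, Rmult_plus_distr_r, exp_plus, Rmult_1_l.
    replace (3 * - y) with (- y + - y + - y) by ring. rewrite !exp_plus. fold q. ring. }
  rewrite E. apply exp_le. rewrite S_INR. 
  assert (INR n <= INR n ^ 2).
  { destruct n; [simpl; lra|]. rewrite S_INR. generalize (pos_INR n); nra. }
  nra.
- replace (64 ^ n * (q * (q ^ 3) ^ n)) with (q * (64 * q ^ 3) ^ n) by (rewrite Rpow_mult_distr; ring).
  apply Rmult_le_compat_l; [lra|]. apply pow_incr. 
  assert (q ^ 2 <= / 256) by nra. split; [nra|]. simpl in *. nra.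
Qed.

Lemma moment_tail y j : 3 <= y -> (j <= 6)%nat ->
  exp (- y) <= Series (fun n => IZR (Z.of_nat (S n)) ^ j * gauss y (Z.of_nat (S n))) <= 64 / 63 * exp (- y).
Proof.
intros Hy Hj.
assert (G : is_series (fun n => (/ 64) ^ n) (/ (1 - / 64))).
{ apply is_series_geom. rewrite Rabs_pos_eq; lra. }
assert (EG : ex_series (fun n => exp (- y) * (/ 64) ^ n)).
{ apply ex_series_Rscal. eexists; exact G. }
assert (EX : ex_series (fun n => IZR (Z.of_nat (S n)) ^ j * gauss y (Z.of_nat (S n)))).
{ eapply ex_series_le_abs; [|exact EG]. intros n; simpl.
  rewrite Rabs_pos_eq; apply term_geom; auto. }
split.
- rewrite Series_incr_1 by auto.
  assert (0 <= Series (fun n => IZR (Z.of_nat (S (S n))) ^ j * gauss y (Z.of_nat (S (S n))))).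
  { apply Series_ge0; [intros n; apply term_geom; auto|].
    apply ex_series_incr_1 in EX; exact EX. }
  assert (E : IZR (Z.of_nat 1) ^ j * gauss y (Z.of_nat 1) = exp (- y)).
  { change (Z.of_nat 1) with 1%Z. unfold gauss. rewrite !pow1, Rmult_1_l. f_equal; ring. }
  lra.
- apply Rle_trans with (Series (fun n => exp (- y) * (/ 64) ^ n)).
  + apply Series_le; auto. intros n; apply term_geom; auto.
  + rewrite Series_scal_l. right.
    transitivity (exp (- y) * / (1 - / 64)); [f_equal; apply is_series_unique; exact G|field].
Qed.

Lemma moment_eq y j : 0 < y -> Nat.even j = true -> moment y j = 0 ^ j
  + 2 * Series (fun n => IZR (Z.of_nat (S n)) ^ j * gauss y (Z.of_nat (S n))).
Proof.
intros Hy Hj. unfold moment. rewrite (Zsum_even _ (Zsummable_moment y j Hy)).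
- unfold gauss at 1. replace (0 ^ 2 * y) with 0 by ring. rewrite Ropp_0, exp_0, Rmult_1_r. reflexivity.
- intros n. rewrite gauss_even, opp_IZR, pow_opp_even; auto.
Qed.

Lemma moment_bounds y j : 3 <= y -> (j <= 6)%nat -> Nat.even j = true ->
  0 ^ j + 2 * exp (- y) <= moment y j <= 0 ^ j + 2 * (64 / 63) * exp (- y).
Proof.
intros Hy Hj Ej. rewrite moment_eq by (auto; lra). generalize (moment_tail y j Hy Hj). lra.
Qed.

Lemma moment0_ge1 y : 3 <= y -> 1 <= moment y 0.
Proof.
intros Hy. generalize (moment_bounds y 0 Hy (Nat.le_0_l _) eq_refl) (exp_pos (- y)). simpl. lra.
Qed.

(** * The bilinear identity *)

Definition bilin (y : R) (j k : nat) (f : Z -> R) : R :=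
  Zsum (fun m => Zsum (fun n => IZR m ^ j * gauss y m * (IZR n ^ k * gauss y n) * f (m + n)%Z)).
(** For even [p] and [f s = tcos e (s x)] this is, up to sign, the Hirota derivative of order [p] of
    theta with itself. Leaving [f] free lets the same linear relation be tested on powers of [s],
    which gives relations between moments. *)
Definition hirota (y : R) (p : nat) (f : Z -> R) : R :=
  Zsum (fun m => Zsum (fun n => gauss y m * gauss y n * (IZR m - IZR n) ^ p * f (m + n)%Z)).
(** The sum over [m] that remains for fixed s = m + n, where m - n = 2 m - s and m^2 + n^2 = (s^2 +
    (2 m - s)^2) / 2. *)
Definition parsum (y : R) (p : nat) (s : Z) : R :=
  Zsum (fun m => (2 * IZR m - IZR s) ^ p * exp (- ((2 * IZR m - IZR s) ^ 2 * (y / 2)))).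

Lemma expdecay_translate f K m : expdecay (- K) f -> 0 <= K -> expdecay (- K) (fun n => f (m + n)%Z).
Proof.
intros [F [HF H]] HK. exists (F * exp (K * IZR (Z.abs m))); split.
{ apply Rmult_le_pos; auto; apply exp_ge0. }
intros n. eapply Rle_trans; [apply H|]. rewrite Rmult_assoc, <- exp_plus.
apply Rmult_le_compat_l; auto. apply exp_le.
assert (IZR (Z.abs (m + n)) <= IZR (Z.abs m) + IZR (Z.abs n)) by (rewrite <- plus_IZR; apply IZR_le; lia).
nra.
Qed.

Lemma Zsummable_bilin_inner y j k f K m : 0 < y -> 0 <= K -> expdecay (- K) f ->
  Zsummable (fun n => IZR m ^ j * gauss y m * (IZR n ^ k * gauss y n) * f (m + n)%Z).
Proof.
intros Hy HK Hf.
apply (Zsummable_ext (fun n => (IZR m ^ j * gauss y m) * (IZR n ^ k * gauss y n * f (m + n)%Z))); [intros; ring|].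
apply Zsummable_scal. eapply Zsummable_gauss_mul; auto. apply expdecay_translate; eauto.
Qed.

Lemma Zsummable_bilin_outer y j k f K : 0 < y -> 0 <= K -> expdecay (- K) f ->
  Zsummable (fun m => Zsum (fun n => IZR m ^ j * gauss y m * (IZR n ^ k * gauss y n) * f (m + n)%Z)).
Proof.
intros Hy HK [F [HF Hf]].
set (w := fun n : Z => exp (- (- K * IZR (Z.abs n)))).
assert (Hw : expdecay (- K) w).
{ exists 1; split; [lra|]. intros n; unfold w. rewrite Rabs_pos_eq; [lra|apply exp_ge0]. }
assert (E2 : Zsummable (fun n => Rabs (IZR n ^ k * gauss y n * w n))).
{ apply Zsummable_expdecay with 1; [lra|].
  destruct (expdecay_mul _ _ _ _ (expdecay_pow_gauss y k (K + 1) Hy) Hw) as [A [HA H]].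
  exists A; split; auto. intros n; rewrite Rabs_Rabsolu. eapply Rle_trans; [apply H|].
  right; do 3 f_equal; ring. }
apply (Zsummable_le _ (fun m => (F * Zsum (fun n => Rabs (IZR n ^ k * gauss y n * w n))) *
   Rabs (IZR m ^ j * gauss y m * w m))).
2:{ apply Zsummable_scal. apply Zsummable_expdecay with 1; [lra|].
  destruct (expdecay_mul _ _ _ _ (expdecay_pow_gauss y j (K + 1) Hy) Hw) as [A [HA H]].
  exists A; split; auto. intros n; rewrite Rabs_Rabsolu. eapply Rle_trans; [apply H|].
  right; do 3 f_equal; ring. }
intros m.
replace (F * Zsum (fun n => Rabs (IZR n ^ k * gauss y n * w n)) * Rabs (IZR m ^ j * gauss y m * w m))
  with (Zsum (fun n => (F * Rabs (IZR m ^ j * gauss y m * w m)) * Rabs (IZR n ^ k * gauss y n * w n)))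
  by (rewrite Zsum_scal; ring).
apply Zsum_abs_le; [|apply Zsummable_scal; auto].
intros n.
replace (F * Rabs (IZR m ^ j * gauss y m * w m) * Rabs (IZR n ^ k * gauss y n * w n)) with
 (Rabs (IZR m ^ j * gauss y m * (IZR n ^ k * gauss y n)) * (F * (w m * w n))).
2:{ rewrite !Rabs_mult. rewrite (Rabs_pos_eq (w m)), (Rabs_pos_eq (w n)); [ring| |]; apply exp_ge0. }
rewrite Rabs_mult. apply Rmult_le_compat_l; [apply Rabs_pos|].
eapply Rle_trans; [apply Hf|]. apply Rmult_le_compat_l; auto. unfold w. rewrite <- exp_plus.
apply exp_le.
assert (IZR (Z.abs (m + n)) <= IZR (Z.abs m) + IZR (Z.abs n)) by (rewrite <- plus_IZR; apply IZR_le; lia).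
nra.
Qed.

Lemma Zsum_lin5 (c0 c1 c2 c3 c4 : R) (a0 a1 a2 a3 a4 : Z -> R) :
  Zsummable a0 -> Zsummable a1 -> Zsummable a2 -> Zsummable a3 -> Zsummable a4 ->
  Zsum (fun n => c0 * a0 n + c1 * a1 n + c2 * a2 n + c3 * a3 n + c4 * a4 n) =
  c0 * Zsum a0 + c1 * Zsum a1 + c2 * Zsum a2 + c3 * Zsum a3 + c4 * Zsum a4.
Proof.
intros. rewrite !Zsum_plus; repeat apply Zsummable_plus; try apply Zsummable_scal; auto.
now rewrite !Zsum_scal.
Qed.

(** Five terms, as many as (m - n)^4 has monomials; shorter expansions are padded with zero
    coefficients. *)
Lemma bilin_lin5 y (c0 c1 c2 c3 c4 : R) (j0 k0 j1 k1 j2 k2 j3 k3 j4 k4 : nat) f K :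
  0 < y -> 0 <= K -> expdecay (- K) f ->
  Zsum (fun m => Zsum (fun n => (c0 * (IZR m ^ j0 * IZR n ^ k0) + c1 * (IZR m ^ j1 * IZR n ^ k1)
     + c2 * (IZR m ^ j2 * IZR n ^ k2) + c3 * (IZR m ^ j3 * IZR n ^ k3) + c4 * (IZR m ^ j4 * IZR n ^ k4))
     * (gauss y m * gauss y n) * f (m + n)%Z)) =
  c0 * bilin y j0 k0 f + c1 * bilin y j1 k1 f + c2 * bilin y j2 k2 f + c3 * bilin y j3 k3 f + c4 * bilin y j4 k4 f.
Proof.
intros Hy HK Hf. unfold bilin. rewrite <- Zsum_lin5; try (eapply Zsummable_bilin_outer; eauto).
apply Zsum_ext; intros m. rewrite <- Zsum_lin5; try (eapply Zsummable_bilin_inner; eauto).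
apply Zsum_ext; intros n. ring.
Qed.

Lemma hirota_4 y f K : 0 < y -> 0 <= K -> expdecay (- K) f ->
  hirota y 4 f = bilin y 0 4 f - 4 * bilin y 1 3 f + 6 * bilin y 2 2 f - 4 * bilin y 3 1 f + bilin y 4 0 f.
Proof.
intros Hy HK Hf.
transitivity (1 * bilin y 0 4 f + (-4) * bilin y 1 3 f + 6 * bilin y 2 2 f + (-4) * bilin y 3 1 f + 1 * bilin y 4 0 f);
  [|ring].
rewrite <- (bilin_lin5 y _ _ _ _ _ _ _ _ _ _ _ _ _ _ _ f K); auto.
unfold hirota; apply Zsum_ext; intros m; apply Zsum_ext; intros n; ring.
Qed.

Lemma hirota_2 y f K : 0 < y -> 0 <= K -> expdecay (- K) f ->
  hirota y 2 f = bilin y 0 2 f - 2 * bilin y 1 1 f + bilin y 2 0 f.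
Proof.
intros Hy HK Hf.
transitivity (1 * bilin y 0 2 f + (-2) * bilin y 1 1 f + 1 * bilin y 2 0 f + 0 * bilin y 0 0 f + 0 * bilin y 0 0 f);
  [|ring].
rewrite <- (bilin_lin5 y _ _ _ _ _ _ _ _ _ _ _ _ _ _ _ f K); auto.
unfold hirota; apply Zsum_ext; intros m; apply Zsum_ext; intros n; ring.
Qed.

Lemma hirota_0 y f : hirota y 0 f = bilin y 0 0 f.
Proof. unfold hirota, bilin; apply Zsum_ext; intros m; apply Zsum_ext; intros n; ring. Qed.

Lemma hirota_conv y p f K : 0 < y -> 0 <= K -> expdecay (- K) f ->
  hirota y p f = Zsum (fun s => exp (- (IZR s ^ 2 * (y / 2))) * parsum y p s * f s).
Proof.
intros Hy HK Hf. unfold hirota.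
(* The factor (m - n)^p is at most e^(p (|m| + |n|)); after paying for it the Gaussians still decay
   at the rate [K + 2]. *)
destruct (expdecay_gauss y (K + 2 + INR p) Hy) as [A [HA Ha]].
rewrite (Zsum_conv (fun m n => gauss y m * gauss y n * (IZR m - IZR n) ^ p) f (A * A) (K + 2) (K + 1) K); auto; try lra.
- apply Zsum_ext; intros s. f_equal. unfold parsum. rewrite <- Zsum_scal. apply Zsum_ext; intros m.
  unfold gauss. rewrite minus_IZR.
  replace (exp (- (IZR s ^ 2 * (y / 2))) *
    ((2 * IZR m - IZR s) ^ p * exp (- ((2 * IZR m - IZR s) ^ 2 * (y / 2))))) with
    (exp (- (IZR s ^ 2 * (y / 2)) + - ((2 * IZR m - IZR s) ^ 2 * (y / 2))) * (2 * IZR m - IZR s) ^ p)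
    by (rewrite exp_plus; ring).
  rewrite <- exp_plus. f_equal; [f_equal; field | f_equal; ring].
- intros m n. rewrite !Rabs_mult.
  apply Rle_trans with (A * exp (- ((K + 2 + INR p) * IZR (Z.abs m))) * (A * exp (- ((K + 2 + INR p) * IZR (Z.abs n))))
     * exp (INR p * (IZR (Z.abs m) + IZR (Z.abs n)))).
  + apply Rmult_le_compat; try apply Rabs_pos; try (apply Rmult_le_pos; apply Rabs_pos).
    * apply Rmult_le_compat; try apply Rabs_pos; auto.
    * rewrite <- RPow_abs. replace (exp (INR p * (IZR (Z.abs m) + IZR (Z.abs n)))) with
        (exp (IZR (Z.abs m) + IZR (Z.abs n)) ^ p).
      { apply pow_incr; split; [apply Rabs_pos|].
        apply Rle_trans with (IZR (Z.abs m) + IZR (Z.abs n)).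
        - rewrite <- minus_IZR, <- abs_IZR, <- plus_IZR. apply IZR_le; lia.
        - generalize (exp_ineq1_le (IZR (Z.abs m) + IZR (Z.abs n))); lra. }
      clear. induction p as [|p IH].
      { simpl. rewrite Rmult_0_l, exp_0; reflexivity. }
      rewrite S_INR. simpl pow. rewrite IH, <- exp_plus. f_equal; ring.
  + match goal with |- A * ?e1 * (A * ?e2) * ?e3 <= _ =>
      replace (A * e1 * (A * e2) * e3) with (A * A * (e1 * e2 * e3)) by ring end.
    rewrite <- !exp_plus. apply Rmult_le_compat_l; [apply Rmult_le_pos; auto|]. apply exp_le.
    generalize (IZR_abs_ge0 m) (IZR_abs_ge0 n); nra.
Qed.

Lemma Zsummable_parsum y p s : 0 < y ->
  Zsummable (fun m => (2 * IZR m - IZR s) ^ p * exp (- ((2 * IZR m - IZR s) ^ 2 * (y / 2)))).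
Proof.
intros Hy. apply Zsummable_expdecay with 1; [lra|].
assert (Hy2 : 0 < y / 2) by lra.
destruct (expdecay_pow_gauss (y / 2) p 1 Hy2) as [A [HA H]].
exists (A * exp (IZR (Z.abs s))); split; [apply Rmult_le_pos; auto; apply exp_ge0|].
intros m. specialize (H (2 * m - s)%Z). unfold gauss in H. rewrite minus_IZR, mult_IZR in H.
eapply Rle_trans; [exact H|]. rewrite Rmult_assoc, <- exp_plus.
apply Rmult_le_compat_l; auto. apply exp_le.
assert (IZR (Z.abs m) <= IZR (Z.abs s) + IZR (Z.abs (2 * m - s))) by (rewrite <- plus_IZR; apply IZR_le; lia).
lra.
Qed.

Lemma parsum_shift y p s t : 0 < y -> parsum y p (s + 2 * t) = parsum y p s.
Proof.
intros Hy. unfold parsum. rewrite <- (Zsum_shift _ t (Zsummable_parsum y p (s + 2 * t) Hy)).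
apply Zsum_ext; intros m. rewrite !plus_IZR, mult_IZR.
replace (2 * (IZR m + IZR t) - (IZR s + 2 * IZR t)) with (2 * IZR m - IZR s) by ring. reflexivity.
Qed.

Lemma parsum_parity y p s : 0 < y -> parsum y p s = parsum y p 0 \/ parsum y p s = parsum y p 1.
Proof.
intros Hy. destruct (Z.Even_or_Odd s) as [[t ->]|[t ->]]; [left|right].
- now rewrite <- (parsum_shift y p 0 t Hy).
- rewrite <- (parsum_shift y p 1 t Hy). f_equal; lia.
Qed.

Lemma parsum_0 y p : parsum y p 0 = 2 ^ p * moment (2 * y) p.
Proof.
unfold parsum, moment. rewrite <- Zsum_scal. apply Zsum_ext; intros m. unfold gauss.
rewrite Rminus_0_r, Rpow_mult_distr, Rmult_assoc. do 4 f_equal. field.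
Qed.

(** This is the determinant of the system solved in [hirota_dependent]. On the odd class (2 m - 1)^2
    >= 1, so the second moment dominates the zeroth; on the even class the leading term [m = 0]
    contributes to the zeroth moment only. *)
Lemma parsum_det y : 3 <= y -> parsum y 2 0 * parsum y 0 1 < parsum y 0 0 * parsum y 2 1.
Proof.
intros Hy. assert (Hy0 : 0 < y) by lra.
assert (A1 : parsum y 0 1 <= parsum y 2 1).
{ apply Zsum_le; [|apply Zsummable_parsum; auto]. intros m. rewrite pow_O.
  generalize (exp_pos (- ((2 * IZR m - 1) ^ 2 * (y / 2)))). intros P.
  assert (1 <= (2 * IZR m - 1) ^ 2).
  { rewrite <- mult_IZR, <- minus_IZR, pow_IZR. apply IZR_le.
    change (Z.of_nat 2) with 2%Z. nia. }
  split; nra. }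
assert (A2 : exp (- (y / 2)) <= parsum y 0 1).
{ rewrite <- (Zsum_delta (exp (- (y / 2)))). apply Zsum_le; [|apply Zsummable_parsum; auto].
  intros n. rewrite pow_O, Rmult_1_l. destruct (Z.eqb_spec n 0) as [-> |_]; split; try (apply exp_ge0); try lra.
  apply exp_le. lra. }
assert (H2 : 3 <= 2 * y) by lra.
generalize (moment_bounds (2 * y) 2 H2 ltac:(lia) eq_refl) (moment0_ge1 (2 * y) H2) (exp3_bound (2 * y) H2) (exp_pos (- (y / 2))).
rewrite !parsum_0. simpl. nra.
Qed.

(* The inner sum in [hirota_conv] only depends on the parity of [s], so the three
   functionals [hirota y 4], [hirota y 2], [hirota y 0] live in a plane. *)
Lemma hirota_dependent y : 3 <= y -> exists k1 k0, forall f K, 0 <= K -> expdecay (- K) f ->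
  hirota y 4 f = k1 * hirota y 2 f + k0 * hirota y 0 f.
Proof.
intros Hy. assert (Hy0 : 0 < y) by lra.
set (D := parsum y 0 0 * parsum y 2 1 - parsum y 2 0 * parsum y 0 1).
assert (HD : D <> 0) by (generalize (parsum_det y Hy); unfold D; lra).
(* Cramer's rule for the two equations coming from the even and the odd class. *)
set (k1 := (parsum y 0 0 * parsum y 4 1 - parsum y 4 0 * parsum y 0 1) / D).
set (k0 := (parsum y 4 0 * parsum y 2 1 - parsum y 2 0 * parsum y 4 1) / D).
assert (E : forall s, parsum y 4 s = k1 * parsum y 2 s + k0 * parsum y 0 s).
{ intros s.
  assert (P : (parsum y 4 s = parsum y 4 0 /\ parsum y 2 s = parsum y 2 0 /\ parsum y 0 s = parsum y 0 0) \/
   (parsum y 4 s = parsum y 4 1 /\ parsum y 2 s = parsum y 2 1 /\ parsum y 0 s = parsum y 0 1)).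
  { destruct (Z.Even_or_Odd s) as [[t ->]|[t ->]]; [left|right].
    - repeat split; match goal with |- parsum ?y ?p _ = _ => rewrite <- (parsum_shift y p 0 t Hy0) end; f_equal; lia.
    - repeat split; match goal with |- parsum ?y ?p _ = _ => rewrite <- (parsum_shift y p 1 t Hy0) end; f_equal; lia. }
  destruct P as [(-> & -> & ->)|(-> & -> & ->)]; unfold k1, k0; unfold D in *; field; auto. }
exists k1, k0. intros f K HK Hf.
assert (zex_W : forall p, Zsummable (fun s => exp (- (IZR s ^ 2 * (y / 2))) * parsum y p s * f s)).
{ intros p. destruct Hf as [F [HF Hf]].
  apply (Zsummable_le _ (fun s => (Rabs (parsum y p 0) + Rabs (parsum y p 1)) *
    Rabs (IZR s ^ 0 * gauss (y / 2) s * f s))).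
  - intros s. rewrite !Rabs_mult, pow_O, Rabs_R1, Rmult_1_l.
    replace (Rabs (exp (- (IZR s ^ 2 * (y / 2)))) * Rabs (parsum y p s) * Rabs (f s)) with
      (Rabs (parsum y p s) * (Rabs (gauss (y / 2) s) * Rabs (f s))) by (unfold gauss; ring).
    apply Rmult_le_compat_r; [apply Rmult_le_pos; apply Rabs_pos|].
    generalize (Rabs_pos (parsum y p 0)) (Rabs_pos (parsum y p 1)).
    destruct (parsum_parity y p s Hy0) as [-> | ->]; lra.
  - apply Zsummable_scal. assert (Hy2 : 0 < y / 2) by lra.
    assert (Hf' : expdecay (- K) f) by (exists F; auto).
    destruct (Zsummable_gauss_mul (y / 2) 0 f K Hy2 Hf') as [Z1 Z2].
    split; [eapply ex_series_ext; [|exact Z1]|eapply ex_series_ext; [|exact Z2]];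
      intros n; simpl; now rewrite Rabs_Rabsolu. }
rewrite !(hirota_conv y _ f K) by auto. rewrite <- !Zsum_scal, <- Zsum_plus.
- apply Zsum_ext; intros s. rewrite E. ring.
- apply Zsummable_scal, zex_W.
- apply Zsummable_scal, zex_W.
Qed.

(** * Moment ratios *)

Lemma bilin_tcos e y j k x : 0 < y ->
  bilin y j k (fun n => tcos e (IZR n * x)) = thetac e y j x * thetac e y k x + eps e * (thetas e y j x * thetas e y k x).
Proof.
intros Hy. unfold bilin.
rewrite (Zsum_ext _ (fun m => thetac e y k x * (IZR m ^ j * gauss y m * tcos e (IZR m * x))
   + eps e * thetas e y k x * (IZR m ^ j * gauss y m * tsin e (IZR m * x)))).
- rewrite Zsum_plus by (apply Zsummable_scal; apply Zsummable_thetac || apply Zsummable_thetas; auto).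
  rewrite !Zsum_scal. unfold thetac, thetas. ring.
- intros m.
  rewrite (Zsum_ext _ (fun n => (IZR m ^ j * gauss y m * tcos e (IZR m * x)) * (IZR n ^ k * gauss y n * tcos e (IZR n * x))
   + (eps e * (IZR m ^ j * gauss y m * tsin e (IZR m * x))) * (IZR n ^ k * gauss y n * tsin e (IZR n * x)))).
  + rewrite Zsum_plus by (apply Zsummable_scal; apply Zsummable_thetac || apply Zsummable_thetas; auto).
    rewrite !Zsum_scal. unfold thetac, thetas. ring.
  + intros n. rewrite plus_IZR, Rmult_plus_distr_r, tcos_plus. ring.
Qed.

(** Multiplication by s = m + n acts on the pair of indices [(j, k)] like a derivation. *)
Lemma bilin_succ y j k f K : 0 < y -> 0 <= K -> expdecay (- K) f ->
  bilin y j k (fun s => IZR s * f s) = bilin y (S j) k f + bilin y j (S k) f.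
Proof.
intros Hy HK Hf.
transitivity (1 * bilin y (S j) k f + 1 * bilin y j (S k) f + 0 * bilin y 0 0 f + 0 * bilin y 0 0 f + 0 * bilin y 0 0 f);
  [|ring].
rewrite <- (bilin_lin5 y _ _ _ _ _ _ _ _ _ _ _ _ _ _ _ f K); auto.
unfold bilin; apply Zsum_ext; intros m; apply Zsum_ext; intros n. rewrite plus_IZR. simpl pow; ring.
Qed.

Lemma bilin_1 y j k : bilin y j k (fun _ => 1) = moment y j * moment y k.
Proof.
unfold bilin, moment. rewrite <- Zsum_scal_r. apply Zsum_ext; intros m. rewrite <- Zsum_scal.
apply Zsum_ext; intros n. ring.
Qed.

Lemma expdecay_1 : expdecay (- 0) (fun _ => 1).
Proof. exists 1; split; [lra|]. intros n. rewrite Ropp_0, Rmult_0_l, Ropp_0, exp_0, Rabs_R1; lra. Qed.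

Lemma expdecay_s j : expdecay (- 1) (fun s => IZR s ^ j * 1).
Proof.
destruct (expdecay_pow j 1 Rlt_0_1) as [A [HA H]]. exists A; split; auto.
intros n; rewrite Rmult_1_r. apply H.
Qed.

Lemma bilin_s2 y j k : 0 < y ->
  bilin y j k (fun s => IZR s ^ 2 * 1) =
  moment y (2 + j) * moment y k + 2 * (moment y (1 + j) * moment y (1 + k)) + moment y j * moment y (2 + k).
Proof.
intros Hy.
transitivity (bilin y j k (fun s => IZR s * (IZR s ^ 1 * 1))).
{ unfold bilin; apply Zsum_ext; intros m; apply Zsum_ext; intros n. ring. }
rewrite (bilin_succ y j k _ 1); auto; [|lra|apply expdecay_s].
transitivity (bilin y (S j) k (fun s => IZR s * 1) + bilin y j (S k) (fun s => IZR s * 1)).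
{ f_equal; unfold bilin; apply Zsum_ext; intros m; apply Zsum_ext; intros n; ring. }
rewrite !(bilin_succ y _ _ _ 0); auto; try lra; try apply expdecay_1.
rewrite !bilin_1. simpl. ring.
Qed.

Lemma bilin_s4 y j k : 0 < y ->
  bilin y j k (fun s => IZR s ^ 4 * 1) =
  moment y (4 + j) * moment y k + 4 * (moment y (3 + j) * moment y (1 + k)) + 6 * (moment y (2 + j) * moment y (2 + k))
  + 4 * (moment y (1 + j) * moment y (3 + k)) + moment y j * moment y (4 + k).
Proof.
intros Hy.
transitivity (bilin y j k (fun s => IZR s * (IZR s ^ 3 * 1))).
{ unfold bilin; apply Zsum_ext; intros m; apply Zsum_ext; intros n. ring. }
rewrite (bilin_succ y j k _ 1); auto; [|lra|apply expdecay_s].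
transitivity (bilin y (S j) k (fun s => IZR s * (IZR s ^ 2 * 1)) + bilin y j (S k) (fun s => IZR s * (IZR s ^ 2 * 1))).
{ f_equal; unfold bilin; apply Zsum_ext; intros m; apply Zsum_ext; intros n; ring. }
rewrite !(bilin_succ y _ _ _ 1); auto; try lra; try apply expdecay_s.
rewrite !bilin_s2; auto. simpl. ring.
Qed.

(** [mu2] has the sign opposite to [p] of the overview: comparing [lambert_der_0] and [logth2_0] at
    [x = 0] gives [lambert y 1 = - mu2 y]. *)
Definition mu2 (y : R) : R := moment y 2 / moment y 0.
Definition mu4 (y : R) : R := moment y 4 / moment y 0.
Definition mu6 (y : R) : R := moment y 6 / moment y 0.
Definition mu8 (y : R) : R := moment y 8 / moment y 0.
(* The coefficients of [u'' = r + s u - 6 u ^ 2]. *)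
Definition ell_r (y : R) : R := mu4 y - 3 * mu2 y ^ 2.
Definition ell_s (y : R) : R := (- mu6 y + 15 * mu2 y * mu4 y - 30 * mu2 y ^ 3) / ell_r y.

(** With q = e^(-y) <= 1/16, the moments of order 2, 4 and 6 all lie between 2 q and 2 (64/63) q, so
    they agree up to the factor 64/63; and 2 (64/63) / 16 < 13/100. *)
Lemma mu_bounds y : 3 <= y ->
  0 < mu2 y <= 13 / 100 /\ 63 / 64 * mu2 y <= mu4 y <= 64 / 63 * mu2 y /\ 63 / 64 * mu2 y <= mu6 y <= 64 / 63 * mu2 y.
Proof.
intros Hy. generalize (exp3_bound y Hy) (moment0_ge1 y Hy).
generalize (moment_bounds y 2 Hy ltac:(lia) eq_refl) (moment_bounds y 4 Hy ltac:(lia) eq_refl) (moment_bounds y 6 Hy ltac:(lia) eq_refl).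
rewrite !pow_i by lia. unfold mu2, mu4, mu6. unfold Rdiv at 1 4 6 9 11 14.
set (q := exp (- y)). set (M0 := moment y 0). intros H2 H4 H6 Hq H0.
assert (Hi : 0 < / M0 <= 1).
{ split; [apply Rinv_0_lt_compat; lra|]. rewrite <- Rinv_1. apply Rinv_le_contravar; lra. }
unfold Rdiv; repeat split; try (apply Rmult_lt_0_compat; lra);
  try (rewrite <- Rmult_assoc; apply Rmult_le_compat_r; lra); nra.
Qed.

Lemma ell_r_bounds y : 3 <= y -> 59 / 100 * mu2 y <= ell_r y <= 64 / 63 * mu2 y.
Proof. intros Hy. generalize (mu_bounds y Hy). unfold ell_r. intros. nra. Qed.

Lemma ell_r_pos y : 3 <= y -> 0 < ell_r y.
Proof. intros Hy. generalize (mu_bounds y Hy) (ell_r_bounds y Hy). lra. Qed.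

(** Says that [ellZ y < 1], as required by [quarter_period]. The rough estimate |s| <= 3 suffices,
    since r <= (64/63) (13/100). *)
Lemma ellZ_sqr_lt1 y : 3 <= y -> ell_s y ^ 2 / 16 + 2 * ell_r y < 1.
Proof.
intros Hy. generalize (mu_bounds y Hy) (ell_r_bounds y Hy) (ell_r_pos y Hy).
set (A := mu2 y). set (B := mu4 y). set (C := mu6 y). intros (HA & HB & HC) Hr Hp.
assert (E : ell_s y * ell_r y = - C + 15 * A * B - 30 * A ^ 3) by (unfold ell_s; fold A B C; field; lra).
assert (N : -3 * ell_r y <= - C + 15 * A * B - 30 * A ^ 3 <= 3 * ell_r y).
{ assert (0 <= A * B <= 133 / 1000 * A) by nra. assert (0 <= A ^ 3 <= 17 / 1000 * A) by (simpl; nra). lra. }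
rewrite <- E in N. assert (-3 <= ell_s y <= 3) by nra. nra.
Qed.

(** One dependence tested on [tcos e (s x)], [1], s^2 and s^4. The second and third relations
    determine [k0] and [k1]; the last one expresses [mu8], which closes the differential system in
    [y]. *)
Lemma moment_rel y : 3 <= y -> exists k1 k0,
  (forall e x, thetac e y 0 x * thetac e y 4 x - 4 * eps e * thetas e y 1 x * thetas e y 3 x + 3 * thetac e y 2 x ^ 2
     = k1 * (thetac e y 0 x * thetac e y 2 x - eps e * thetas e y 1 x ^ 2) + k0 * thetac e y 0 x ^ 2) /\
  mu4 y + 3 * mu2 y ^ 2 = k1 * mu2 y + k0 /\
  mu6 y - mu2 y * mu4 y = k1 * (mu4 y - mu2 y ^ 2) + 2 * k0 * mu2 y /\
  mu8 y - 4 * mu2 y * mu6 y + 3 * mu4 y ^ 2 = k1 * (mu6 y - mu2 y * mu4 y) + 2 * k0 * (mu4 y + 3 * mu2 y ^ 2).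
Proof.
intros Hy. assert (Hy0 : 0 < y) by lra. 
generalize (moment0_ge1 y Hy). intros HM0.
destruct (hirota_dependent y Hy) as [k1 [k0 H]].
(* By the symmetry in [m] and [n] the orders 4 and 2 come out doubled and the order 0 does not;
   dividing by [2] halves [k0] only. *)
exists k1, (k0 / 2).
assert (O : forall k, Nat.odd k = true -> moment y k = 0) by (intros; apply moment_odd; auto).
repeat split.
- intros e x. specialize (H _ _ (Rabs_pos x) (expdecay_tcos e x)).
  rewrite (hirota_4 y _ (Rabs x)), (hirota_2 y _ (Rabs x)), hirota_0 in H; auto; try apply Rabs_pos; try apply expdecay_tcos.
  rewrite !bilin_tcos in H by auto.
  rewrite !(thetas_even e y 0), !(thetas_even e y 2), !(thetas_even e y 4), !(thetac_odd e y 1), !(thetac_odd e y 3) in H by auto.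
  lra.
- specialize (H _ _ (Rle_refl 0) expdecay_1).
  rewrite (hirota_4 y _ 0), (hirota_2 y _ 0), hirota_0 in H; auto; try lra; try apply expdecay_1.
  rewrite !bilin_1 in H. rewrite (O 1%nat), (O 3%nat) in H by auto.
  unfold mu2, mu4. apply Rmult_eq_reg_r with (2 * moment y 0 ^ 2); [|nra].
  field_simplify; [|lra|lra]. lra.
- specialize (H _ _ Rle_0_1 (expdecay_s 2)).
  rewrite (hirota_4 y _ 1), (hirota_2 y _ 1), hirota_0 in H; auto; try lra; try apply expdecay_s.
  rewrite !bilin_s2 in H by auto. simpl Nat.add in H. rewrite (O 1%nat), (O 3%nat), (O 5%nat) in H by auto.
  unfold mu2, mu4, mu6. apply Rmult_eq_reg_r with (2 * moment y 0 ^ 2); [|nra].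
  field_simplify; [|lra|lra]. lra.
- specialize (H _ _ Rle_0_1 (expdecay_s 4)).
  rewrite (hirota_4 y _ 1), (hirota_2 y _ 1), hirota_0 in H; auto; try lra; try apply expdecay_s.
  rewrite !bilin_s4 in H by auto. simpl Nat.add in H.
  rewrite (O 1%nat), (O 3%nat), (O 5%nat), (O 7%nat) in H by auto.
  unfold mu2, mu4, mu6, mu8. apply Rmult_eq_reg_r with (2 * moment y 0 ^ 2); [|nra].
  field_simplify; [|lra|lra]. lra.
Qed.

(** * The differential equations in y and in x *)

Lemma ratio_derive y k : 3 <= y ->
  is_derive (fun y => moment y k / moment y 0) y (- (moment y (k + 2) / moment y 0) + mu2 y * (moment y k / moment y 0)).
Proof.
intros Hy. assert (Hy0 : 0 < y) by lra. generalize (moment0_ge1 y Hy). intros H0.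
generalize (is_derive_div (fun y => moment y k) (fun y => moment y 0) y _ _
  (moment_derive y k Hy0) (moment_derive y 0 Hy0)). intros H.
assert (H0' : moment y 0 <> 0) by lra. specialize (H H0'). simpl Nat.add in H.
eapply is_derive_ext; [intros t; reflexivity|].
replace (- (moment y (k + 2) / moment y 0) + mu2 y * (moment y k / moment y 0)) with
 ((- moment y (k + 2) * moment y 0 - moment y k * - moment y 2) / moment y 0 ^ 2) by (unfold mu2; field; auto).
exact H.
Qed.

Lemma mu2_derive y : 3 <= y -> is_derive mu2 y (- (ell_r y + 2 * mu2 y ^ 2)).
Proof.
intros Hy. generalize (ratio_derive y 2 Hy). simpl Nat.add. intros H.
replace (- (ell_r y + 2 * mu2 y ^ 2)) with (- (moment y 4 / moment y 0) + mu2 y * (moment y 2 / moment y 0)); [exact H|].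
unfold ell_r, mu4. fold (mu2 y). ring.
Qed.
Lemma mu4_derive y : 3 <= y -> is_derive mu4 y (- mu6 y + mu2 y * mu4 y).
Proof. exact (fun Hy => ratio_derive y 4 Hy). Qed.
Lemma mu6_derive y : 3 <= y -> is_derive mu6 y (- mu8 y + mu2 y * mu6 y).
Proof. exact (fun Hy => ratio_derive y 6 Hy). Qed.

Ltac subst_Derive H :=
  match type of H with is_derive _ _ ?l =>
    match goal with |- context [Derive ?g ?x] =>
      let E := fresh in
      assert (E : Derive g x = l) by (apply is_derive_unique; exact H); rewrite E; clear E
    end
  end.

Lemma ell_r_derive y : 3 <= y -> is_derive ell_r y ((ell_s y - 8 * mu2 y) * ell_r y).
Proof.
intros Hy. generalize (ell_r_pos y Hy); intros Hr.
generalize (mu2_derive y Hy) (mu4_derive y Hy); intros HA HB.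
assert (E : ell_s y * ell_r y = - mu6 y + 15 * mu2 y * mu4 y - 30 * mu2 y ^ 3) by (unfold ell_s; field; lra).
unfold ell_r at 1.
replace ((ell_s y - 8 * mu2 y) * ell_r y) with
  (- mu6 y + mu2 y * mu4 y - 3 * (2 * mu2 y * - (ell_r y + 2 * mu2 y ^ 2))).
- apply (is_derive_Rminus mu4 (fun y => 3 * mu2 y ^ 2)); auto.
  apply (is_derive_scal (fun y => mu2 y ^ 2)).
  auto_derive; [eexists; exact HA|]. subst_Derive HA. ring.
- rewrite Rmult_minus_distr_r, E. unfold ell_r. ring.
Qed.

(** The derivative of [mu6] brings in [mu8]; the relations of [moment_rel] eliminate it in favour of
    the lower ratios. *)
Lemma ell_s_derive y : 3 <= y -> is_derive ell_s y (- 4 * mu2 y * ell_s y - 16 * ell_r y).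
Proof.
intros Hy. generalize (ell_r_pos y Hy); intros Hr.
generalize (mu2_derive y Hy) (mu4_derive y Hy) (mu6_derive y Hy) (ell_r_derive y Hy); intros HA HB HC HR.
destruct (moment_rel y Hy) as (k1 & k0 & _ & R2 & R3 & R4).
assert (K0 : k0 = mu4 y + 3 * mu2 y ^ 2 - k1 * mu2 y) by lra.
assert (K1 : k1 = (mu6 y - 3 * mu2 y * mu4 y - 6 * mu2 y ^ 3) / ell_r y).
{ rewrite K0 in R3. apply Rmult_eq_reg_r with (ell_r y); [|lra].
  unfold Rdiv; rewrite Rmult_assoc, Rinv_l by lra. unfold ell_r. lra. }
assert (ED : mu8 y = 4 * mu2 y * mu6 y - 3 * mu4 y ^ 2 + k1 * (mu6 y - mu2 y * mu4 y) + 2 * k0 * (mu4 y + 3 * mu2 y ^ 2)) by lra.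
unfold ell_s at 1. auto_derive.
- repeat split; auto; try (eexists; eassumption). lra.
- subst_Derive HA; subst_Derive HB; subst_Derive HC; subst_Derive HR.
  rewrite ED, K0, K1. unfold ell_s. 
  assert (EB : mu4 y = ell_r y + 3 * mu2 y ^ 2) by (unfold ell_r; ring).
  rewrite EB. field. lra.
Qed.

(** For [e = true] all terms are nonnegative. For the cosine series the terms with [n <> 0] add up
    to at most 2 (64/63) / 16 < 1 in absolute value. *)
Lemma thetac0_pos e y x : 3 <= y -> 0 < thetac e y 0 x.
Proof.
intros Hy. assert (Hy0 : 0 < y) by lra. unfold thetac. rewrite (Zsum_even _ (Zsummable_thetac e y 0 x Hy0)).
2:{ intros n. rewrite gauss_even, opp_IZR, !pow_O.
  replace (- IZR n * x) with (- (IZR n * x)) by ring. now rewrite tcos_opp. }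
assert (E0 : IZR 0 ^ 0 * gauss y 0 * tcos e (IZR 0 * x) = 1).
{ rewrite Rmult_0_l, tcos_0. unfold gauss. replace (IZR 0 ^ 2 * y) with 0 by ring.
  rewrite Ropp_0, exp_0. ring. }
rewrite E0.
assert (EX : ex_series (fun n => IZR (Z.of_nat (S n)) ^ 0 * gauss y (Z.of_nat (S n)) * tcos e (IZR (Z.of_nat (S n)) * x))).
{ generalize (Zsummable_ser1 _ (Zsummable_thetac e y 0 x Hy0)). intros H. apply ex_series_incr_1 in H. exact H. }
assert (EM : ex_series (fun n => IZR (Z.of_nat (S n)) ^ 0 * gauss y (Z.of_nat (S n)))).
{ generalize (Zsummable_ser1 _ (Zsummable_moment y 0 Hy0)). intros H. apply ex_series_incr_1 in H. exact H. }
generalize (moment_tail y 0 Hy (Nat.le_0_l _)) (exp3_bound y Hy). intros HT Hq.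
destruct e.
- assert (0 <= Series (fun n => IZR (Z.of_nat (S n)) ^ 0 * gauss y (Z.of_nat (S n)) * tcos true (IZR (Z.of_nat (S n)) * x))); [|lra].
  apply Series_ge0; auto. intros n. rewrite pow_O, Rmult_1_l.
  apply Rmult_le_pos; [apply exp_ge0|]. simpl. unfold cosh.
  generalize (exp_pos (IZR (Z.pos (Pos.of_succ_nat n)) * x)) (exp_pos (- (IZR (Z.pos (Pos.of_succ_nat n)) * x))). lra.
- assert (A : Rabs (Series (fun n => IZR (Z.of_nat (S n)) ^ 0 * gauss y (Z.of_nat (S n)) * tcos false (IZR (Z.of_nat (S n)) * x)))
    <= Series (fun n => IZR (Z.of_nat (S n)) ^ 0 * gauss y (Z.of_nat (S n)))).
  { apply Series_abs_le; auto. intros n. rewrite pow_O, !Rmult_1_l, Rabs_mult.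
    unfold gauss. rewrite Rabs_pos_eq by apply exp_ge0.
    rewrite <- (Rmult_1_r (exp (- (IZR (Z.of_nat (S n)) ^ 2 * y)))) at 2.
    apply Rmult_le_compat_l; [apply exp_ge0|]. simpl.
    generalize (COS_bound (IZR (Z.pos (Pos.of_succ_nat n)) * x)). intros; apply Rabs_le; lra. }
  generalize (Rle_abs (- Series (fun n => IZR (Z.of_nat (S n)) ^ 0 * gauss y (Z.of_nat (S n)) * tcos false (IZR (Z.of_nat (S n)) * x)))).
  rewrite Rabs_Ropp. lra.
Qed.

(* The first three derivatives in [x] of the logarithm of [thetac e y 0]. *)
Definition logth1 (e : bool) (y x : R) : R := eps e * thetas e y 1 x / thetac e y 0 x.
Definition logth2 (e : bool) (y x : R) : R :=
  (eps e * thetac e y 2 x * thetac e y 0 x - thetas e y 1 x ^ 2) / thetac e y 0 x ^ 2.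
Definition logth3 (e : bool) (y x : R) : R :=
  thetas e y 3 x / thetac e y 0 x - 3 * thetas e y 1 x * thetac e y 2 x / thetac e y 0 x ^ 2
  + 2 * eps e * thetas e y 1 x ^ 3 / thetac e y 0 x ^ 3.

Lemma logth1_derive e y x : 3 <= y -> is_derive (logth1 e y) x (logth2 e y x).
Proof.
intros Hy. assert (Hy0 : 0 < y) by lra. generalize (thetac0_pos e y x Hy); intros HC.
unfold logth1, logth2. generalize (thetac_derive e y 0 x Hy0) (thetas_derive e y 1 x Hy0). intros H0 H1.
auto_derive.
- repeat split; try (eexists; eassumption). lra.
- subst_Derive H0; subst_Derive H1.
  destruct e; simpl eps; field; lra.
Qed.

Lemma logth2_derive e y x : 3 <= y -> is_derive (logth2 e y) x (logth3 e y x).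
Proof.
intros Hy. assert (Hy0 : 0 < y) by lra. generalize (thetac0_pos e y x Hy); intros HC.
unfold logth2, logth3. generalize (thetac_derive e y 0 x Hy0) (thetas_derive e y 1 x Hy0) (thetac_derive e y 2 x Hy0). intros H0 H1 H2.
auto_derive.
- repeat split; try (eexists; eassumption). nra.
- subst_Derive H0; subst_Derive H1; subst_Derive H2.
  destruct e; simpl eps; field; lra.
Qed.

(** The bilinear relation expresses the fourth derivative of theta by the lower ones, and thereby
    the fourth derivative of log theta by the second. The shift by [eps e * mu2 y] normalises the
    unknown to vanish at [x = 0]. *)
Lemma logth3_derive e y x : 3 <= y ->
  is_derive (logth3 e y) x (ell_r y - eps e * ell_s y * (logth2 e y x - eps e * mu2 y) - 6 * (logth2 e y x - eps e * mu2 y) ^ 2).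
Proof.
intros Hy. assert (Hy0 : 0 < y) by lra. generalize (thetac0_pos e y x Hy); intros HC.
generalize (ell_r_pos y Hy); intros Hr.
destruct (moment_rel y Hy) as (k1 & k0 & R1 & R2 & R3 & _). specialize (R1 e x).
assert (K0 : k0 = mu4 y + 3 * mu2 y ^ 2 - k1 * mu2 y) by lra.
assert (K1 : ell_s y = 12 * mu2 y - k1).
{ rewrite K0 in R3. apply Rmult_eq_reg_r with (ell_r y); [|lra].
  unfold ell_s, Rdiv; rewrite Rmult_assoc, Rinv_l by lra. unfold ell_r. lra. }
replace (ell_r y - eps e * ell_s y * (logth2 e y x - eps e * mu2 y) - 6 * (logth2 e y x - eps e * mu2 y) ^ 2) with
 (k0 + k1 * eps e * logth2 e y x - 6 * logth2 e y x ^ 2).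
2:{ rewrite K0, K1. unfold ell_r. destruct e; simpl eps; ring. }
assert (E4 : thetac e y 4 x = (4 * eps e * thetas e y 1 x * thetas e y 3 x - 3 * thetac e y 2 x ^ 2 +
   k1 * (thetac e y 0 x * thetac e y 2 x - eps e * thetas e y 1 x ^ 2) + k0 * thetac e y 0 x ^ 2) / thetac e y 0 x).
{ apply Rmult_eq_reg_r with (thetac e y 0 x); [|lra]. unfold Rdiv. rewrite Rmult_assoc, Rinv_l by lra. lra. }
unfold logth3, logth2. generalize (thetac_derive e y 0 x Hy0) (thetas_derive e y 1 x Hy0) (thetac_derive e y 2 x Hy0) (thetas_derive e y 3 x Hy0).
intros H0 H1 H2 H3.
auto_derive.
- repeat split; try (eexists; eassumption); apply Rgt_not_eq, Rlt_gt;
    repeat apply Rmult_lt_0_compat; lra.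
- subst_Derive H0; subst_Derive H1; subst_Derive H2; subst_Derive H3.
  rewrite E4. destruct e; simpl eps; field; lra.
Qed.

Lemma logth1_0 e y : logth1 e y 0 = 0.
Proof. unfold logth1. rewrite thetas_at0. unfold Rdiv; ring. Qed.
Lemma logth2_0 e y : 3 <= y -> logth2 e y 0 = eps e * mu2 y.
Proof.
intros Hy. generalize (moment0_ge1 y Hy). intros. unfold logth2, mu2. rewrite thetas_at0, !thetac_at0. field. lra.
Qed.
Lemma logth3_0 e y : logth3 e y 0 = 0.
Proof. unfold logth3. rewrite !thetas_at0. unfold Rdiv; ring. Qed.

(** * The Lambert series as logarithmic derivative of theta *)

Definition altZ (n : Z) : R := if Z.even n then 1 else -1.

Lemma altZ_abs n : Rabs (altZ n) = 1.
Proof. unfold altZ; destruct (Z.even n); [apply Rabs_R1|]. rewrite Rabs_left; lra. Qed.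

Lemma altZ_opp n : altZ (- n) = altZ n.
Proof. unfold altZ. now rewrite Z.even_opp. Qed.

Lemma altZ_odd_flip s n : altZ (2 * s - 1 - n) = - altZ n.
Proof.
unfold altZ. rewrite !Z.even_sub, Z.even_mul. simpl. destruct (Z.even n); simpl; ring.
Qed.

(* [/ sinh 0 = 0], so the term of index [0] vanishes. *)
Definition alt_csch (y : R) (n : Z) : R := altZ n * / sinh (IZR n * y).

Lemma alt_csch_opp y n : alt_csch y (- n) = - alt_csch y n.
Proof.
unfold alt_csch. rewrite altZ_opp, opp_IZR. replace (- IZR n * y) with (- (IZR n * y)) by ring.
rewrite (tsin_opp true : forall u, sinh (- u) = - sinh u), Rinv_opp. ring.
Qed.

Lemma sinh_lower t : 1 <= t -> exp t / 4 <= sinh t.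
Proof.
intros Ht. unfold sinh. generalize (exp_ineq1_le t) (exp_pos (- t)).
assert (exp t * exp (- t) = 1) by (rewrite <- exp_plus, Rplus_opp_r, exp_0; auto).
intros. assert (exp (- t) <= 1) by nra. nra.
Qed.

Lemma inv_sinh_bound t : 1 <= t -> 0 < / sinh t <= 4 * exp (- t).
Proof.
intros Ht. generalize (sinh_lower t Ht) (exp_pos t). intros H P. split; [apply Rinv_0_lt_compat; lra|].
rewrite exp_Ropp. replace (4 * / exp t) with (/ (exp t / 4)) by (field; lra).
apply Rinv_le_contravar; lra.
Qed.

Lemma alt_csch_bound y n : 1 <= y -> Rabs (alt_csch y n) <= 4 * exp (- (y * IZR (Z.abs n))).
Proof.
intros Hy.
assert (P : forall m, (0 < m)%Z -> Rabs (alt_csch y m) <= 4 * exp (- (y * IZR (Z.abs m)))).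
{ intros m Hm. unfold alt_csch. rewrite Rabs_mult, altZ_abs, Rmult_1_l.
  assert (1 <= IZR m) by (apply IZR_le; lia).
  destruct (inv_sinh_bound (IZR m * y)) as [A B]; [nra|].
  rewrite Rabs_pos_eq by lra. rewrite Z.abs_eq by lia. rewrite (Rmult_comm y). exact B. }
destruct (Z.lt_trichotomy n 0) as [L|[-> |L]]; auto.
- replace n with (- - n)%Z by lia. rewrite alt_csch_opp, Rabs_Ropp, Z.abs_opp. apply P; lia.
- unfold alt_csch. rewrite Rmult_0_l, sinh_0, Rinv_0, Rmult_0_r, Rabs_R0.
  generalize (exp_pos (- (y * IZR (Z.abs 0)))); lra.
Qed.

Lemma expdecay_alt_csch y : 1 <= y -> expdecay y (alt_csch y).
Proof. intros Hy; exists 4; split; [lra|]. intros; apply alt_csch_bound; auto. Qed.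

Lemma Zsummable_gexp y c (a : Z -> R) B : 0 < y -> (forall n, Rabs (a n) <= B) ->
  Zsummable (fun n => a n * exp (- (IZR n ^ 2 * y) + c * IZR n)).
Proof.
intros Hy Ha.
apply (Zsummable_le _ (fun n => B * (exp (- (IZR n ^ 2 * y)) * exp (- (- Rabs c * IZR (Z.abs n)))))).
- intros n. rewrite Rabs_mult. apply Rmult_le_compat; try apply Rabs_pos; auto.
  rewrite Rabs_pos_eq by apply exp_ge0. rewrite <- exp_plus. apply exp_le.
  replace (- (- Rabs c * IZR (Z.abs n))) with (Rabs (c * IZR n)) by (rewrite Rabs_mult, abs_IZR; ring).
  generalize (Rle_abs (c * IZR n)); lra.
- apply Zsummable_scal.
  apply (Zsummable_ext (fun n => IZR n ^ 0 * gauss y n * exp (- (- Rabs c * IZR (Z.abs n))))).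
  { intros n; unfold gauss; ring. }
  apply (Zsummable_gauss_mul y 0 _ (Rabs c)); auto.
  exists 1; split; [lra|]. intros n. rewrite Rabs_pos_eq by apply exp_ge0. lra.
Qed.

(** The reflection n -> 2 s - 1 - n preserves the exponent and reverses the sign [altZ]. *)
Lemma alt_theta_zero y s : 0 < y ->
  Zsum (fun n => altZ n * exp (- (IZR n ^ 2 * y) + (2 * IZR s - 1) * y * IZR n)) = 0.
Proof.
intros Hy.
set (f := fun n => altZ n * exp (- (IZR n ^ 2 * y) + (2 * IZR s - 1) * y * IZR n)).
assert (E : Zsummable f).
{ apply Zsummable_gexp with 1; auto. intros n; rewrite altZ_abs; lra. }
generalize (Zsum_flip f (2 * s - 1) E).
rewrite (Zsum_ext (fun n => f (2 * s - 1 - n)%Z) (fun n => - f n)).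
- rewrite Zsum_opp. lra.
- intros n. unfold f. rewrite altZ_odd_flip, !minus_IZR, mult_IZR.
  rewrite <- Ropp_mult_distr_l. do 3 f_equal. ring.
Qed.

(** Multiplied by [gauss y s], this is the coefficient of [sin (s x)] in the product of theta with
    the sine series of [alt_csch]. *)
Definition lambert_conv (y : R) (s : Z) : R :=
  Zsum (fun n => alt_csch y n * exp (- (IZR n ^ 2 * y) + 2 * IZR s * y * IZR n)).

Lemma alt_csch_le4 y n : 1 <= y -> Rabs (alt_csch y n) <= 4.
Proof.
intros Hy; eapply Rle_trans; [apply alt_csch_bound; auto|].
rewrite <- (Rmult_1_r 4) at 2. apply Rmult_le_compat_l; [lra|]. rewrite <- exp_0. apply exp_le.
generalize (IZR_abs_ge0 n). nra.
Qed.

(** The difference of the two exponentials carries the factor 2 sinh(n y), which cancels the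
    denominator. What is left is the alternating sum of [alt_theta_zero] without its term [n = 0],
    that is, [0 - 2]. *)
Lemma lambert_conv_step y s : 1 <= y -> lambert_conv y s = lambert_conv y (s - 1) - 2.
Proof.
intros Hy. assert (Hy0 : 0 < y) by lra.
assert (E : forall s, Zsummable (fun n => alt_csch y n * exp (- (IZR n ^ 2 * y) + 2 * IZR s * y * IZR n))).
{ intros t; apply Zsummable_gexp with 4; auto. intros n; apply alt_csch_le4; auto. }
assert (E1 : Zsummable (fun n => altZ n * exp (- (IZR n ^ 2 * y) + (2 * IZR s - 1) * y * IZR n))).
{ apply Zsummable_gexp with 1; auto. intros n; rewrite altZ_abs; lra. }
assert (D : lambert_conv y s - lambert_conv y (s - 1) =
  Zsum (fun n => 2 * (altZ n * exp (- (IZR n ^ 2 * y) + (2 * IZR s - 1) * y * IZR n)) - (if Z.eqb n 0 then 2 else 0))).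
{ unfold lambert_conv. rewrite <- Zsum_minus by auto. apply Zsum_ext; intros n.
  destruct (Z.eqb_spec n 0) as [-> |Hn].
  - unfold alt_csch, altZ. simpl Z.even. cbv iota. rewrite Rmult_0_l, sinh_0, Rinv_0, Rmult_0_r.
    replace (- (0 ^ 2 * y) + (2 * IZR s - 1) * y * 0) with 0 by ring. rewrite exp_0. ring.
  - rewrite minus_IZR.
    replace (- (IZR n ^ 2 * y) + 2 * IZR s * y * IZR n) with
      (- (IZR n ^ 2 * y) + (2 * IZR s - 1) * y * IZR n + IZR n * y) by ring.
    replace (- (IZR n ^ 2 * y) + 2 * (IZR s - 1) * y * IZR n) with
      (- (IZR n ^ 2 * y) + (2 * IZR s - 1) * y * IZR n + - (IZR n * y)) by ring.
    rewrite (exp_plus _ (IZR n * y)), (exp_plus _ (- (IZR n * y))).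
    set (X := exp (- (IZR n ^ 2 * y) + (2 * IZR s - 1) * y * IZR n)).
    unfold alt_csch.
    assert (S0 : sinh (IZR n * y) <> 0).
    { intros H0. assert (IZR n * y = 0); [|apply eq_IZR_contrapositive in Hn; nra].
      unfold sinh in H0. assert (exp (IZR n * y) = exp (- (IZR n * y))) by lra.
      apply exp_inv in H. lra. }
    replace (exp (IZR n * y)) with (exp (- (IZR n * y)) + 2 * sinh (IZR n * y)) by (unfold sinh; field).
    field; auto. }
rewrite Zsum_minus, Zsum_scal, Zsum_delta, alt_theta_zero in D; auto.
- lra.
- apply Zsummable_scal; auto.
- apply Zsummable_expdecay with 1; [lra|]. exists 2; split; [lra|].
  intros n. destruct (Z.eqb_spec n 0) as [-> |_].
  + simpl. rewrite Rmult_0_r, Ropp_0, exp_0, Rabs_pos_eq; lra.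
  + rewrite Rabs_R0. apply Rmult_le_pos; [lra|apply exp_ge0].
Qed.

Lemma lambert_conv_eq y s : 1 <= y -> lambert_conv y s = - 2 * IZR s.
Proof.
intros Hy.
assert (H0 : lambert_conv y 0 = 0).
{ apply Zsum_odd.
  - apply Zsummable_gexp with 4; [lra|]. intros n; apply alt_csch_le4; auto.
  - intros n. rewrite alt_csch_opp, opp_IZR.
    replace (- ((- IZR n) ^ 2 * y) + 2 * 0 * y * - IZR n) with (- (IZR n ^ 2 * y) + 2 * 0 * y * IZR n) by ring. ring. }
assert (H1 : forall n, lambert_conv y (Z.of_nat n) = - 2 * IZR (Z.of_nat n)).
{ induction n as [|n IH]; [simpl; rewrite H0; ring|].
  rewrite lambert_conv_step by auto. replace (Z.of_nat (S n) - 1)%Z with (Z.of_nat n) by lia.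
  rewrite IH, Nat2Z.inj_succ, succ_IZR. ring. }
assert (H2 : forall n, lambert_conv y (- Z.of_nat n) = - 2 * IZR (- Z.of_nat n)).
{ induction n as [|n IH]; [simpl; rewrite H0; ring|].
  generalize (lambert_conv_step y (- Z.of_nat n) Hy). rewrite IH.
  replace (- Z.of_nat n - 1)%Z with (- Z.of_nat (S n))%Z by lia. intros E.
  replace (- Z.of_nat n)%Z with (- Z.of_nat (S n) + 1)%Z in E by lia. rewrite plus_IZR in E. lra. }
destruct (Z.le_gt_cases 0 s).
- rewrite <- (Z2Nat.id s) by lia. apply H1.
- replace s with (- Z.of_nat (Z.to_nat (- s)))%Z by lia. apply H2.
Qed.

(** Multiply the sine series by theta: by [lambert_conv_eq] the product has the coefficients
    [-2 s * gauss y s], those of twice the derivative of theta. *)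
Lemma logth1_lambert y x : 3 <= y -> logth1 false y x = / 2 * Zsum (fun n => alt_csch y n * sin (IZR n * x)).
Proof.
intros Hy. assert (Hy0 : 0 < y) by lra. assert (Hy1 : 1 <= y) by lra.
generalize (thetac0_pos false y x Hy). intros HC.
assert (BS : expdecay (- 0) (fun n => sin (IZR n * x))).
{ exists 1; split; [lra|]. intros n. replace (- (- 0 * IZR (Z.abs n))) with 0 by ring.
  rewrite exp_0. generalize (SIN_bound (IZR n * x)); intros; apply Rabs_le; lra. }
assert (BC : expdecay (- 0) (fun n => cos (IZR n * x))).
{ exists 1; split; [lra|]. intros n. replace (- (- 0 * IZR (Z.abs n))) with 0 by ring.
  rewrite exp_0. generalize (COS_bound (IZR n * x)); intros; apply Rabs_le; lra. }
assert (ZS : forall f, expdecay (- 0) f -> Zsummable (fun n => alt_csch y n * f n)).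
{ intros f Hf. apply Zsummable_expdecay with (y + - 0); [lra|]. apply expdecay_mul; auto. apply expdecay_alt_csch; auto. }
assert (K : Zsum (fun m => Zsum (fun n => gauss y m * alt_csch y n * sin (IZR (m + n) * x))) =
  thetac false y 0 x * Zsum (fun n => alt_csch y n * sin (IZR n * x))).
{ rewrite (Zsum_ext _ (fun m => Zsum (fun n => alt_csch y n * cos (IZR n * x)) * (IZR m ^ 0 * gauss y m * tsin false (IZR m * x))
     + Zsum (fun n => alt_csch y n * sin (IZR n * x)) * (IZR m ^ 0 * gauss y m * tcos false (IZR m * x)))).
  - rewrite Zsum_plus by (apply Zsummable_scal; apply Zsummable_thetac || apply Zsummable_thetas; auto).
    rewrite !Zsum_scal. fold (thetas false y 0 x) (thetac false y 0 x). rewrite thetas_even by auto. ring.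
  - intros m.
    rewrite (Zsum_ext _ (fun n => (gauss y m * sin (IZR m * x)) * (alt_csch y n * cos (IZR n * x)) +
      (gauss y m * cos (IZR m * x)) * (alt_csch y n * sin (IZR n * x)))).
    + rewrite Zsum_plus by (apply Zsummable_scal, ZS; auto). rewrite !Zsum_scal. simpl. ring.
    + intros n. rewrite plus_IZR, Rmult_plus_distr_r, sin_plus. ring. }
destruct (expdecay_gauss y (y + 1) Hy0) as [A [HA Ha]].
rewrite (Zsum_conv (fun m n => gauss y m * alt_csch y n) (fun n => sin (IZR n * x)) (A * 4) (y + 1) y 0) in K; auto; try lra.
- rewrite (Zsum_ext _ (fun s => -2 * (IZR s ^ 1 * gauss y s * tsin false (IZR s * x)))) in K.
  + rewrite Zsum_scal in K. fold (thetas false y 1 x) in K. unfold logth1. simpl eps.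
    apply Rmult_eq_reg_r with (thetac false y 0 x); [|lra]. unfold Rdiv. rewrite Rmult_assoc, Rinv_l by lra. lra.
  + intros s. simpl tsin.
    replace (Zsum (fun m => gauss y m * alt_csch y (s - m))) with (gauss y s * lambert_conv y s); [rewrite lambert_conv_eq; auto; ring|].
    rewrite <- (Zsum_flip (fun m => gauss y m * alt_csch y (s - m)) s).
    * unfold lambert_conv. rewrite <- Zsum_scal. apply Zsum_ext; intros n. replace (s - (s - n))%Z with n by lia.
      unfold gauss. rewrite minus_IZR.
      replace (- ((IZR s - IZR n) ^ 2 * y)) with (- (IZR s ^ 2 * y) + (- (IZR n ^ 2 * y) + 2 * IZR s * y * IZR n)) by ring.
      rewrite (exp_plus (- (IZR s ^ 2 * y))). ring.
    * apply (Zsummable_le _ (fun n => 4 * (IZR n ^ 0 * gauss y n))); [|apply Zsummable_scal, Zsummable_moment; auto].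
      intros n. rewrite pow_O, Rmult_1_l, Rabs_mult, Rmult_comm.
      apply Rmult_le_compat; try apply Rabs_pos; [apply alt_csch_le4; auto|].
      unfold gauss; rewrite Rabs_pos_eq; [lra|apply exp_ge0].
- intros m n. rewrite Rabs_mult.
  replace (A * 4 * (exp (- ((y + 1) * IZR (Z.abs m))) * exp (- (y * IZR (Z.abs n))))) with
   (A * exp (- ((y + 1) * IZR (Z.abs m))) * (4 * exp (- (y * IZR (Z.abs n))))) by ring.
  apply Rmult_le_compat; try apply Rabs_pos; auto. apply alt_csch_bound; auto.
Qed.

(** The [k]-th derivative of [logth2 false y]; the phase k PI / 2 gives all derivatives of the
    cosine one formula. *)
Definition lambert_der (y : R) (k : nat) (x : R) : R :=
  / 2 * Zsum (fun n => IZR n ^ S k * alt_csch y n * cos (IZR n * x + INR k * (PI / 2))).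

Lemma expdecay_pow_alt_csch y k : 3 <= y -> expdecay (y - 1) (fun n => IZR n ^ k * alt_csch y n).
Proof.
intros Hy. replace (y - 1) with (- (1) + y) by ring. apply expdecay_mul; [apply expdecay_pow; lra|apply expdecay_alt_csch; lra].
Qed.

Lemma cos_1 z : Rabs (cos z) <= 1.
Proof. generalize (COS_bound z); intros; apply Rabs_le; lra. Qed.

(** The new factor [n] costs a rate of at most [1], hence [1 < k]. *)
Lemma trig_series_derive (a : Z -> R) k (c x : R) : 1 < k -> expdecay k a ->
  is_derive (fun x => Zsum (fun n => a n * cos (IZR n * x + c))) x
    (Zsum (fun n => IZR n * a n * cos (IZR n * x + (c + PI / 2)))).
Proof.
intros Hk Ha.
assert (Ha1 : expdecay (k - 1) (fun n => IZR n * a n)).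
{ replace (k - 1) with (- (1) + k) by ring. apply (expdecay_mul (- (1)) k (fun n => IZR n)); auto.
  destruct (expdecay_pow 1 1 Rlt_0_1) as [A [HA H]]. exists A; split; auto. intros n.
  generalize (H n). now rewrite pow_1. }
destruct Ha1 as [A [HA H]].
apply (Zsum_is_derive (fun n x => a n * cos (IZR n * x + c))
   (fun n x => IZR n * a n * cos (IZR n * x + (c + PI / 2))) A (k - 1) x (mkposreal 1 Rlt_0_1)).
- lra.
- intros n z _. replace (IZR n * z + (c + PI / 2)) with (PI / 2 + (IZR n * z + c)) by ring.
  rewrite cos_plus, cos_PI2, sin_PI2. auto_derive; [auto|ring].
- intros n z _. rewrite Rabs_mult. rewrite <- (Rmult_1_r (A * _)).
  apply Rmult_le_compat; try apply Rabs_pos; auto. apply cos_1.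
- apply (Zsummable_le _ (fun n => Rabs (a n))).
  + intros n. rewrite Rabs_mult. rewrite <- (Rmult_1_r (Rabs (a n))) at 2.
    apply Rmult_le_compat_l; [apply Rabs_pos|apply cos_1].
  + apply Zsummable_expdecay with k; [lra|]. destruct Ha as [B [HB Hb]]. exists B; split; auto.
    intros n; rewrite Rabs_Rabsolu; auto.
Qed.

Lemma lambert_der_derive y k x : 3 <= y -> is_derive (lambert_der y k) x (lambert_der y (S k) x).
Proof.
intros Hy. unfold lambert_der.
apply (is_derive_scal (fun x => Zsum (fun n => IZR n ^ S k * alt_csch y n * cos (IZR n * x + INR k * (PI / 2))))).
replace (Zsum (fun n => IZR n ^ S (S k) * alt_csch y n * cos (IZR n * x + INR (S k) * (PI / 2)))) with
 (Zsum (fun n => IZR n * (IZR n ^ S k * alt_csch y n) * cos (IZR n * x + (INR k * (PI / 2) + PI / 2)))).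
- apply (trig_series_derive (fun n => IZR n ^ S k * alt_csch y n) (y - 1)); [lra|]. apply expdecay_pow_alt_csch; auto.
- apply Zsum_ext; intros n. rewrite S_INR, <- !tech_pow_Rmult, Rmult_plus_distr_r, Rmult_1_l. ring.
Qed.

Lemma lambert_der_0 y x : 3 <= y -> lambert_der y 0 x = logth2 false y x.
Proof.
intros Hy. generalize (logth1_derive false y x Hy). intros H. apply is_derive_unique in H. rewrite <- H.
symmetry. apply is_derive_unique.
apply (is_derive_ext (fun x => / 2 * Zsum (fun n => alt_csch y n * cos (IZR n * x + - (PI / 2))))).
{ intros t. rewrite (logth1_lambert y t Hy). f_equal. apply Zsum_ext; intros n. f_equal.
  rewrite cos_plus, cos_neg, sin_neg, cos_PI2, sin_PI2. ring. }
unfold lambert_der.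
apply (is_derive_scal (fun x => Zsum (fun n => alt_csch y n * cos (IZR n * x + - (PI / 2))))).
replace (Zsum (fun n => IZR n ^ 1 * alt_csch y n * cos (IZR n * x + INR 0 * (PI / 2)))) with
 (Zsum (fun n => IZR n * alt_csch y n * cos (IZR n * x + (- (PI / 2) + PI / 2)))).
- apply trig_series_derive with y; [lra|]. apply expdecay_alt_csch; lra.
- apply Zsum_ext; intros n. rewrite pow_1. do 2 f_equal. simpl; ring.
Qed.

(** * Taylor coefficients of the Lambert series *)

Definition conv (a : nat -> R) (k : nat) : R := sum_f_R0 (fun i => a i * a (k - i)%nat) k.

Lemma sum_derive (f f' : nat -> R -> R) (x : R) (k : nat) :
  (forall i, (i <= k)%nat -> is_derive (f i) x (f' i x)) ->
  is_derive (fun x => sum_f_R0 (fun i => f i x) k) x (sum_f_R0 (fun i => f' i x) k).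
Proof.
intros H; induction k as [|k IH]; simpl.
- apply H; lia.
- apply is_derive_Rplus; [apply IH; intros; apply H; lia|apply H; lia].
Qed.

(** The Leibniz rule for Taylor coefficients: in the Cauchy product of index k + 1 each pair
    receives the weight i + (k + 1 - i) = k + 1. *)
Lemma conv_deriv_sum (a : nat -> R) (k : nat) :
  sum_f_R0 (fun i => INR (S i) * a (S i) * a (k - i)%nat + a i * (INR (S (k - i)) * a (S (k - i)))) k
  = INR (S k) * conv a (S k).
Proof.
rewrite plus_sum. unfold conv. rewrite scal_sum.
transitivity (sum_f_R0 (fun i => INR i * a i * a (S k - i)%nat + INR (S k - i) * a i * a (S k - i)%nat) (S k)).
- rewrite plus_sum. f_equal.
  + rewrite (decomp_sum _ (S k)) by lia. simpl pred. simpl INR at 2. rewrite !Rmult_0_l, Rplus_0_l.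
    apply sum_eq. intros i Hi. simpl Nat.sub. reflexivity.
  + rewrite tech5. replace (S k - S k)%nat with 0%nat by lia. simpl INR at 3. rewrite !Rmult_0_l, Rplus_0_r.
    apply sum_eq. intros i Hi. replace (S k - i)%nat with (S (k - i)) by lia. ring.
- apply sum_eq. intros i Hi. rewrite minus_INR by lia. ring.
Qed.

(** Here [f k] plays the part of the [k]-th derivative of u divided by k!. The recursion is proved
    at every [x], not only at [0], because the induction differentiates it; analyticity of u does
    not enter. *)
Lemma tower_recursion (f : nat -> R -> R) (r s : R) :
  (forall k x, is_derive (f k) x (INR (S k) * f (S k) x)) ->
  (forall x, 2 * f 2%nat x = r + s * f 0%nat x - 6 * f 0%nat x ^ 2) ->
  forall k x, INR (S (S k)) * INR (S k) * f (S (S k)) x =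
    (if Nat.eqb k 0 then r else 0) + s * f k x - 6 * conv (fun i => f i x) k.
Proof.
intros Hd H k; induction k as [|k IH]; intros x.
- unfold conv. simpl. generalize (H x). simpl. lra.
- assert (D1 : is_derive (fun x => INR (S (S k)) * INR (S k) * f (S (S k)) x) x
     (INR (S (S k)) * INR (S k) * (INR (S (S (S k))) * f (S (S (S k))) x))).
  { apply (is_derive_scal (f (S (S k)))). apply Hd. }
  assert (D2 : is_derive (fun x => (if Nat.eqb k 0 then r else 0) + s * f k x - 6 * conv (fun i => f i x) k) x
     (0 + s * (INR (S k) * f (S k) x) - 6 * (INR (S k) * conv (fun i => f i x) (S k)))).
  { apply is_derive_Rminus.
    - apply is_derive_Rplus; [apply is_derive_Rconst|].
      apply (is_derive_scal (f k)), Hd.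
    - apply (is_derive_scal (fun x => conv (fun i => f i x) k)).
      rewrite <- conv_deriv_sum. unfold conv.
      apply (sum_derive (fun i x => f i x * f (k - i)%nat x)
        (fun i x => INR (S i) * f (S i) x * f (k - i)%nat x + f i x * (INR (S (k - i)) * f (S (k - i)) x))).
      intros i _. apply (is_derive_mult (f i) (f (k - i)%nat)); auto. intros; apply Rmult_comm. }
  apply (is_derive_ext _ _ _ _ (fun t => eq_sym (IH t))) in D2.
  apply (is_derive_inj _ _ _ _ D1) in D2.
  assert (P : INR (S k) <> 0) by (apply not_0_INR; lia).
  simpl Nat.eqb. apply Rmult_eq_reg_l with (INR (S k)); auto.
  rewrite !S_INR in *. lra.
Qed.

Definition lambert (y : R) (s : nat) : R := / 2 * Zsum (fun n => IZR n ^ s * alt_csch y n).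

Lemma cos_kPI (j : nat) : cos (INR (2 * j) * (PI / 2)) = (-1) ^ j.
Proof.
rewrite mult_INR. replace (INR 2 * INR j * (PI / 2)) with (INR j * PI) by (simpl; field).
induction j as [|j IH]; [simpl; rewrite Rmult_0_l; apply cos_0|].
rewrite S_INR, Rmult_plus_distr_r, Rmult_1_l, neg_cos, IH. simpl; ring.
Qed.
Lemma cos_kPI_odd (j : nat) : cos (INR (2 * j + 1) * (PI / 2)) = 0.
Proof.
rewrite plus_INR, Rmult_plus_distr_r. simpl (INR 1). rewrite Rmult_1_l, cos_plus, cos_PI2.
rewrite sin_PI2. replace (sin (INR (2 * j) * (PI / 2))) with 0; [ring|].
symmetry. rewrite mult_INR. replace (INR 2 * INR j * (PI / 2)) with (INR j * PI) by (simpl; field).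
induction j as [|j IH]; [simpl; rewrite Rmult_0_l; apply sin_0|].
rewrite S_INR, Rmult_plus_distr_r, Rmult_1_l, neg_sin, IH. ring.
Qed.

Lemma lambert_der_at0 y k : lambert_der y k 0 = cos (INR k * (PI / 2)) * lambert y (S k).
Proof.
unfold lambert_der, lambert. rewrite (Zsum_ext _ (fun n => IZR n ^ S k * alt_csch y n * cos (INR k * (PI / 2)))).
- rewrite Zsum_scal_r. ring.
- intros n. now rewrite Rmult_0_r, Rplus_0_l.
Qed.


(** The Taylor coefficient of order [2 j] at [x = 0] of [logth2 false y x + mu2 y], whose constant
    term vanishes. *)
Definition lambert_coef (y : R) (j : nat) : R :=
  if Nat.eqb j 0 then 0 else (-1) ^ j * lambert y (2 * j + 1) / INR (fact (2 * j)).

Lemma sum_even_only (f : nat -> R) (j : nat) :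
  (forall i, f (2 * i + 1)%nat = 0) -> sum_f_R0 f (2 * j) = sum_f_R0 (fun i => f (2 * i)%nat) j.
Proof.
intros H; induction j as [|j IH]; [reflexivity|].
replace (2 * S j)%nat with (S (S (2 * j))) by lia. rewrite !tech5, IH.
replace (S (2 * j)) with (2 * j + 1)%nat by lia. rewrite H.
replace (S (2 * j + 1)) with (2 * S j)%nat by lia. ring.
Qed.

Lemma lambert_coef_recursion y j : 3 <= y ->
  INR (2 * j + 2) * INR (2 * j + 1) * lambert_coef y (S j) =
    (if Nat.eqb j 0 then ell_r y else 0) + ell_s y * lambert_coef y j - 6 * conv (lambert_coef y) j.
Proof.
intros Hy.
set (f := fun k x => (lambert_der y k x + (if Nat.eqb k 0 then mu2 y else 0)) / INR (fact k)).
assert (W0 : forall x, lambert_der y 0 x = logth2 false y x) by (intros; apply lambert_der_0; auto).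
assert (W1 : forall x, lambert_der y 1 x = logth3 false y x).
{ intros x. generalize (lambert_der_derive y 0 x Hy). intros H.
  apply (is_derive_ext _ _ _ _ W0) in H. apply is_derive_unique in H. rewrite <- H.
  apply is_derive_unique, logth2_derive; auto. }
assert (W2 : forall x, lambert_der y 2 x = ell_r y + ell_s y * (logth2 false y x + mu2 y) - 6 * (logth2 false y x + mu2 y) ^ 2).
{ intros x. generalize (lambert_der_derive y 1 x Hy). intros H.
  apply (is_derive_ext _ _ _ _ W1) in H. apply is_derive_unique in H. rewrite <- H.
  rewrite (is_derive_unique _ _ _ (logth3_derive false y x Hy)). simpl eps. ring. }
assert (FN : forall k, INR (fact k) <> 0) by (intros; apply INR_fact_neq_0).
assert (Hd : forall k x, is_derive (f k) x (INR (S k) * f (S k) x)).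
{ intros k x.
  assert (EE : INR (S k) * f (S k) x = / INR (fact k) * (lambert_der y (S k) x + 0)).
  { unfold f. simpl Nat.eqb. cbv iota. rewrite fact_simpl, mult_INR. field. split; auto. apply not_0_INR; lia. }
  rewrite EE. unfold f.
  apply (is_derive_ext (fun x => / INR (fact k) * (lambert_der y k x + (if Nat.eqb k 0 then mu2 y else 0)))).
  { intros t. apply Rmult_comm. }
  apply (is_derive_scal (fun x => lambert_der y k x + (if Nat.eqb k 0 then mu2 y else 0))).
  apply is_derive_Rplus; [apply lambert_der_derive; auto|apply is_derive_Rconst]. }
assert (HO : forall x, 2 * f 2%nat x = ell_r y + ell_s y * f 0%nat x - 6 * f 0%nat x ^ 2).
{ intros x. unfold f. simpl Nat.eqb. cbv iota. rewrite W2, W0. simpl fact. simpl INR. field. }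
generalize (tower_recursion f (ell_r y) (ell_s y) Hd HO (2 * j) 0).
assert (Fe : forall i, f (2 * i)%nat 0 = lambert_coef y i).
{ intros i. unfold f, lambert_coef. destruct i as [|i].
  - simpl Nat.mul. simpl Nat.eqb. cbv iota. rewrite W0, logth2_0 by auto. simpl eps. simpl fact. simpl INR. field.
  - replace (Nat.eqb (2 * S i) 0) with false by (symmetry; apply Nat.eqb_neq; lia).
    simpl (Nat.eqb (S i) 0). cbv iota. rewrite lambert_der_at0, cos_kPI. rewrite Rplus_0_r.
    replace (2 * S i + 1)%nat with (S (2 * S i)) by lia. reflexivity. }
assert (Fo : forall i, f (2 * i + 1)%nat 0 = 0).
{ intros i. unfold f. replace (Nat.eqb (2 * i + 1) 0) with false by (symmetry; apply Nat.eqb_neq; lia).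
  rewrite lambert_der_at0, cos_kPI_odd. unfold Rdiv; ring. }
replace (S (S (2 * j))) with (2 * S j)%nat by lia. rewrite !Fe.
replace (2 * S j)%nat with (2 * j + 2)%nat by lia. replace (S (2 * j)) with (2 * j + 1)%nat by lia.
intros ->.
replace (Nat.eqb (2 * j) 0) with (Nat.eqb j 0) by (destruct j; reflexivity).
f_equal. f_equal. unfold conv. rewrite sum_even_only.
- apply sum_eq. intros i Hi. replace (2 * j - 2 * i)%nat with (2 * (j - i))%nat by lia. now rewrite !Fe.
- intros i. rewrite Fo. ring.
Qed.

(* In Jacobi's notation for the nome [e^(-y)]: [ellZ = (K / PI)^2] and [ellX = k^2]. *)
Definition ellZ (y : R) : R := sqrt (ell_s y ^ 2 / 16 + 2 * ell_r y).
Definition ellX (y : R) : R := / 2 + ell_s y / (8 * ellZ y).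

Lemma ellZ_pos y : 3 <= y -> 0 < ellZ y.
Proof.
intros Hy. apply sqrt_lt_R0. generalize (ell_r_pos y Hy) (pow2_ge_0 (ell_s y)). lra.
Qed.

Lemma ellZ_sqr y : 3 <= y -> ellZ y ^ 2 = ell_s y ^ 2 / 16 + 2 * ell_r y.
Proof.
intros Hy. unfold ellZ. rewrite pow2_sqrt; auto. generalize (ell_r_pos y Hy) (pow2_ge_0 (ell_s y)). lra.
Qed.

(** With a = X Z and b = (1 - X) Z the equation becomes u'' = 2 a b + 4 (a - b) u - 6 u^2, whose
    first integral through u = u' = 0 factors as u'^2 = 4 u (a - u) (b + u). *)
Lemma ell_s_XZ y : 3 <= y -> ell_s y = 4 * (2 * ellX y - 1) * ellZ y.
Proof. intros Hy. generalize (ellZ_pos y Hy). intros. unfold ellX. field. lra. Qed.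

Lemma ell_r_XZ y : 3 <= y -> ell_r y = 2 * ellX y * (1 - ellX y) * ellZ y ^ 2.
Proof.
intros Hy. generalize (ellZ_pos y Hy) (ellZ_sqr y Hy). intros P Q.
assert (ell_r y = (ellZ y ^ 2 - ell_s y ^ 2 / 16) / 2) by lra. rewrite H.
rewrite (ell_s_XZ y Hy). field.
Qed.

Lemma ellZ_derive y : 3 <= y -> is_derive ellZ y (- 4 * mu2 y * ellZ y).
Proof.
intros Hy. generalize (ellZ_pos y Hy) (ellZ_sqr y Hy) (ell_r_derive y Hy) (ell_s_derive y Hy). intros P Q HR HS.
unfold ellZ. auto_derive.
- repeat split; try (eexists; eassumption). generalize (ell_r_pos y Hy) (pow2_ge_0 (ell_s y)). simpl. lra.
- subst_Derive HR; subst_Derive HS.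
  replace (ell_s y * (ell_s y * 1) * / 16 + 2 * ell_r y) with (ell_s y ^ 2 / 16 + 2 * ell_r y) by (simpl; field).
  fold (ellZ y). field_simplify_eq; [|lra]. rewrite Q. field.
Qed.

Lemma ellX_derive y : 3 <= y -> is_derive ellX y (- 4 * ellX y * (1 - ellX y) * ellZ y).
Proof.
intros Hy. generalize (ellZ_pos y Hy) (ellZ_derive y Hy) (ell_s_derive y Hy). intros P HZ HS.
unfold ellX at 1. auto_derive.
- repeat split; try (eexists; eassumption). lra.
- subst_Derive HZ; subst_Derive HS. rewrite ell_r_XZ, ell_s_XZ by auto. field. lra.
Qed.

Lemma ellX_range y : 3 <= y -> 0 < ellX y < 1.
Proof.
intros Hy. generalize (ell_r_XZ y Hy) (ell_r_pos y Hy) (ellZ_pos y Hy). intros E P Q.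
assert (0 < ellZ y ^ 2) by nra. assert (0 < ellX y * (1 - ellX y)) by nra. split; nra.
Qed.

Lemma mu2_derive_XZ y : 3 <= y -> is_derive mu2 y (- (2 * ellX y * (1 - ellX y) * ellZ y ^ 2 + 2 * mu2 y ^ 2)).
Proof. intros Hy. rewrite <- ell_r_XZ by auto. apply mu2_derive; auto. Qed.

(* The recursion satisfied by the polynomials [R_{2j}]. *)
Definition rho_rec (rho : nat -> R -> R) : Prop :=
  forall x, 0 < x < 1 -> rho 0%nat x = 0 /\ rho 1%nat x = 1 /\
  forall j, (1 <= j)%nat -> INR (2 * j + 2) * INR (2 * j + 1) * rho (S j) x =
    4 * (1 - 2 * x) * rho j x - 6 * x * (1 - x) * conv (fun i => rho i x) j.

(** Homogeneity: once r and s are written through X and Z, each step of the recursion contributes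
    the factor [- Z], and the product in the convolution supplies the second factor X (1 - X). *)
Lemma lambert_coef_rho rho y : rho_rec rho -> 3 <= y -> forall j,
  lambert_coef y j = (-1) ^ S j * ellZ y ^ S j * (ellX y * (1 - ellX y)) * rho j (ellX y).
Proof.
intros Hr Hy. destruct (Hr (ellX y) (ellX_range y Hy)) as (R0 & R1 & RS).
intros j. induction j as [j IH] using lt_wf_ind.
destruct j as [|[|j]].
- rewrite R0. unfold lambert_coef; simpl; ring.
- rewrite R1. generalize (lambert_coef_recursion y 0 Hy). unfold conv. simpl. unfold lambert_coef at 2 3 4. simpl.
  rewrite ell_r_XZ by auto. intros E. apply Rmult_eq_reg_l with ((1 + 1) * 1); lra.
- assert (P : INR (2 * S j + 2) * INR (2 * S j + 1) <> 0).
  { apply Rmult_integral_contrapositive; split; apply not_0_INR; lia. }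
  apply Rmult_eq_reg_l with (INR (2 * S j + 2) * INR (2 * S j + 1)); auto.
  rewrite lambert_coef_recursion by auto. 
  replace (INR (2 * S j + 2) * INR (2 * S j + 1) * ((-1) ^ S (S (S j)) * ellZ y ^ S (S (S j)) * (ellX y * (1 - ellX y)) * rho (S (S j)) (ellX y)))
   with ((-1) ^ S (S (S j)) * ellZ y ^ S (S (S j)) * (ellX y * (1 - ellX y)) *
     (INR (2 * S j + 2) * INR (2 * S j + 1) * rho (S (S j)) (ellX y))) by ring.
  rewrite RS by lia. simpl (Nat.eqb (S j) 0). cbv iota.
  rewrite (IH (S j)) by lia.
  assert (CE : conv (lambert_coef y) (S j) = (-1) ^ (S j) * ellZ y ^ S (S (S j)) * (ellX y * (1 - ellX y)) ^ 2 * conv (fun i => rho i (ellX y)) (S j)).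
  { unfold conv. rewrite scal_sum. apply sum_eq. intros i Hi.
    destruct (Nat.eq_dec i 0) as [-> |N0].
    { rewrite R0. unfold lambert_coef at 1. simpl Nat.eqb. cbv iota. ring. }
    destruct (Nat.eq_dec i (S j)) as [-> |N1].
    { rewrite Nat.sub_diag, R0. unfold lambert_coef at 2. simpl Nat.eqb. cbv iota. ring. }
    rewrite (IH i) by lia. rewrite (IH (S j - i)%nat) by lia.
    replace (S j) with (i + (S j - i))%nat at 5 6 by lia.
    replace ((-1) ^ (i + (S j - i))) with ((-1) ^ i * (-1) ^ (S j - i)) by (rewrite pow_add; ring).
    replace (ellZ y ^ S (S (i + (S j - i)))) with (ellZ y * ellZ y * (ellZ y ^ i * ellZ y ^ (S j - i))) by (rewrite <- !tech_pow_Rmult, pow_add; ring).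
    simpl pow. ring. }
  rewrite CE, ell_s_XZ by auto. simpl pow. ring.
Qed.

Lemma lambert_rho rho y j : rho_rec rho -> 3 <= y -> (1 <= j)%nat ->
  lambert y (2 * j + 1) = - INR (fact (2 * j)) * ellZ y ^ S j * (ellX y * (1 - ellX y)) * rho j (ellX y).
Proof.
intros Hr Hy Hj. generalize (lambert_coef_rho rho y Hr Hy j). unfold lambert_coef.
replace (Nat.eqb j 0) with false by (symmetry; apply Nat.eqb_neq; lia). intros E.
assert (FN := INR_fact_neq_0 (2 * j)).
assert (S1 : (-1) ^ j * (-1) ^ j = 1).
{ rewrite <- Rpow_mult_distr. replace (-1 * -1) with 1 by ring. apply pow1. }
replace (lambert y (2 * j + 1)) with (INR (fact (2 * j)) * ((-1) ^ j * ((-1) ^ j * lambert y (2 * j + 1) / INR (fact (2 * j))))).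
- rewrite E. simpl ((-1) ^ S j).
  replace (- INR (fact (2 * j)) * ellZ y ^ S j * (ellX y * (1 - ellX y)) * rho j (ellX y)) with
   (- INR (fact (2 * j)) * ellZ y ^ S j * (ellX y * (1 - ellX y)) * rho j (ellX y) * ((-1) ^ j * (-1) ^ j)) by (rewrite S1; ring).
  ring.
- transitivity ((-1) ^ j * (-1) ^ j * lambert y (2 * j + 1)); [field; auto|rewrite S1; ring].
Qed.

(** * Quarter periods *)

Lemma nonincreasing_of_derive (f f' : R -> R) (A : R) :
  (forall x, is_derive f x (f' x)) -> (forall x, 0 <= x <= A -> f' x <= 0) -> 0 <= A -> f A <= f 0.
Proof.
intros Hd Hn HA.
destruct (MVT_gen f 0 A f') as [c [Hc E]].
- intros; auto.
- intros x _. apply derivable_continuous_pt. exists (f' x). apply is_derive_Reals; auto.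
- rewrite Rmin_left, Rmax_right in Hc by auto. generalize (Hn c Hc). nra.
Qed.

Lemma continuous_bounded (f : R -> R) (A : R) : 0 <= A ->
  (forall x, continuous f x) -> exists K, forall x, 0 <= x <= A -> Rabs (f x) <= K.
Proof.
intros HA Hc.
destruct (continuity_ab_maj (fun x => Rabs (f x)) 0 A HA) as [M [HM _]].
- intros c _. apply (continuity_pt_comp f Rabs); [|apply Rcontinuity_abs].
  apply continuity_pt_filterlim, Hc.
- exists (Rabs (f M)). exact HM.
Qed.

(* The quantity [D ^ 2 + E ^ 2], damped by an exponential, is nonincreasing. *)
Lemma linear_system_zero (D E p q : R -> R) (A : R) : 0 <= A ->
  (forall x, continuous p x) -> (forall x, continuous q x) ->
  (forall x, is_derive D x (p x * E x)) -> (forall x, is_derive E x (q x * D x)) ->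
  D 0 = 0 -> E 0 = 0 -> D A = 0 /\ E A = 0.
Proof.
intros HA Cp Cq HD HE D0 E0.
destruct (continuous_bounded (fun x => p x + q x) A HA) as [K HK].
{ intros x. apply (continuous_plus (V := R_NormedModule)); auto. }
set (N := fun x => (D x ^ 2 + E x ^ 2) * exp (- (K * x))).
assert (HN : N A <= N 0).
{ apply (nonincreasing_of_derive N (fun x => (2 * (p x + q x) * (D x * E x) - K * (D x ^ 2 + E x ^ 2)) * exp (- (K * x)))); auto.
  - intros x. generalize (HD x) (HE x); intros H1 H2. unfold N. auto_derive.
    + repeat split; auto; eexists; eassumption.
    + subst_Derive H1; subst_Derive H2. ring.
  - intros x Hx. specialize (HK x Hx). generalize (exp_pos (- (K * x))). intros P.
    assert (2 * (p x + q x) * (D x * E x) <= K * (D x ^ 2 + E x ^ 2)); [|nra].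
    apply Rle_trans with (Rabs (p x + q x) * (2 * Rabs (D x * E x))).
    + eapply Rle_trans; [apply Rle_abs|]. rewrite !Rabs_mult, (Rabs_pos_eq 2) by lra. right; ring.
    + apply Rmult_le_compat; try apply Rabs_pos; auto.
      * generalize (Rabs_pos (D x * E x)); lra.
      * unfold Rabs; destruct Rcase_abs; generalize (pow2_ge_0 (D x - E x)) (pow2_ge_0 (D x + E x)); simpl; lra. }
unfold N in HN. rewrite D0, E0 in HN. generalize (exp_pos (- (K * A))). intros P.
assert (D A ^ 2 + E A ^ 2 <= 0) by nra.
generalize (pow2_ge_0 (D A)) (pow2_ge_0 (E A)). intros. split; nra.
Qed.

(** Putting u = a sin^2 t into u'^2 = 4 u (a - u) (b + u) leaves t' = [ellw a b t]; so [ellJ a b] is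
    the argument at which u reaches the amplitude [t]. *)
Definition ellw (a b t : R) : R := sqrt (b + a * sin t ^ 2).
Definition ellJ (a b x : R) : R := RInt (fun t => / ellw a b t) 0 x.

Lemma sin2_range t : 0 <= sin t ^ 2 <= 1.
Proof. generalize (sin2_cos2 t) (pow2_ge_0 (cos t)) (pow2_ge_0 (sin t)). unfold Rsqr. simpl; lra. Qed.

Lemma ellw_bounds a b t : 0 < a -> 0 < b -> 0 < ellw a b t <= sqrt (a + b).
Proof.
intros Ha Hb. generalize (sin2_range t). intros. split.
- apply sqrt_lt_R0. nra.
- apply sqrt_le_1_alt. nra.
Qed.

Lemma ellw_sqr a b t : 0 < a -> 0 < b -> ellw a b t * ellw a b t = b + a * sin t ^ 2.
Proof. intros Ha Hb. unfold ellw. apply sqrt_sqrt. generalize (sin2_range t). nra. Qed.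

Lemma ellw_derive a b t : 0 < a -> 0 < b -> is_derive (ellw a b) t (a * sin t * cos t / ellw a b t).
Proof.
intros Ha Hb. generalize (sin2_range t) (ellw_bounds a b t Ha Hb). intros H P. unfold ellw. auto_derive.
- simpl in *. nra.
- unfold ellw in P. simpl in *. field. lra.
Qed.

Lemma inv_ellw_continuous a b t : 0 < a -> 0 < b -> continuous (fun t => / ellw a b t) t.
Proof.
intros Ha Hb. generalize (ellw_bounds a b t Ha Hb) (ellw_derive a b t Ha Hb). intros P H.
apply ex_derive_Rcontinuous. auto_derive. split; [eexists; exact H|lra].
Qed.


Lemma RInt_cont_derive (f : R -> R) a x : (forall x, continuous f x) ->
  is_derive (fun x => RInt f a x) x (f x).
Proof.
intros H. apply (is_derive_RInt (V := R_NormedModule) f (fun x => RInt f a x) a x).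
- exists (mkposreal 1 Rlt_0_1). intros y _. apply (RInt_correct (V := R_CompleteNormedModule)).
  apply ex_RInt_Rcontinuous; auto.
- apply H.
Qed.

Lemma ellJ_derive a b x : 0 < a -> 0 < b -> is_derive (ellJ a b) x (/ ellw a b x).
Proof.
intros Ha Hb. apply (RInt_cont_derive (fun t => / ellw a b t)). intros; apply inv_ellw_continuous; auto.
Qed.

Lemma ellJ_0 a b : ellJ a b 0 = 0.
Proof. unfold ellJ. apply (RInt_point (V := R_CompleteNormedModule)). Qed.

(** With the amplitude as independent variable no inverse of [ellJ] occurs. The differences from the
    explicit solution satisfy a linear system, since u^2 - w^2 = (u - w) (u + w). *)
Lemma ode_solution (a b : R) (u v : R -> R) (A : R) : 0 < a -> 0 < b -> 0 <= A ->
  (forall x, is_derive u x (v x)) ->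
  (forall x, is_derive v x (2 * a * b + 4 * (a - b) * u x - 6 * u x ^ 2)) ->
  u 0 = 0 -> v 0 = 0 ->
  u (ellJ a b A) = a * sin A ^ 2 /\ v (ellJ a b A) = 2 * a * sin A * cos A * ellw a b A.
Proof.
intros Ha Hb HA Hu Hv u0 v0.
set (D := fun x => u (ellJ a b x) - a * sin x ^ 2).
set (E := fun x => v (ellJ a b x) - 2 * a * sin x * cos x * ellw a b x).
assert (Cu : forall x, continuous (fun x => u (ellJ a b x)) x).
{ intros x. apply ex_derive_Rcontinuous. eexists.
  apply (is_derive_comp u (ellJ a b)); [apply Hu|apply ellJ_derive; auto]. }
destruct (linear_system_zero D E (fun x => / ellw a b x)
  (fun x => / ellw a b x * (4 * (a - b) - 6 * (u (ellJ a b x) + a * sin x ^ 2))) A HA) as [HD HE].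
- intros x; apply inv_ellw_continuous; auto.
- intros x. apply (continuous_mult (K := R_AbsRing)); [apply inv_ellw_continuous; auto|].
  apply (continuous_minus (V := R_NormedModule)); [apply continuous_const|].
  apply (continuous_mult (K := R_AbsRing)); [apply continuous_const|].
  apply (continuous_plus (V := R_NormedModule)); [apply Cu|].
  apply ex_derive_Rcontinuous. auto_derive; auto.
- intros x. generalize (ellJ_derive a b x Ha Hb) (ellw_bounds a b x Ha Hb); intros HJ P.
  generalize (Hu (ellJ a b x)); intros HU. unfold D, E. auto_derive.
  + repeat split; auto; eexists; eassumption.
  + subst_Derive HJ; subst_Derive HU. field. lra.
- intros x. generalize (ellJ_derive a b x Ha Hb) (ellw_bounds a b x Ha Hb) (ellw_derive a b x Ha Hb); intros HJ P HW.
  generalize (Hv (ellJ a b x)); intros HV. unfold D, E. auto_derive.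
  + repeat split; auto; eexists; eassumption.
  + subst_Derive HJ; subst_Derive HV; subst_Derive HW.
    generalize (ellw_sqr a b x Ha Hb) (sin2_cos2 x). unfold Rsqr. intros W SC.
    set (w := ellw a b x) in *. set (s := sin x) in *. set (c := cos x) in *.
    set (U := u (ellJ a b x)).
    field_simplify_eq; [|lra].
    replace (c ^ 2) with (1 - s ^ 2) by (simpl; lra).
    replace (w ^ 2) with (b + a * s ^ 2) by (simpl in *; lra). ring.
- unfold D. rewrite ellJ_0, u0, sin_0. ring.
- unfold E. rewrite ellJ_0, v0, sin_0. ring.
- unfold D, E in HD, HE. split; lra.
Qed.

(** Along the explicit solution [v] vanishes only where sin A cos A = 0. As [ellw] is at most sqrt(a
    + b) < 1, the amplitude [PI] is reached beyond [PI >= T]; so the amplitude of [T] lies strictly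
    between [0] and [PI] and must be PI / 2. *)
Lemma quarter_period (a b : R) (u v : R -> R) (T : R) : 0 < a -> 0 < b -> a + b < 1 -> 0 < T <= PI ->
  (forall x, is_derive u x (v x)) ->
  (forall x, is_derive v x (2 * a * b + 4 * (a - b) * u x - 6 * u x ^ 2)) ->
  u 0 = 0 -> v 0 = 0 -> v T = 0 -> ellJ a b (PI / 2) = T.
Proof.
intros Ha Hb Hab HT Hu Hv u0 v0 vT.
assert (P := PI_RGT_0).
assert (HJ : PI < ellJ a b PI).
{ apply Rlt_le_trans with (/ sqrt (a + b) * PI).
  - rewrite <- (Rmult_1_l PI) at 1. apply Rmult_lt_compat_r; auto.
    rewrite <- Rinv_1 at 1. apply Rinv_lt_contravar.
    + rewrite Rmult_1_r. apply sqrt_lt_R0; lra.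
    + rewrite <- sqrt_1. apply sqrt_lt_1_alt; lra.
  - unfold ellJ. replace (/ sqrt (a + b) * PI) with (RInt (fun _ => / sqrt (a + b)) 0 PI).
    2:{ rewrite RInt_Rconst. Rgoal. ring. }
    apply RInt_le; [lra|apply ex_RInt_const|apply ex_RInt_Rcontinuous; intros; apply inv_ellw_continuous; auto|].
    intros x _. destruct (ellw_bounds a b x Ha Hb). apply Rinv_le_contravar; auto. }
destruct (IVT_gen (ellJ a b) 0 PI T) as [A [HA EA]].
- intros x. apply derivable_continuous_pt. eexists. apply is_derive_Reals, ellJ_derive; auto.
- rewrite ellJ_0, Rmin_left, Rmax_right by lra. lra.
- rewrite Rmin_left, Rmax_right in HA by lra.
  assert (A <> 0) by (intros ->; rewrite ellJ_0 in EA; lra).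
  assert (A <> PI) by (intros ->; lra).
  destruct (ode_solution a b u v A Ha Hb (proj1 HA) Hu Hv u0 v0) as [_ E].
  rewrite EA, vT in E. destruct (ellw_bounds a b A Ha Hb) as [W _].
  assert (S : 0 < sin A) by (apply sin_gt_0; lra).
  assert (CA : cos A = 0).
  { assert (Q : 0 < 2 * a * sin A * ellw a b A) by (repeat apply Rmult_lt_0_compat; lra).
    apply Rmult_eq_reg_l with (2 * a * sin A * ellw a b A); lra. }
  destruct (Rtotal_order A (PI / 2)) as [L|[<- |L]]; auto; exfalso.
  + generalize (cos_gt_0 A). lra.
  + generalize (cos_lt_0 A). lra.
Qed.

(** The integrands compare pointwise, because (b + a sin^2) - (a + b sin^2) = (b - a) cos^2. *)
Lemma ellJ_sym_inj a b : 0 < a -> 0 < b -> ellJ a b (PI / 2) = ellJ b a (PI / 2) -> a = b.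
Proof.
intros Ha Hb E. assert (P := PI_RGT_0).
assert (Lt : forall a b, 0 < a -> 0 < b -> a < b -> ellJ a b (PI / 2) < ellJ b a (PI / 2)).
{ clear - P. intros a b Ha Hb L. unfold ellJ.
  apply RInt_lt; [lra| | |]; try (intros; apply inv_ellw_continuous; auto).
  intros x Hx. assert (Q : 0 < cos x) by (apply cos_gt_0; lra).
  assert (Hs := sin2_cos2 x). unfold Rsqr in Hs.
  destruct (ellw_bounds b a x Hb Ha) as [W _]. apply Rinv_lt_contravar.
  + apply Rmult_lt_0_compat; auto. apply ellw_bounds; auto.
  + assert (C2 : 0 < (b - a) * (cos x * cos x)) by (repeat apply Rmult_lt_0_compat; lra).
    assert (S2 : sin x ^ 2 = 1 - cos x * cos x) by (simpl; lra).
    apply sqrt_lt_1_alt. generalize (sin2_range x). rewrite S2. intros R2. split; nra. }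
destruct (Rtotal_order a b) as [L|[L|L]]; auto.
- generalize (Lt a b Ha Hb L); lra.
- generalize (Lt b a Hb Ha L); lra.
Qed.

(** * The values at y = PI *)

Lemma sin_nPI n : sin (IZR n * PI) = 0.
Proof. apply sin_eq_0_1. exists n; reflexivity. Qed.

Lemma thetas_false_PI y k : thetas false y k PI = 0.
Proof.
unfold thetas. rewrite (Zsum_ext _ (fun n => 0 * 0)); [rewrite Zsum_scal; ring|].
intros n. simpl tsin. rewrite sin_nPI. ring.
Qed.

Lemma logth1_false_PI y : logth1 false y PI = 0.
Proof. unfold logth1. rewrite thetas_false_PI. unfold Rdiv; ring. Qed.
Lemma logth3_false_PI y : logth3 false y PI = 0.
Proof. unfold logth3. rewrite !thetas_false_PI. unfold Rdiv; ring. Qed.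

Lemma thetac_true_exp y x : 0 < y -> thetac true y 0 x = Zsum (fun n => exp (- (IZR n ^ 2 * y) + x * IZR n)).
Proof.
intros Hy.
assert (E : Zsummable (fun n => exp (- (IZR n ^ 2 * y) + x * IZR n))).
{ apply (Zsummable_ext (fun n => 1 * exp (- (IZR n ^ 2 * y) + x * IZR n))); [intros; ring|].
  apply (Zsummable_gexp y x (fun _ => 1) 1); auto. intros; rewrite Rabs_R1; lra. }
transitivity (/ 2 * (Zsum (fun n => exp (- (IZR n ^ 2 * y) + x * IZR n)) +
   Zsum (fun n => exp (- (IZR (- n) ^ 2 * y) + x * IZR (- n))))).
- rewrite <- Zsum_plus; auto.
  + rewrite <- Zsum_scal. apply Zsum_ext; intros n. rewrite opp_IZR. unfold gauss; simpl tcos. unfold cosh.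
    replace (- ((- IZR n) ^ 2 * y) + x * - IZR n) with (- (IZR n ^ 2 * y) + - (IZR n * x)) by ring.
    replace (- (IZR n ^ 2 * y) + x * IZR n) with (- (IZR n ^ 2 * y) + (IZR n * x)) by ring.
    rewrite !exp_plus. field.
  + apply (Zsummable_refl _ E).
- rewrite (Zsum_refl (fun n => exp (- (IZR n ^ 2 * y) + x * IZR n))) by auto. field.
Qed.

(** The reflection n -> 1 - n in the exponential form of the series. *)
Lemma thetac_true_quasi y x : 0 < y -> thetac true y 0 (2 * y - x) = exp (y - x) * thetac true y 0 x.
Proof.
intros Hy. rewrite !thetac_true_exp by auto. rewrite <- Zsum_scal.
rewrite <- (Zsum_flip (fun n => exp (- (IZR n ^ 2 * y) + (2 * y - x) * IZR n)) 1).
- apply Zsum_ext; intros n. rewrite <- exp_plus, minus_IZR. f_equal. ring.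
- apply (Zsummable_ext (fun n => 1 * exp (- (IZR n ^ 2 * y) + (2 * y - x) * IZR n))); [intros; ring|].
  apply (Zsummable_gexp y (2 * y - x) (fun _ => 1) 1); auto. intros; rewrite Rabs_R1; lra.
Qed.

Lemma is_derive_reflect (f : R -> R) (l c x : R) :
  is_derive f (c - x) l -> is_derive (fun t => f (c - t)) x (- l).
Proof.
intros H. auto_derive; [eexists; exact H|]. subst_Derive H. ring.
Qed.

(** Logarithmic derivative of the quasi-periodicity. Differentiating it further makes x = y a
    critical point of the second logarithmic derivative, hence a candidate for the quarter
    period. *)
Lemma logth1_true_reflect y x : 3 <= y -> logth1 true y (2 * y - x) = 1 - logth1 true y x.
Proof.
intros Hy. assert (Hy0 : 0 < y) by lra.
assert (D : forall t, is_derive (fun t => ln (thetac true y 0 t)) t (logth1 true y t)).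
{ intros t. generalize (thetac_derive true y 0 t Hy0) (thetac0_pos true y t Hy). intros H P.
  auto_derive; [split; [eexists; exact H|split; [exact P|auto]]|]. subst_Derive H. unfold logth1. simpl eps. field. lra. }
assert (D1 := is_derive_reflect _ _ (2 * y) x (D (2 * y - x))).
assert (D2 : is_derive (fun t => ln (thetac true y 0 (2 * y - t))) x (-1 + logth1 true y x)).
{ apply (is_derive_ext (fun t => (y - t) + ln (thetac true y 0 t))).
  - intros t. rewrite thetac_true_quasi by auto. rewrite ln_mult; [|apply exp_pos|apply thetac0_pos; auto].
    now rewrite ln_exp.
  - apply is_derive_Rplus; [|apply D]. auto_derive; auto; ring. }
apply (is_derive_inj _ _ _ _ D1) in D2. lra.
Qed.

Lemma logth2_true_reflect y x : 3 <= y -> logth2 true y (2 * y - x) = logth2 true y x.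
Proof.
intros Hy.
assert (D1 := is_derive_reflect _ _ (2 * y) x (logth1_derive true y (2 * y - x) Hy)).
assert (D2 : is_derive (fun t => logth1 true y (2 * y - t)) x (- logth2 true y x)).
{ apply (is_derive_ext (fun t => 1 - logth1 true y t)).
  - intros t. now rewrite logth1_true_reflect.
  - generalize (logth1_derive true y x Hy); intros H. auto_derive; [eexists; exact H|]. subst_Derive H. ring. }
apply (is_derive_inj _ _ _ _ D1) in D2. lra.
Qed.

Lemma logth3_true_y y : 3 <= y -> logth3 true y y = 0.
Proof.
intros Hy. assert (E : 2 * y - y = y) by ring.
assert (D0 := logth2_derive true y (2 * y - y) Hy).
assert (D1 := is_derive_reflect _ _ (2 * y) y D0). rewrite E in D1.
assert (D2 : is_derive (fun t => logth2 true y (2 * y - t)) y (logth3 true y y)).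
{ apply (is_derive_ext (fun t => logth2 true y t)).
  - intros t. now rewrite logth2_true_reflect.
  - apply logth2_derive; auto. }
apply (is_derive_inj _ _ _ _ D1) in D2. lra.
Qed.

Lemma logth1_true_y y : 3 <= y -> logth1 true y y = 1 / 2.
Proof. intros Hy. generalize (logth1_true_reflect y y Hy). replace (2 * y - y) with y by ring. lra. Qed.

Lemma PI_ge3 : 3 < PI.
Proof. generalize PI2_3_2. lra. Qed.

Lemma ellZ_lt1 y : 3 <= y -> ellZ y < 1.
Proof.
intros Hy. unfold ellZ. rewrite <- sqrt_1. apply sqrt_lt_1_alt.
generalize (ellZ_sqr_lt1 y Hy) (ell_r_pos y Hy) (pow2_ge_0 (ell_s y)). lra.
Qed.

(** The unknown u of the elliptic equation; passing from [e = false] to [e = true] exchanges a = X Z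
    and b = (1 - X) Z in that equation. *)
Definition wpth (e : bool) (y x : R) : R := logth2 e y x - eps e * mu2 y.

Lemma wpth_derive e y x : 3 <= y -> is_derive (wpth e y) x (logth3 e y x).
Proof.
intros Hy. unfold wpth. generalize (logth2_derive e y x Hy); intros H.
auto_derive; [eexists; exact H|]. subst_Derive H. ring.
Qed.

Lemma wpth_0 e y : 3 <= y -> wpth e y 0 = 0.
Proof. intros Hy. unfold wpth. rewrite logth2_0 by auto. ring. Qed.

Lemma logth3_derive_XZ e y x : 3 <= y -> is_derive (logth3 e y) x
  (2 * (ellX y * ellZ y) * ((1 - ellX y) * ellZ y) - eps e * (4 * (ellX y * ellZ y - (1 - ellX y) * ellZ y)) * wpth e y x - 6 * wpth e y x ^ 2).
Proof.
intros Hy. generalize (logth3_derive e y x Hy). rewrite (ell_r_XZ y Hy), (ell_s_XZ y Hy). fold (wpth e y x). intros H.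
apply (is_derive_eq _ _ _ _ H). ring.
Qed.

Lemma ellX_PI : ellX PI = 1 / 2 /\ PI = ellJ (ellZ PI / 2) (ellZ PI / 2) (PI / 2).
Proof.
assert (Hy : 3 <= PI) by (generalize PI_ge3; lra).
generalize (ellX_range PI Hy) (ellZ_pos PI Hy) (ellZ_lt1 PI Hy). intros HX HZ HZ1.
set (a := ellX PI * ellZ PI). set (b := (1 - ellX PI) * ellZ PI).
assert (Ha : 0 < a) by (apply Rmult_lt_0_compat; lra).
assert (Hb : 0 < b) by (apply Rmult_lt_0_compat; lra).
assert (Hab : a + b < 1) by (unfold a, b; lra).
assert (HP : 0 < PI <= PI) by lra.
assert (Q1 : ellJ a b (PI / 2) = PI).
{ apply (quarter_period a b (wpth false PI) (logth3 false PI) PI); auto.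
  - intros x; apply wpth_derive; auto.
  - intros x. generalize (logth3_derive_XZ false PI x Hy). fold a b. intros H. apply (is_derive_eq _ _ _ _ H). simpl eps; ring.
  - apply wpth_0; auto.
  - apply logth3_0.
  - apply logth3_false_PI. }
assert (Q2 : ellJ b a (PI / 2) = PI).
{ apply (quarter_period b a (wpth true PI) (logth3 true PI) PI); auto.
  - lra.
  - intros x; apply wpth_derive; auto.
  - intros x. generalize (logth3_derive_XZ true PI x Hy). fold a b. intros H. apply (is_derive_eq _ _ _ _ H). simpl eps; ring.
  - apply wpth_0; auto.
  - apply logth3_0.
  - apply logth3_true_y; auto. }
assert (E : a = b) by (apply ellJ_sym_inj; auto; congruence).
assert (X2 : ellX PI = 1 / 2) by (unfold a, b in E; nra).
split; auto. rewrite <- Q1 at 1. unfold a, b. rewrite X2. f_equal; field.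
Qed.

(** At X = 1/2 the equations for both values of [e] coincide, and so do their solutions. Integrating
    the equality gives logth1 true - logth1 false = 2 mu2 x, and at x = PI the left side is 1/2 -
    0. *)
Lemma mu2_PI : mu2 PI = / (4 * PI).
Proof.
assert (Hy : 3 <= PI) by (generalize PI_ge3; lra).
destruct ellX_PI as [X2 _].
assert (Cu : forall e x, continuous (wpth e PI) x).
{ intros e x. apply ex_derive_Rcontinuous. eexists; apply wpth_derive; auto. }
assert (EU : forall A, 0 <= A -> wpth true PI A = wpth false PI A).
{ intros A HA.
  destruct (linear_system_zero (fun x => wpth true PI x - wpth false PI x) (fun x => logth3 true PI x - logth3 false PI x)
   (fun _ => 1) (fun x => -6 * (wpth true PI x + wpth false PI x)) A HA) as [H _]; try lra.
  - intros; apply continuous_const.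
  - intros x. apply (continuous_scal_r (V := R_NormedModule)). apply (continuous_plus (V := R_NormedModule)); auto.
  - intros x. generalize (wpth_derive true PI x Hy) (wpth_derive false PI x Hy); intros H1 H2.
    rewrite Rmult_1_l. apply is_derive_Rminus; auto.
  - intros x. generalize (logth3_derive_XZ true PI x Hy) (logth3_derive_XZ false PI x Hy); intros H1 H2.
    generalize (is_derive_Rminus _ _ _ _ _ H1 H2). intros H.
    apply (is_derive_eq _ _ _ _ H). rewrite X2. unfold minus, plus, opp; simpl. field.
  - rewrite !wpth_0; auto. ring.
  - rewrite !logth3_0. ring. }
(* Monotonicity for both signs [s] amounts to constancy. *)
assert (N : forall s, Rabs s = 1 -> s * (logth1 true PI PI - logth1 false PI PI - 2 * mu2 PI * PI) <= s * (logth1 true PI 0 - logth1 false PI 0 - 2 * mu2 PI * 0)).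
{ intros s _.
  apply (nonincreasing_of_derive (fun x => s * (logth1 true PI x - logth1 false PI x - 2 * mu2 PI * x))
   (fun x => s * (logth2 true PI x - logth2 false PI x - 2 * mu2 PI)) PI); [| |lra].
  - intros x. generalize (logth1_derive true PI x Hy) (logth1_derive false PI x Hy); intros H1 H2.
    auto_derive; [repeat split; eexists; eassumption|]. subst_Derive H1; subst_Derive H2. ring.
  - intros x Hx. generalize (EU x (proj1 Hx)). unfold wpth. simpl eps. intros E.
    replace (logth2 true PI x - logth2 false PI x - 2 * mu2 PI) with 0 by lra. lra. }
generalize (N 1 Rabs_R1). assert (M1 : Rabs (-1) = 1) by (rewrite Rabs_left; lra). generalize (N (-1) M1).
rewrite !logth1_0, logth1_false_PI, logth1_true_y by auto. intros.
apply Rmult_eq_reg_r with (4 * PI); [|lra]. rewrite Rinv_l; lra.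
Qed.

(** * The lemniscate integral and Gamma(1/4) *)

Definition exppow_int (p : nat) (x : R) : R := RInt (fun t => exp (- t ^ p)) 0 x.

Lemma exp_pow_continuous p x : continuous (fun t => exp (- t ^ p)) x.
Proof. apply ex_derive_Rcontinuous. auto_derive; auto. Qed.

Lemma exppow_int_derive p x : is_derive (exppow_int p) x (exp (- x ^ p)).
Proof. apply (RInt_cont_derive (fun t => exp (- t ^ p))). intros; apply exp_pow_continuous. Qed.

Lemma exppow_int_0 p : exppow_int p 0 = 0.
Proof. apply (RInt_point (V := R_CompleteNormedModule)). Qed.

Lemma exppow_int_scale p X : 0 < X -> X * RInt (fun u => exp (- (X * u) ^ p)) 0 1 = exppow_int p X.
Proof.
intros HX. unfold exppow_int.
generalize (RInt_comp_lin (V := R_CompleteNormedModule) (fun t => exp (- t ^ p)) X 0 0 1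
  (ex_RInt_Rcontinuous _ _ _ (exp_pow_continuous p))).
replace (X * 0 + 0) with 0 by ring. replace (X * 1 + 0) with X by ring. intros <-.
rewrite (RInt_scal (V := R_CompleteNormedModule)).
- unfold scal; simpl; unfold mult; simpl. f_equal. apply RInt_ext. intros x _. now rewrite Rplus_0_r.
- apply ex_RInt_Rcontinuous. intros x. apply (continuous_comp (fun y => X * y + 0) (fun t => exp (- t ^ p)));
   [|apply exp_pow_continuous]. apply ex_derive_Rcontinuous. auto_derive; auto.
Qed.

(* Gaussian-integral trick: both sides have the same derivative in [X]. *)
Lemma exppow_int_sqr (p : nat) (F : R -> R -> R) :
  (forall X u, is_derive (fun X => F X u) X (2 * X * exp (- (X ^ p * (1 + u ^ p))))) ->
  (forall X u, continuous (F X) u) ->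
  RInt (F 0) 0 1 = 0 ->
  forall X, 0 <= X -> exppow_int p X ^ 2 = RInt (F X) 0 1.
Proof.
intros HF tcos F0 X HX.
assert (D1 : forall X, is_derive (fun X => exppow_int p X ^ 2) X (2 * exp (- X ^ p) * exppow_int p X)).
{ intros x. generalize (exppow_int_derive p x); intros H. auto_derive; [eexists; exact H|].
  subst_Derive H. ring. }
assert (D2 : forall X, is_derive (fun X => RInt (F X) 0 1) X
   (RInt (fun u => 2 * X * exp (- (X ^ p * (1 + u ^ p)))) 0 1)).
{ intros x.
  replace (RInt (fun u => 2 * x * exp (- (x ^ p * (1 + u ^ p)))) 0 1) with
    (RInt (fun t => Derive (fun u => F u t) x) 0 1).
  2:{ apply RInt_ext; intros u _. apply is_derive_unique, HF. }
  apply is_derive_RInt_param.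
  - exists (mkposreal 1 Rlt_0_1). intros y _ t _. eexists; apply HF.
  - intros t _. apply continuity_2d_pt_filterlim.
    apply (filterlim_ext (fun z : R * R => 2 * fst z * exp (- (fst z ^ p * (1 + snd z ^ p))))).
    { intros [z1 z2]; simpl. symmetry; apply is_derive_unique, HF. }
    assert (EQ : Derive (fun z : R => F z t) x = 2 * x * exp (- (x ^ p * (1 + t ^ p)))) by apply is_derive_unique, HF.
    rewrite EQ.
    change (continuous (fun z : R * R => 2 * fst z * exp (- (fst z ^ p * (1 + snd z ^ p)))) (x, t)).
    assert (Cp : forall x, continuous (fun t => t ^ p) x).
    { intros y; apply ex_derive_Rcontinuous. auto_derive; auto. }
    apply (continuous_mult (K := R_AbsRing)).
    + apply (continuous_mult (K := R_AbsRing)); [apply continuous_const|apply continuous_fst].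
    + apply (continuous_comp (fun z : R * R => - (fst z ^ p * (1 + snd z ^ p))) exp).
      * apply (continuous_opp (V := R_NormedModule)). apply (continuous_mult (K := R_AbsRing)).
        -- apply (continuous_comp (fun z : R * R => fst z) (fun t => t ^ p)); [apply continuous_fst|apply Cp].
        -- apply (continuous_plus (V := R_NormedModule)); [apply continuous_const|].
           apply (continuous_comp (fun z : R * R => snd z) (fun t => t ^ p)); [apply continuous_snd|apply Cp].
      * apply ex_derive_Rcontinuous. auto_derive; auto.
  - exists (mkposreal 1 Rlt_0_1). intros y _. apply ex_RInt_Rcontinuous; auto. }
(* The substitution t = x u moves the inner integral to the fixed interval [0, 1], where it becomes
   the integral of the derivative of [F]. *)
assert (E : forall x, 0 <= x -> 2 * exp (- x ^ p) * exppow_int p x = RInt (fun u => 2 * x * exp (- (x ^ p * (1 + u ^ p)))) 0 1).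
{ intros x Hx. destruct (Rle_lt_or_eq_dec 0 x Hx) as [L|<-].
  - rewrite <- (exppow_int_scale p x L). rewrite <- Rmult_assoc.
    rewrite <- (RInt_scal (V := R_CompleteNormedModule)).
    + apply RInt_ext; intros u _. unfold scal; simpl; unfold mult; simpl.
      replace (- (x ^ p * (1 + u ^ p))) with (- x ^ p + - (x * u) ^ p) by (rewrite Rpow_mult_distr; ring).
      rewrite exp_plus. ring.
    + apply ex_RInt_Rcontinuous. intros u. apply ex_derive_Rcontinuous. auto_derive; auto.
  - rewrite exppow_int_0, Rmult_0_r. symmetry.
    rewrite (RInt_ext _ (fun _ => 0)); [|intros; rewrite Rmult_0_r, Rmult_0_l; reflexivity].
    rewrite RInt_Rconst. Rgoal. ring. }
assert (N : forall s, s * (exppow_int p X ^ 2 - RInt (F X) 0 1) <= s * (exppow_int p 0 ^ 2 - RInt (F 0) 0 1)).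
{ intros s.
  apply (nonincreasing_of_derive (fun x => s * (exppow_int p x ^ 2 - RInt (F x) 0 1))
   (fun x => s * (2 * exp (- x ^ p) * exppow_int p x - RInt (fun u => 2 * x * exp (- (x ^ p * (1 + u ^ p)))) 0 1)) X); auto.
  - intros x. apply (is_derive_scal (fun x => exppow_int p x ^ 2 - RInt (F x) 0 1)).
    apply is_derive_Rminus; auto.
  - intros x Hx. rewrite E by lra. right; ring. }
rewrite exppow_int_0, F0 in N. generalize (N 1) (N (-1)). lra.
Qed.

Lemma Egauss2_sqr X : 0 <= X ->
  exppow_int 2 X ^ 2 = RInt (fun u => (1 - exp (- (X ^ 2 * (1 + u ^ 2)))) / (1 + u ^ 2)) 0 1.
Proof.
intros HX. assert (P : forall u : R, 0 < 1 + u ^ 2) by (intros u; generalize (pow2_ge_0 u); lra).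
apply (exppow_int_sqr 2 (fun X u => (1 - exp (- (X ^ 2 * (1 + u ^ 2)))) / (1 + u ^ 2))); auto.
- intros x u. specialize (P u). auto_derive; [simpl in P; lra|]. simpl in *. field. lra.
- intros x u. specialize (P u). apply ex_derive_Rcontinuous.
  auto_derive. simpl in P. lra.
- rewrite (RInt_ext _ (fun _ => 0)).
  + rewrite RInt_Rconst. Rgoal. ring.
  + intros u _. replace (- (0 ^ 2 * (1 + u ^ 2))) with 0 by ring. rewrite exp_0. Rgoal. unfold Rdiv; ring.
Qed.

Lemma RInt_inv_1_x2 : RInt (fun u => / (1 + u ^ 2)) 0 1 = PI / 4.
Proof.
apply is_RInt_unique.
replace (PI / 4) with (minus (atan 1) (atan 0)).
- apply (is_RInt_derive (V := R_CompleteNormedModule) atan).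
  + intros x _. auto_derive; auto. simpl. field. generalize (pow2_ge_0 x). simpl; lra.
  + intros x _. apply ex_derive_Rcontinuous. auto_derive.
    generalize (pow2_ge_0 x). simpl; lra.
- rewrite atan_1, atan_0. unfold minus, plus, opp; simpl. ring.
Qed.

Lemma is_lim_Egauss2 : is_lim (exppow_int 2) p_infty (sqrt PI / 2).
Proof.
assert (P : forall u : R, 0 < 1 + u ^ 2) by (intros u; generalize (pow2_ge_0 u); lra).
assert (Pos : forall X, 0 <= X -> 0 <= exppow_int 2 X).
{ intros X HX. unfold exppow_int. apply RInt_ge_0; auto.
  - apply ex_RInt_Rcontinuous, exp_pow_continuous.
  - intros; apply exp_ge0. }
assert (L : is_lim (fun X => exppow_int 2 X ^ 2) p_infty (PI / 4)).
(* The error term comes from X^2 >= 2 X - 1 >= X - 1 and only has to tend to [0]. *)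
{ assert (B : forall X, 0 <= X -> PI / 4 - exp (- X) * exp 1 <= exppow_int 2 X ^ 2 <= PI / 4).
  { intros X HX. rewrite Egauss2_sqr by auto.
    assert (Ci : forall x, continuous (fun u => / (1 + u ^ 2)) x).
    { intros x. specialize (P x). apply ex_derive_Rcontinuous. auto_derive. simpl in P; lra. }
    assert (Cj : forall x, continuous (fun u => (1 - exp (- (X ^ 2 * (1 + u ^ 2)))) / (1 + u ^ 2)) x).
    { intros x. specialize (P x). apply ex_derive_Rcontinuous. auto_derive. simpl in P; lra. }
    rewrite <- RInt_inv_1_x2. split.
    - replace (RInt (fun u => / (1 + u ^ 2)) 0 1 - exp (- X) * exp 1) with
        (RInt (fun u => / (1 + u ^ 2) - exp (- X) * exp 1) 0 1).
      + apply RInt_le; [lra| |apply ex_RInt_Rcontinuous; auto|].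
        * apply ex_RInt_Rcontinuous. intros x. apply (continuous_minus (V := R_NormedModule)); [apply Ci|apply continuous_const].
        * intros u Hu. specialize (P u).
          assert (Q : exp (- (X ^ 2 * (1 + u ^ 2))) <= exp (- X) * exp 1).
          { rewrite <- exp_plus. apply exp_le. generalize (pow2_ge_0 (X * u)) (pow2_ge_0 (X - 1)). simpl. nra. }
          assert (Q2 : / (1 + u ^ 2) <= 1).
          { rewrite <- Rinv_1. apply Rinv_le_contravar; [lra|]. generalize (pow2_ge_0 u); lra. }
          assert (0 < / (1 + u ^ 2)) by (apply Rinv_0_lt_compat; auto).
          generalize (exp_pos (- (X ^ 2 * (1 + u ^ 2)))). unfold Rdiv. intros. nra.
      + rewrite (RInt_minus (V := R_CompleteNormedModule) (fun u => / (1 + u ^ 2)) (fun _ => exp (- X) * exp 1)).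
        * rewrite (RInt_const (V := R_CompleteNormedModule)). unfold minus, plus, opp, scal; simpl; unfold mult; simpl. ring.
        * apply ex_RInt_Rcontinuous; auto.
        * apply ex_RInt_const.
    - apply RInt_le; [lra|apply ex_RInt_Rcontinuous; auto|apply ex_RInt_Rcontinuous; auto|].
      intros u Hu. specialize (P u). unfold Rdiv. rewrite <- (Rmult_1_l (/ (1 + u ^ 2))) at 2.
      apply Rmult_le_compat_r; [apply Rlt_le, Rinv_0_lt_compat; auto|].
      generalize (exp_pos (- (X ^ 2 * (1 + u ^ 2)))). lra. }
  apply (is_lim_le_le_loc (fun X => PI / 4 - exp (- X) * exp 1) (fun _ => PI / 4)).
  - exists 0. intros X HX. apply B; lra.
  - replace (Finite (PI / 4)) with (Rbar_minus (PI / 4) (Rbar_mult 0 (exp 1))) by (simpl; f_equal; ring).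
    apply is_lim_minus'; [apply is_lim_const|]. apply (is_lim_scal_r _ (exp 1) p_infty 0).
    apply (is_lim_comp exp (fun x => - x) p_infty 0 m_infty); [apply is_lim_exp_m| |].
    + apply (is_lim_opp (fun x => x) p_infty p_infty). apply is_lim_id.
    + exists 0. intros; discriminate.
  - apply is_lim_const. }
apply (is_lim_ext_loc (fun X => sqrt (exppow_int 2 X ^ 2))).
{ exists 0. intros X HX. apply sqrt_pow2. apply Pos; lra. }
replace (sqrt PI / 2) with (sqrt (PI / 4)).
- apply (is_lim_comp_continuous (fun X => exppow_int 2 X ^ 2) sqrt p_infty (PI / 4)); auto.
  apply continuous_sqrt.
- rewrite sqrt_div; [|generalize PI_RGT_0; lra|lra]. f_equal.
  replace 4 with (2 ^ 2) by ring. apply sqrt_pow2; lra.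
Qed.

(** A lemniscate integral; [Gamma_quarter] shows its value to be Gamma(1/4)^2 / (8 sqrt PI). *)
Definition lemint : R := RInt (fun u => / sqrt (1 + u ^ 4)) 0 1.

Lemma one_u4 u : 1 <= 1 + u ^ 4.
Proof. generalize (pow2_ge_0 (u ^ 2)). intros. simpl in *. nra. Qed.

Lemma inv_sqrt_1u4_continuous x : continuous (fun u => / sqrt (1 + u ^ 4)) x.
Proof.
apply ex_derive_Rcontinuous. generalize (one_u4 x). intros. auto_derive.
simpl in H. split; [lra|]. split; auto. apply Rgt_not_eq, sqrt_lt_R0; lra.
Qed.

(** For [p = 4] the antiderivative in X required by [exppow_int_sqr] is itself a Gaussian integral,
    through z = X^2 sqrt(1 + u^4). *)
Lemma Egauss4_sqr X : 0 <= X ->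
  exppow_int 4 X ^ 2 = RInt (fun u => exppow_int 2 (X ^ 2 * sqrt (1 + u ^ 4)) / sqrt (1 + u ^ 4)) 0 1.
Proof.
intros HX.
assert (S : forall u, 0 < sqrt (1 + u ^ 4)) by (intros u; apply sqrt_lt_R0; generalize (one_u4 u); lra).
apply (exppow_int_sqr 4 (fun X u => exppow_int 2 (X ^ 2 * sqrt (1 + u ^ 4)) / sqrt (1 + u ^ 4))); auto.
- intros x u. specialize (S u). generalize (one_u4 u); intros Hu.
  generalize (exppow_int_derive 2 (x ^ 2 * sqrt (1 + u ^ 4))); intros H.
  unfold Rdiv. set (c := sqrt (1 + u ^ 4)) in *.
  assert (Hc : c ^ 2 = 1 + u ^ 4) by (unfold c; rewrite pow2_sqrt; lra).
  auto_derive; [eexists; exact H|]. subst_Derive H.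
  replace ((x ^ 2 * c) ^ 2) with (x ^ 4 * (1 + u ^ 4)) by (rewrite <- Hc; ring). field. lra.
- intros x u. specialize (S u). generalize (one_u4 u); intros Hu.
  apply ex_derive_Rcontinuous.
  generalize (exppow_int_derive 2 (x ^ 2 * sqrt (1 + u ^ 4))); intros H.
  auto_derive. simpl in *. repeat split; try lra. eexists; exact H.
- rewrite (RInt_ext _ (fun _ => 0)).
  + rewrite RInt_Rconst. Rgoal. ring.
  + intros u _. replace (0 ^ 2 * sqrt (1 + u ^ 4)) with 0 by ring. rewrite exppow_int_0. Rgoal. unfold Rdiv; ring.
Qed.

Lemma exppow_int_incr p x y : x <= y -> exppow_int p x <= exppow_int p y.
Proof.
intros [L| ->]; [|lra].
destruct (MVT_gen (exppow_int p) x y (fun x => exp (- x ^ p))) as [c [_ E]].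
- intros; apply exppow_int_derive.
- intros c _. apply derivable_continuous_pt. eexists. apply is_derive_Reals, exppow_int_derive.
- generalize (exp_pos (- c ^ p)). nra.
Qed.

Lemma lemint_pos : 0 < lemint.
Proof.
unfold lemint. apply RInt_gt_0; [lra| |].
- intros x _. apply Rinv_0_lt_compat, sqrt_lt_R0. generalize (one_u4 x); lra.
- intros x _. apply inv_sqrt_1u4_continuous.
Qed.

(** Squeezing replaces an interchange of limit and integral: since sqrt(1 + u^4) >= 1, the inner
    Gaussian integral lies between its value at X^2 and its limit. *)
Lemma is_lim_Egauss4_sqr : is_lim (fun X => exppow_int 4 X ^ 2) p_infty (sqrt PI / 2 * lemint).
Proof.
assert (S : forall u, 1 <= sqrt (1 + u ^ 4)).
{ intros u. rewrite <- sqrt_1 at 1. apply sqrt_le_1_alt, one_u4. }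
assert (Up : forall X, exppow_int 2 X <= sqrt PI / 2).
{ intros X. apply (is_lim_le_loc (fun _ => exppow_int 2 X) (exppow_int 2) p_infty (exppow_int 2 X) (sqrt PI / 2)).
  - exists X. intros Y HY. apply exppow_int_incr; lra.
  - apply is_lim_const.
  - apply is_lim_Egauss2. }
assert (B : forall X, 0 <= X -> exppow_int 2 (X ^ 2) * lemint <= exppow_int 4 X ^ 2 <= sqrt PI / 2 * lemint).
{ intros X HX. rewrite Egauss4_sqr by auto. unfold lemint.
  assert (Cj : ex_RInt (fun u => exppow_int 2 (X ^ 2 * sqrt (1 + u ^ 4)) / sqrt (1 + u ^ 4)) 0 1).
  { apply ex_RInt_Rcontinuous. intros u. apply ex_derive_Rcontinuous.
    generalize (exppow_int_derive 2 (X ^ 2 * sqrt (1 + u ^ 4))) (S u) (one_u4 u); intros H ? ?.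
    auto_derive. simpl in *. repeat split; try lra. eexists; exact H. }
  assert (Ck : forall c, ex_RInt (fun u => scal c (/ sqrt (1 + u ^ 4))) 0 1).
  { intros c. apply ex_RInt_Rcontinuous. intros u. apply (continuous_scal_r (V := R_NormedModule)), inv_sqrt_1u4_continuous. }
  assert (Ci : ex_RInt (fun u => / sqrt (1 + u ^ 4)) 0 1) by (apply ex_RInt_Rcontinuous, inv_sqrt_1u4_continuous).
  rewrite <- !(RInt_scal (V := R_CompleteNormedModule)  (fun u => / sqrt (1 + u ^ 4))) by exact Ci.
  split; (apply RInt_le; [lra|auto|auto|]); intros u _;
    change (scal ?c (/ sqrt (1 + u ^ 4))) with (c * / sqrt (1 + u ^ 4));
    apply Rmult_le_compat_r; try (apply Rlt_le, Rinv_0_lt_compat; generalize (S u); lra); auto.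
  apply exppow_int_incr. generalize (S u) (pow2_ge_0 X). nra. }
apply (is_lim_le_le_loc (fun X => exppow_int 2 (X ^ 2) * lemint) (fun _ => sqrt PI / 2 * lemint)).
- exists 0. intros X HX; apply B; lra.
- apply (is_lim_scal_r _ lemint p_infty (sqrt PI / 2)).
  apply (is_lim_comp (exppow_int 2) (fun x => x ^ 2) p_infty (sqrt PI / 2) p_infty); [apply is_lim_Egauss2| |].
  + apply (is_lim_le_p_loc (fun x => x)); [|apply is_lim_id].
    exists 1. intros x Hx. simpl. nra.
  + exists 0; intros; discriminate.
- apply is_lim_const.
Qed.

Lemma is_lim_Egauss4 : is_lim (exppow_int 4) p_infty (sqrt (sqrt PI / 2 * lemint)).
Proof.
apply (is_lim_ext_loc (fun X => sqrt (exppow_int 4 X ^ 2))).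
{ exists 0. intros X HX. apply sqrt_pow2. rewrite <- (exppow_int_0 4). apply exppow_int_incr; lra. }
apply (is_lim_comp_continuous (fun X => exppow_int 4 X ^ 2) sqrt); [apply is_lim_Egauss4_sqr|apply continuous_sqrt].
Qed.

Lemma Rpower_quarter_pow t : 0 < t -> Rpower t (1 / 4) ^ 4 = t.
Proof.
intros Ht. simpl. rewrite Rmult_1_r, <- !Rpower_plus.
replace (1 / 4 + (1 / 4 + (1 / 4 + 1 / 4))) with 1 by field. apply Rpower_1; auto.
Qed.

(** The substitution t = z^4 makes [4 * exppow_int 4 (Rpower t (1 / 4))] an antiderivative on t > 0,
    and the improper integral is the difference of its limits at [0] and at infinity. *)
Lemma Gamma_quarter :
  RInt_gen (fun t => Rpower t (1 / 4 - 1) * exp (- t)) (at_right 0) (Rbar_locally p_infty)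
  = 4 * sqrt (sqrt PI / 2 * lemint).
Proof.
set (L := sqrt (sqrt PI / 2 * lemint)).
set (f := fun t => 4 * exppow_int 4 (Rpower t (1 / 4))).
assert (D : forall t, 0 < t -> is_derive f t (Rpower t (1 / 4 - 1) * exp (- t))).
{ intros t Ht. unfold f. generalize (exppow_int_derive 4 (Rpower t (1 / 4))). intros H.
  rewrite Rpower_quarter_pow in H by auto. unfold Rpower at 1.
  unfold Rpower in H. auto_derive; [repeat split; auto; eexists; exact H|].
  subst_Derive H. unfold Rpower.
  replace ((1 / 4 - 1) * ln t) with (1 * / 4 * ln t + - ln t) by field.
  rewrite (exp_plus (1 * / 4 * ln t)), (exp_Ropp (ln t)), exp_ln by auto.
  unfold Rdiv. rewrite !Rmult_1_l. field. lra. }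
assert (Pr : filter_prod (at_right 0) (Rbar_locally p_infty)
   (fun ab : R * R => forall x, Rmin (fst ab) (snd ab) <= x <= Rmax (fst ab) (snd ab) -> 0 < x)).
{ apply (Filter_prod _ _ _ (fun x => 0 < x) (fun x => 0 < x)).
  - exists (mkposreal 1 Rlt_0_1). auto.
  - exists 0; auto.
  - simpl. intros x y Hx Hy z. unfold Rmin; destruct Rle_dec; lra. }
apply (is_RInt_gen_unique (V := R_CompleteNormedModule)).
replace (4 * L) with (4 * L - 0) by ring.
apply (is_RInt_gen_ext (Derive f)).
{ eapply filter_imp; [|exact Pr]. intros ab H x Hx. apply is_derive_unique, D, H. lra. }
apply is_RInt_gen_Derive.
- eapply filter_imp; [|exact Pr]. intros ab H x Hx. eexists; apply D, H; auto.
- eapply filter_imp; [|exact Pr]. intros ab H x Hx. specialize (H x Hx).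
  apply (continuous_ext_loc (U := R_UniformSpace) (Derive f) (fun t => Rpower t (1 / 4 - 1) * exp (- t)) x).
  + apply (locally_interval _ x 0 p_infty); simpl; auto. intros t Ht _. symmetry. apply is_derive_unique, D, Ht.
  + apply ex_derive_Rcontinuous. unfold Rpower. auto_derive. lra.
- apply (filterlim_comp _ _ _ (fun t => Rpower t (1 / 4)) (fun z => 4 * exppow_int 4 z) (at_right 0) (locally 0)).
  + unfold Rpower.
    apply (filterlim_comp _ _ _ (fun t => 1 / 4 * ln t) exp (at_right 0) (Rbar_locally m_infty));
      [|apply is_lim_exp_m].
    apply (filterlim_comp _ _ _ ln (fun z => 1 / 4 * z) (at_right 0) (Rbar_locally m_infty)); [apply is_lim_ln_0|].
    generalize (filterlim_Rbar_mult_l (1 / 4) m_infty). simpl. destruct (Rle_dec 0 (1 / 4)); [|exfalso; lra].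
    destruct (Rle_lt_or_eq_dec 0 (1 / 4) r); auto. exfalso; lra.
  + replace 0 with (4 * exppow_int 4 0) at 2 by (rewrite exppow_int_0; ring).
    apply (ex_derive_Rcontinuous (fun z => 4 * exppow_int 4 z)).
    generalize (exppow_int_derive 4 0); intros H. auto_derive. eexists; exact H.
- apply (filterlim_comp _ _ _ (fun t => Rpower t (1 / 4)) (fun z => 4 * exppow_int 4 z) (Rbar_locally p_infty) (Rbar_locally p_infty)).
  + unfold Rpower.
    apply (filterlim_comp _ _ _ (fun t => 1 / 4 * ln t) exp (Rbar_locally p_infty) (Rbar_locally p_infty));
      [|apply is_lim_exp_p].
    apply (filterlim_comp _ _ _ ln (fun z => 1 / 4 * z) (Rbar_locally p_infty) (Rbar_locally p_infty)); [apply is_lim_ln_p|].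
    generalize (filterlim_Rbar_mult_l (1 / 4) p_infty). simpl. destruct (Rle_dec 0 (1 / 4)); [|exfalso; lra].
    destruct (Rle_lt_or_eq_dec 0 (1 / 4) r); auto. exfalso; lra.
  + apply (is_lim_scal_l (exppow_int 4) 4 p_infty L), is_lim_Egauss4.
Qed.

(* The substitution [u = cos t / (1 + sin t)]. *)
Lemma lemint_ellJ : ellJ 1 1 (PI / 2) = sqrt 2 * lemint.
Proof.
assert (P := PI_RGT_0).
set (F := fun x => RInt (fun u => / sqrt (1 + u ^ 4)) 0 x).
assert (DF : forall x, is_derive F x (/ sqrt (1 + x ^ 4))).
{ intros x. apply (RInt_cont_derive (fun u => / sqrt (1 + u ^ 4))), inv_sqrt_1u4_continuous. }
assert (S2 : 0 < sqrt 2) by (apply sqrt_lt_R0; lra).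
assert (Q : sqrt 2 * sqrt 2 = 2) by (apply sqrt_sqrt; lra).
set (Gf := fun t => - sqrt 2 * F (cos t / (1 + sin t))).
assert (DG : forall t, 0 <= t <= PI / 2 -> is_derive Gf t (/ ellw 1 1 t)).
{ intros t Ht. assert (St : 0 <= sin t) by (apply sin_ge_0; lra).
  generalize (DF (cos t / (1 + sin t))). intros H. unfold Gf, Rdiv in *.
  auto_derive; [repeat split; first [lra | eexists; exact H]|].
  subst_Derive H. unfold ellw.
  assert (E : sqrt (1 + (cos t * / (1 + sin t)) ^ 4) = sqrt 2 * sqrt (1 + 1 * sin t ^ 2) / (1 + sin t)).
  { assert (C2 : cos t ^ 2 = 1 - sin t ^ 2) by (generalize (sin2_cos2 t); unfold Rsqr; simpl; lra).
    assert (N : 0 <= sqrt 2 * sqrt (1 + 1 * sin t ^ 2) / (1 + sin t)).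
    { apply Rdiv_le_0_compat; [|lra]. apply Rmult_le_pos; [lra|apply sqrt_pos]. }
    rewrite <- (sqrt_pow2 (sqrt 2 * sqrt (1 + 1 * sin t ^ 2) / (1 + sin t))) by auto. f_equal.
    unfold Rdiv. rewrite !Rpow_mult_distr. rewrite !pow2_sqrt; [|generalize (sin2_range t); lra|lra].
    replace (cos t ^ 4) with ((cos t ^ 2) ^ 2) by ring. rewrite C2. field. lra. }
  rewrite E. assert (W : 0 < sqrt (1 + 1 * sin t ^ 2)) by (apply sqrt_lt_R0; generalize (sin2_range t); lra).
  assert (C2 : cos t * cos t = 1 - sin t * sin t) by (generalize (sin2_cos2 t); unfold Rsqr; lra).
  field_simplify_eq; [|repeat split; lra]. 
  replace (cos t ^ 2) with (1 - sin t * sin t) by (rewrite <- C2; ring). ring. }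
unfold ellJ. apply is_RInt_unique.
replace (sqrt 2 * lemint) with (minus (Gf (PI / 2)) (Gf 0)).
- apply (is_RInt_derive (V := R_CompleteNormedModule) Gf).
  + intros x Hx. rewrite Rmin_left, Rmax_right in Hx by lra. apply DG; lra.
  + intros x _. apply inv_ellw_continuous; lra.
- unfold Gf. rewrite cos_PI2, cos_0, sin_0, sin_PI2. unfold minus, plus, opp; simpl.
  replace (0 / (1 + 1)) with 0 by field. replace (1 / (1 + 0)) with 1 by field.
  assert (F0 : F 0 = 0) by apply (RInt_point (V := R_CompleteNormedModule)).
  assert (F1 : F 1 = lemint) by reflexivity. rewrite F0, F1. Rgoal. ring.
Qed.

Lemma ellJ_diag c x : 0 < c -> sqrt c * ellJ c c x = ellJ 1 1 x.
Proof.
intros Hc. assert (S : 0 < sqrt c) by (apply sqrt_lt_R0; auto). unfold ellJ.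
rewrite <- (RInt_scal (V := R_CompleteNormedModule) (fun t => / ellw c c t)).
- apply RInt_ext. intros t _. change (sqrt c * / ellw c c t = / ellw 1 1 t). unfold ellw.
  replace (c + c * sin t ^ 2) with (c * (1 + 1 * sin t ^ 2)) by ring.
  generalize (sin2_range t). intros. rewrite sqrt_mult by lra.
  assert (0 < sqrt (1 + 1 * sin t ^ 2)) by (apply sqrt_lt_R0; lra). field. lra.
- apply ex_RInt_Rcontinuous. intros; apply inv_ellw_continuous; auto.
Qed.

(** With a = b = Z / 2 the quarter period is sqrt 2 * lemint / sqrt(Z / 2); equating it with PI
    gives Z = 4 lemint^2 / PI^2. The shape of the right side is the one that [Gamma_quarter]
    produces. *)
Lemma ellZ_PI : ellZ PI = (4 * sqrt (sqrt PI / 2 * lemint)) ^ 4 / (16 * PI ^ 3).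
Proof.
assert (P := PI_RGT_0). assert (Hy : 3 <= PI) by (generalize PI_ge3; lra).
destruct ellX_PI as [_ E]. assert (HZ := ellZ_pos PI Hy). assert (K := lemint_pos).
assert (SP : 0 < sqrt PI) by (apply sqrt_lt_R0; auto).
assert (SP2 : sqrt PI * sqrt PI = PI) by (apply sqrt_sqrt; lra).
assert (Hc : 0 < ellZ PI / 2) by lra.
generalize (ellJ_diag (ellZ PI / 2) (PI / 2) Hc). rewrite <- E, lemint_ellJ. intros H.
assert (H2 : ellZ PI / 2 * PI ^ 2 = 2 * lemint ^ 2).
{ transitivity ((sqrt (ellZ PI / 2) * PI) ^ 2).
  - rewrite Rpow_mult_distr, pow2_sqrt; lra.
  - rewrite H, Rpow_mult_distr, pow2_sqrt; lra. }
replace ((4 * sqrt (sqrt PI / 2 * lemint)) ^ 4) with (256 * (sqrt (sqrt PI / 2 * lemint) ^ 2) ^ 2) by ring.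
rewrite pow2_sqrt by (apply Rmult_le_pos; lra).
replace ((sqrt PI / 2 * lemint) ^ 2) with (PI / 4 * lemint ^ 2) by (rewrite <- SP2 at 1; field).
apply Rmult_eq_reg_r with (PI ^ 2 / 2); [|apply Rgt_not_eq; apply Rdiv_lt_0_compat; [apply pow_lt; auto|lra]].
transitivity (2 * lemint ^ 2); [rewrite <- H2; field|]. field. lra.
Qed.

(** * Differentiating the Lambert series in y *)

(* The [k]-th derivative of [1 / sinh], only meaningful for [k <= 4]. *)
Definition csch_deriv (k : nat) (t : R) : R :=
  match k with
  | 0 => / sinh t
  | 1 => - cosh t / sinh t ^ 2
  | 2 => / sinh t + 2 / sinh t ^ 3
  | 3 => - cosh t / sinh t ^ 2 - 6 * cosh t / sinh t ^ 4
  | _ => / sinh t + 20 / sinh t ^ 3 + 24 / sinh t ^ 5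
  end.

Lemma cosh_sqr t : cosh t ^ 2 = 1 + sinh t ^ 2.
Proof.
assert (E : exp t * exp (- t) = 1) by (rewrite <- exp_plus, Rplus_opp_r, exp_0; auto).
unfold cosh, sinh. field_simplify. 
replace (exp t ^ 2 + 2 * exp t * exp (- t) + exp (- t) ^ 2) with (exp t ^ 2 + exp (- t) ^ 2 + 2 * (exp t * exp (- t))) by ring.
rewrite E. field_simplify.
replace (exp t ^ 2 - 2 * exp t * exp (- t) + exp (- t) ^ 2 + 4) with (exp t ^ 2 + exp (- t) ^ 2 - 2 * (exp t * exp (- t)) + 4) by ring.
rewrite E. field.
Qed.

Lemma csch_deriv_derive k t : (k <= 3)%nat -> 1 <= t -> is_derive (csch_deriv k) t (csch_deriv (S k) t).
Proof.
intros Hk Ht.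
assert (S : 0 < sinh t) by (generalize (sinh_lower t Ht) (exp_pos t); lra).
assert (C := cosh_sqr t).
assert (DS : is_derive sinh t (cosh t)) by apply (tsin_derive true).
assert (DC : is_derive cosh t (sinh t)) by (apply (is_derive_eq _ _ _ _ (tcos_derive true t)); simpl; ring).
assert (S2 : sinh t * (sinh t * 1) <> 0) by nra.
assert (S3 : sinh t * (sinh t * (sinh t * 1)) <> 0) by (apply Rmult_integral_contrapositive_currified; [lra|exact S2]).
assert (S4 : sinh t * (sinh t * (sinh t * (sinh t * 1))) <> 0) by (apply Rmult_integral_contrapositive_currified; [lra|exact S3]).
destruct k as [|[|[|[|k]]]]; [| | | |lia]; cbn [csch_deriv].
- change (is_derive (fun t => / sinh t) t (- cosh t / sinh t ^ 2)).
  auto_derive; [repeat split; auto; lra|]. field; repeat split; lra.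
- change (is_derive (fun t => - cosh t / sinh t ^ 2) t (/ sinh t + 2 / sinh t ^ 3)).
  auto_derive; [repeat split; auto; lra|].
  field_simplify_eq; [|lra]. replace (cosh t ^ 2) with (1 + sinh t ^ 2) by auto. ring.
- change (is_derive (fun t => / sinh t + 2 / sinh t ^ 3) t (- cosh t / sinh t ^ 2 - 6 * cosh t / sinh t ^ 4)).
  auto_derive; [repeat split; auto; lra|]. field; repeat split; lra.
- change (is_derive (fun t => - cosh t / sinh t ^ 2 - 6 * cosh t / sinh t ^ 4) t (/ sinh t + 20 / sinh t ^ 3 + 24 / sinh t ^ 5)).
  auto_derive; [repeat split; auto; lra|].
  field_simplify_eq; [|lra]. replace (cosh t ^ 2) with (1 + sinh t ^ 2) by auto. ring.
Qed.
(** Everything follows from 1 / sinh t <= 4 e^(-t); the worst case is the last branch, with 4 + 20 *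
    64 + 24 * 1024 < 30000. *)
Lemma csch_deriv_bound k t : 1 <= t -> Rabs (csch_deriv k t) <= 30000 * exp (- t).
Proof.
intros Ht. destruct (inv_sinh_bound t Ht) as [X0 X1].
assert (S : 0 < sinh t) by (generalize (sinh_lower t Ht) (exp_pos t); lra).
assert (E : exp t * exp (- t) = 1) by (rewrite <- exp_plus, Rplus_opp_r, exp_0; auto).
assert (E0 := exp_pos (- t)). assert (E1 := exp_ineq1_le t).
assert (E2 : exp (- t) <= 1) by nra.
assert (C0 : 0 < cosh t) by (unfold cosh; generalize (exp_pos t); lra).
assert (C1 : cosh t <= exp t) by (unfold cosh; nra).
set (x := / sinh t) in *. set (e := exp (- t)) in *. set (c := cosh t) in *.
assert (Cx : 0 <= c * x <= 4).
{ split; [apply Rmult_le_pos; lra|]. apply Rle_trans with (exp t * (4 * e)); [|nra].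
  apply Rmult_le_compat; lra. }
assert (X3 : 0 <= x ^ 2 <= 16).
{ split; [apply pow2_ge_0|]. replace 16 with (4 ^ 2) by ring. apply pow_incr; lra. }
assert (X4 : 0 <= x ^ 4 <= 256).
{ replace (x ^ 4) with (x ^ 2 * x ^ 2) by ring. split; nra. }
assert (B0 : 0 <= x <= 4 * e) by lra.
assert (B1 : 0 <= c * x ^ 2 <= 16 * e) by (replace (c * x ^ 2) with (c * x * x) by ring; nra).
assert (B2 : 0 <= x ^ 3 <= 64 * e) by (replace (x ^ 3) with (x ^ 2 * x) by ring; nra).
assert (B3 : 0 <= c * x ^ 4 <= 256 * e) by (replace (c * x ^ 4) with (x ^ 2 * (c * x ^ 2)) by ring; nra).
assert (B4 : 0 <= x ^ 5 <= 1024 * e) by (replace (x ^ 5) with (x ^ 4 * x) by ring; nra).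
assert (I : forall n, / sinh t ^ n = x ^ n) by (intros n; unfold x; now rewrite pow_inv).
destruct k as [|[|[|[|k]]]]; cbn [csch_deriv]; unfold Rdiv; rewrite ?I; apply Rabs_le; fold x c; lra.
Qed.

Lemma pow_exp_bound j : exists A, 0 <= A /\ forall i, INR (S i) ^ j <= A * exp (INR (S i)).
Proof.
destruct (expdecay_pow j 1 Rlt_0_1) as [A [HA H]]. exists A; split; auto. intros i.
generalize (H (Z.of_nat (S i))). rewrite Z.abs_eq by lia. rewrite <- INR_IZR_INZ.
rewrite Rabs_pos_eq by (apply pow_le, pos_INR).
replace (- (- (1) * INR (S i))) with (INR (S i)) by ring. auto.
Qed.

Definition csch_series (k s : nat) (y : R) : R :=
  Series (fun i => (-1) ^ S i * INR (S i) ^ s * csch_deriv k (INR (S i) * y)).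

(** Uniform in [y >= 2], because termwise differentiation at [y >= 3] uses a window of radius
    [1]. *)
Lemma csch_series_term_bound k s : exists A, 0 <= A /\ forall i y, 2 <= y ->
  Rabs ((-1) ^ S i * INR (S i) ^ s * csch_deriv k (INR (S i) * y)) <= A * exp (- (1 * INR i)).
Proof.
destruct (pow_exp_bound s) as [A [HA H]]. exists (30000 * A); split; [lra|]. intros i y Hy.
assert (Hi : 1 <= INR (S i)) by (rewrite S_INR; generalize (pos_INR i); lra).
rewrite !Rabs_mult. assert (M : Rabs ((-1) ^ S i) = 1) by apply pow_1_abs. rewrite M, Rmult_1_l.
rewrite Rabs_pos_eq by (apply pow_le; lra).
apply Rle_trans with (A * exp (INR (S i)) * (30000 * exp (- (INR (S i) * y)))).
- apply Rmult_le_compat; auto; [apply pow_le; lra|apply Rabs_pos|]. apply csch_deriv_bound. nra.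
- replace (A * exp (INR (S i)) * (30000 * exp (- (INR (S i) * y)))) with
    (30000 * A * exp (INR (S i) + - (INR (S i) * y))) by (rewrite exp_plus; ring).
  apply Rmult_le_compat_l; [lra|]. apply exp_le. rewrite S_INR in *. nra.
Qed.

Lemma csch_series_ex k s y : 2 <= y -> ex_series (fun i => (-1) ^ S i * INR (S i) ^ s * csch_deriv k (INR (S i) * y)).
Proof.
intros Hy. destruct (csch_series_term_bound k s) as [A [HA H]].
apply ex_series_le_abs with (fun i => A * exp (- (1 * INR i))); [intros; auto|].
apply ex_series_Rscal, ex_series_exp; lra.
Qed.

Lemma csch_series_derive k s y : (k <= 3)%nat -> 3 <= y -> is_derive (csch_series k s) y (csch_series (S k) (S s) y).
Proof.
intros Hk Hy. destruct (csch_series_term_bound (S k) (S s)) as [A [HA H]]. unfold csch_series.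
assert (In : forall z, Rabs (z - y) < mkposreal 1 Rlt_0_1 -> 2 <= z).
{ simpl. intros z. unfold Rabs; destruct Rcase_abs; lra. }
apply (Series_is_derive (fun i y => (-1) ^ S i * INR (S i) ^ s * csch_deriv k (INR (S i) * y))
  (fun i y => (-1) ^ S i * INR (S i) ^ (S s) * csch_deriv (S k) (INR (S i) * y))
  (fun i => A * exp (- (1 * INR i))) y (mkposreal 1 Rlt_0_1)).
- intros i z Hz. apply In in Hz.
  assert (Hi : 1 <= INR (S i)) by (rewrite S_INR; generalize (pos_INR i); lra).
  replace ((-1) ^ S i * INR (S i) ^ S s * csch_deriv (S k) (INR (S i) * z)) with
    ((-1) ^ S i * INR (S i) ^ s * (INR (S i) * csch_deriv (S k) (INR (S i) * z))) by (simpl; ring).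
  apply (is_derive_scal (fun y => csch_deriv k (INR (S i) * y))).
  apply (is_derive_comp (csch_deriv k) (fun y => INR (S i) * y)); [apply csch_deriv_derive; auto; nra|].
  generalize (INR (S i)). intros c. auto_derive; [auto|Rgoal; ring].
- intros i z Hz. apply H, In, Hz.
- apply ex_series_Rscal, ex_series_exp; lra.
- apply csch_series_ex; lra.
Qed.

Lemma lambert_csch_series y s : 3 <= y -> Nat.odd s = true -> lambert y s = csch_series 0 s y.
Proof.
intros Hy Hs. unfold lambert, csch_series. rewrite Zsum_even.
- rewrite pow_i by (destruct s; [discriminate|lia]). rewrite Rmult_0_l, Rplus_0_l, <- Rmult_assoc, Rinv_l, Rmult_1_l by lra.
  apply Series_ext; intros i. rewrite <- INR_IZR_INZ. unfold alt_csch. rewrite <- INR_IZR_INZ.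
  cbn [csch_deriv]. rewrite <- Rmult_assoc. f_equal. rewrite Rmult_comm. f_equal.
  unfold altZ. clear. induction (S i) as [|n IH]; [reflexivity|].
  rewrite Nat2Z.inj_succ, Z.even_succ, <- Z.negb_even. simpl pow. rewrite <- IH.
  destruct (Z.even (Z.of_nat n)); simpl; ring.
- apply Zsummable_expdecay with (y - 1); [lra|]. apply expdecay_pow_alt_csch; auto.
- intros n. rewrite opp_IZR, pow_opp_odd, alt_csch_opp by auto. ring.
Qed.

Definition tower (T : nat -> R -> R) : Prop := forall k x, is_derive (T k) x (T (S k) x).

(* The [k]-th derivative of [x (1 - x) T 0 x] by Leibniz; the truncated indices
   [k - 1] and [k - 2] only matter when their coefficients are nonzero. *)
Definition ptower (k : nat) (T : nat -> R -> R) (x : R) : R :=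
  x * (1 - x) * T k x + INR k * (1 - 2 * x) * T (k - 1)%nat x
  - INR k * INR (k - 1) * T (k - 2)%nat x.

Lemma ptower_derive k T x : tower T -> is_derive (ptower k T) x (ptower (S k) T x).
Proof.
intros HT. generalize (HT k x) (HT (k - 1)%nat x) (HT (k - 2)%nat x). intros H0 H1 H2.
unfold ptower. auto_derive; [repeat split; eexists; eassumption|].
subst_Derive H0; subst_Derive H1; subst_Derive H2. Rgoal.
destruct k as [|[|k]].
- simpl. ring.
- simpl. ring.
- replace (S (S (S k)) - 1)%nat with (S (S k)) by lia. replace (S (S (S k)) - 2)%nat with (S k) by lia.
  replace (S (S k) - 1)%nat with (S k) by lia. replace (S (S k) - 2)%nat with k by lia.
  rewrite !S_INR. ring.
Qed.

(* Differential polynomials in [mu2], [ellZ], [ellX], [ellZ ^ a] and the composites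
   [ptower i T (ellX y)]; [dd a] is the derivation induced by the differential system. *)
Inductive dpoly : Type :=
  | dC (r : R) | dA | dZ | dX | dP | dF (i : nat) | dAdd (p q : dpoly) | dMul (p q : dpoly).

Fixpoint dev (j : nat) (T : nat -> R -> R) (p : dpoly) (y : R) : R :=
  match p with
  | dC r => r
  | dA => mu2 y
  | dZ => ellZ y
  | dX => ellX y
  | dP => ellZ y ^ S j
  | dF i => ptower i T (ellX y)
  | dAdd p q => dev j T p y + dev j T q y
  | dMul p q => dev j T p y * dev j T q y
  end.

Definition dX' : dpoly := dMul (dC (-4)) (dMul dX (dMul (dAdd (dC 1) (dMul (dC (-1)) dX)) dZ)).

Fixpoint dd (a : R) (p : dpoly) : dpoly :=
  match p with
  | dC r => dC 0
  | dA => dAdd (dMul (dC (/ 2)) (dMul dX' dZ)) (dMul (dC (-2)) (dMul dA dA))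
  | dZ => dMul (dC (-4)) (dMul dA dZ)
  | dX => dX'
  | dP => dMul (dC (-4 * a)) (dMul dA dP)
  | dF i => dMul dX' (dF (S i))
  | dAdd p q => dAdd (dd a p) (dd a q)
  | dMul p q => dAdd (dMul (dd a p) q) (dMul p (dd a q))
  end.

Lemma dd_derive j T p y : tower T -> 3 <= y ->
  is_derive (dev j T p) y (dev j T (dd (INR (S j)) p) y).
Proof.
intros HT Hy. induction p as [r| | | | |i|p IHp q IHq|p IHp q IHq].
- apply is_derive_Rconst.
- apply (is_derive_eq _ _ _ _ (mu2_derive_XZ y Hy)). cbn [dev dd dX']. unfold dX'. cbn [dev]. field.
- apply (is_derive_eq _ _ _ _ (ellZ_derive y Hy)). cbn [dev dd]. ring.
- apply (is_derive_eq _ _ _ _ (ellX_derive y Hy)). cbn [dev dd]. unfold dX'. cbn [dev]. ring.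
- apply (is_derive_eq _ _ _ _ (is_derive_pow ellZ (S j) y _ (ellZ_derive y Hy))).
  cbn [dev dd Nat.pred]. rewrite <- tech_pow_Rmult. Rgoal. ring.
- apply (is_derive_eq _ _ _ _ (is_derive_comp (ptower i T) ellX y _ _ (ptower_derive i T (ellX y) HT) (ellX_derive y Hy))).
  cbn [dev dd]. unfold dX'. cbn [dev]. unfold scal; simpl; unfold mult; simpl. Rgoal. ring.
- apply is_derive_Rplus; auto.
- apply (is_derive_mult (dev j T p) (dev j T q)); auto. intros; apply Rmult_comm.
Qed.

Definition lambert_diff (k j : nat) (T : nat -> R -> R) : R -> R :=
  dev j T (Nat.iter k (dd (INR (S j))) (dMul dP (dF 0))).

Lemma lambert_diff_derive k j T y : tower T -> 3 <= y -> is_derive (lambert_diff k j T) y (lambert_diff (S k) j T y).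
Proof. intros HT Hy. apply dd_derive; auto. Qed.

(** Differentiates [lambert_rho] [k] times in [y]: termwise on the left, where each derivative of 1
    / sinh(n y) brings out a factor [n], and symbolically on the right. *)
Lemma csch_series_lambert_diff rho j T : rho_rec rho -> tower T -> (1 <= j)%nat ->
  (forall x, 0 < x < 1 -> rho j x = T 0%nat x) ->
  forall k, (k <= 4)%nat -> forall y, 3 < y ->
  csch_series k (2 * j + 1 + k) y = - INR (fact (2 * j)) * lambert_diff k j T y.
Proof.
intros Hr HT Hj E k. induction k as [|k IH]; intros Hk y Hy.
- rewrite Nat.add_0_r, <- lambert_csch_series; [|lra|].
  2:{ apply Nat.odd_spec. exists j; lia. }
  rewrite (lambert_rho rho) by (auto; lra). rewrite E by (apply ellX_range; lra). unfold lambert_diff. cbn [Nat.iter nat_rect dev]. unfold ptower. simpl INR. ring.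
- assert (D1 : is_derive (csch_series k (2 * j + 1 + k)) y (csch_series (S k) (2 * j + 1 + S k) y)).
  { replace (2 * j + 1 + S k)%nat with (S (2 * j + 1 + k)) by lia. apply csch_series_derive; [lia|lra]. }
  assert (D2 : is_derive (csch_series k (2 * j + 1 + k)) y (- INR (fact (2 * j)) * lambert_diff (S k) j T y)).
  (* The strict inequality [3 < y] leaves a whole neighbourhood on which the induction hypothesis
     holds. *)
  { apply (is_derive_ext_loc (fun y => - INR (fact (2 * j)) * lambert_diff k j T y)).
    - apply (locally_interval _ y 3 p_infty); simpl; auto. intros z Hz _. symmetry. apply IH; auto; lia.
    - apply (is_derive_scal (lambert_diff k j T)), lambert_diff_derive; auto; lra. }
  exact (is_derive_inj _ _ _ _ D1 D2).
Qed.

Ltac diff_tac X2 :=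
  cbn [Nat.iter nat_rect dd dX' dev]; rewrite X2;
  unfold ptower; cbn [Nat.sub].

(** For odd [j] the function [rho j] is symmetric about 1/2. Here [f0], [f2], [f4] are the
    derivatives of x (1 - x) T 0 x at 1/2; those of order 1 and 3 vanish by the two hypotheses. *)
Lemma lambert_diff_odd j T : T 1%nat (1 / 2) = 0 -> T 3%nat (1 / 2) = 0 ->
  let a := INR (S j) in let A := mu2 PI in let Z := ellZ PI in
  let f0 := T 0%nat (1 / 2) / 4 in
  let f2 := T 2%nat (1 / 2) / 4 - 2 * T 0%nat (1 / 2) in
  let f4 := T 4%nat (1 / 2) / 4 - 12 * T 2%nat (1 / 2) in
  lambert_diff 0 j T PI = Z ^ S j * f0 /\
  lambert_diff 2 j T PI = Z ^ S j * (8 * a * (2 * a + 1) * A ^ 2 * f0 + 2 * a * Z ^ 2 * f0 + Z ^ 2 * f2) /\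
  lambert_diff 3 j T PI = Z ^ S j * (- 32 * a * (2 * a + 1) * (a + 1) * A ^ 3 * f0
     - 24 * a * (a + 1) * A * Z ^ 2 * f0 - 12 * (a + 1) * A * Z ^ 2 * f2) /\
  lambert_diff 4 j T PI = Z ^ S j * (64 * a * (a + 1) * (2 * a + 1) * (2 * a + 3) * A ^ 4 * f0
     + 96 * a * (a + 1) * (2 * a + 3) * A ^ 2 * Z ^ 2 * f0 + 48 * (a + 1) * (2 * a + 3) * A ^ 2 * Z ^ 2 * f2
     + 4 * a * (3 * a - 1) * Z ^ 4 * f0 + 12 * (a - 2) * Z ^ 4 * f2 + Z ^ 4 * f4).
Proof.
intros T1 T3. destruct ellX_PI as [X2 _]. cbv zeta. unfold lambert_diff. generalize (INR (S j)). intros a.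
repeat split; diff_tac X2; rewrite ?T1, ?T3; simpl INR; field.
Qed.

Lemma lambert_diff_even j T : T 0%nat (1 / 2) = 0 -> T 2%nat (1 / 2) = 0 ->
  let a := INR (S j) in let A := mu2 PI in let Z := ellZ PI in
  let f1 := T 1%nat (1 / 2) / 4 in
  lambert_diff 0 j T PI = 0 /\
  lambert_diff 1 j T PI = - Z ^ S j * Z * f1 /\
  lambert_diff 2 j T PI = Z ^ S j * (4 * (2 * a + 1) * A * Z * f1).
Proof.
intros T0 T2. destruct ellX_PI as [X2 _]. cbv zeta. unfold lambert_diff. generalize (INR (S j)). intros a.
repeat split; diff_tac X2; rewrite ?T0, ?T2; simpl INR; field.
Qed.

(** * The four series *)

(** [rho_rec] speaks of the interval (0, 1), whereas [tower] asks for derivatives on the whole line;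
    so each [rho j] is replaced by a polynomial function that agrees with it on (0, 1). *)
Inductive polyfun : (R -> R) -> Prop :=
  | pf_const c : polyfun (fun _ => c)
  | pf_id : polyfun (fun x => x)
  | pf_add f g : polyfun f -> polyfun g -> polyfun (fun x => f x + g x)
  | pf_mul f g : polyfun f -> polyfun g -> polyfun (fun x => f x * g x).

Lemma polyfun_derive f : polyfun f -> exists f', polyfun f' /\ forall x, is_derive f x (f' x).
Proof.
intros H; induction H as [c| |f g Hf [f' [Pf Df]] Hg [g' [Pg Dg]]|f g Hf [f' [Pf Df]] Hg [g' [Pg Dg]]].
- exists (fun _ => 0); split; [constructor|]. intros x; apply is_derive_Rconst.
- exists (fun _ => 1); split; [constructor|]. intros x; apply (is_derive_id (K := R_AbsRing)).
- exists (fun x => f' x + g' x); split; [now constructor|]. intros x.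
  apply is_derive_Rplus; auto.
- exists (fun x => f' x * g x + f x * g' x); split; [now repeat constructor|]. intros x.
  apply (is_derive_mult f g); auto. intros; apply Rmult_comm.
Qed.

Lemma polyfun_Derive_n f : polyfun f -> forall k, exists h, polyfun h /\ forall x, Derive_n f k x = h x.
Proof.
intros H k; induction k as [|k [h [Ph Eh]]]; [exists f; auto|].
destruct (polyfun_derive h Ph) as [h' [Ph' Dh]]. exists h'; split; auto. intros x. simpl.
rewrite (Derive_ext _ h) by auto. apply is_derive_unique, Dh.
Qed.

Lemma polyfun_tower f : polyfun f -> tower (Derive_n f).
Proof.
intros H k x. destruct (polyfun_Derive_n f H k) as [h [Ph Eh]].
destruct (polyfun_derive h Ph) as [h' [_ Dh]]. simpl. apply Derive_correct.
exists (h' x). apply (is_derive_ext h); auto.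
Qed.

Lemma rho_polyfun rho : rho_rec rho -> forall j, exists f, polyfun f /\ forall x, 0 < x < 1 -> rho j x = f x.
Proof.
intros Hr j; induction j as [j IH] using lt_wf_ind.
destruct j as [|[|j]].
- exists (fun _ => 0); split; [constructor|]. intros x Hx. apply (Hr x Hx).
- exists (fun _ => 1); split; [constructor|]. intros x Hx. apply (Hr x Hx).
- assert (C : forall n, (n <= S j)%nat -> exists f, polyfun f /\
    forall x, 0 < x < 1 -> sum_f_R0 (fun i => rho i x * rho (S j - i)%nat x) n = f x).
  { induction n as [|n IHn]; intros Hn.
    - destruct (IH 0%nat) as [f [Pf Ef]]; [lia|]. destruct (IH (S j)) as [g [Pg Eg]]; [lia|].
      exists (fun x => f x * g x); split; [now constructor|]. intros x Hx. simpl. now rewrite Ef, Eg.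
    - destruct IHn as [s [Ps Es]]; [lia|].
      destruct (IH (S n)) as [f [Pf Ef]]; [lia|]. destruct (IH (S j - S n)%nat) as [g [Pg Eg]]; [lia|].
      exists (fun x => s x + f x * g x); split; [now repeat constructor|]. intros x Hx.
      rewrite tech5, Es, Ef, Eg; auto. }
  destruct (C (S j)) as [s [Ps Es]]; [lia|]. destruct (IH (S j)) as [f [Pf Ef]]; [lia|].
  set (c := / (INR (2 * S j + 2) * INR (2 * S j + 1))).
  exists (fun x => c * ((4 + -8 * x) * f x + -6 * x * (1 + -1 * x) * s x)); split; [repeat constructor; auto|].
  intros x Hx. destruct (Hr x Hx) as (_ & _ & H). specialize (H (S j) ltac:(lia)).
  rewrite Ef in H by auto. unfold conv in H. rewrite Es in H by auto.
  replace ((4 + -8 * x) * f x + -6 * x * (1 + -1 * x) * s x) with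
    (4 * (1 - 2 * x) * f x - 6 * x * (1 - x) * s x) by ring.
  rewrite <- H. unfold c. field. split; apply not_0_INR; lia.
Qed.

(** Under x -> 1 - x the recursion changes only through the sign of 1 - 2 x. At x = 1/2 this kills
    every second derivative, which is why so few values of the R_(2n) appear in the theorem. *)
Lemma rho_sym rho : rho_rec rho -> forall j x, 0 < x < 1 -> rho j (1 - x) = (-1) ^ S j * rho j x.
Proof.
intros Hr j x Hx. assert (Hx' : 0 < 1 - x < 1) by lra.
destruct (Hr x Hx) as (A0 & A1 & AS). destruct (Hr (1 - x) Hx') as (B0 & B1 & BS).
induction j as [j IH] using lt_wf_ind. destruct j as [|[|j]].
- rewrite A0, B0; ring.
- rewrite A1, B1; ring.
- assert (P : INR (2 * S j + 2) * INR (2 * S j + 1) <> 0).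
  { apply Rmult_integral_contrapositive; split; apply not_0_INR; lia. }
  apply Rmult_eq_reg_l with (INR (2 * S j + 2) * INR (2 * S j + 1)); auto.
  rewrite BS by lia.
  transitivity ((-1) ^ S (S (S j)) * (INR (2 * S j + 2) * INR (2 * S j + 1) * rho (S (S j)) x)); [|ring].
  rewrite AS by lia.
  rewrite (IH (S j)) by lia.
  assert (CE : conv (fun i => rho i (1 - x)) (S j) = (-1) ^ S (S (S j)) * conv (fun i => rho i x) (S j)).
  { unfold conv. rewrite scal_sum. apply sum_eq. intros i Hi.
    rewrite (IH i), (IH (S j - i)%nat) by lia.
    replace (S (S (S j))) with (S i + S (S j - i))%nat by lia. rewrite pow_add. ring. }
  rewrite CE. simpl pow. ring.
Qed.

Lemma tower_sym T s : tower T -> (forall x, 0 < x < 1 -> T 0%nat (1 - x) = s * T 0%nat x) ->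
  forall k x, 0 < x < 1 -> T k (1 - x) = s * (-1) ^ k * T k x.
Proof.
intros HT H0 k; induction k as [|k IH]; intros x Hx; [rewrite H0 by auto; simpl; ring|].
assert (D1 := is_derive_reflect _ _ 1 x (HT k (1 - x))).
assert (D2 : is_derive (fun t => T k (1 - t)) x (s * (-1) ^ k * T (S k) x)).
{ apply (is_derive_ext_loc (fun t => s * (-1) ^ k * T k t)).
  - apply (locally_interval _ x 0 1); simpl; try lra. intros z Hz0 Hz1. symmetry; apply IH; lra.
  - apply (is_derive_scal (T k)), HT. }
apply (is_derive_inj _ _ _ _ D1) in D2. simpl pow. lra.
Qed.

Lemma tower_half_zero T s k : tower T -> (forall x, 0 < x < 1 -> T 0%nat (1 - x) = s * T 0%nat x) ->
  s * (-1) ^ k = -1 -> T k (1 / 2) = 0.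
Proof.
intros HT H0 E. generalize (tower_sym T s HT H0 k (1 / 2) ltac:(lra)).
replace (1 - 1 / 2) with (1 / 2) by field. rewrite E. lra.
Qed.

Section Sums.
Variables (rho : nat -> R -> R) (Hr : rho_rec rho).
Variable (G : R).
Hypothesis (HG0 : G <> 0) (HG : ellZ PI = G ^ 4 / (16 * PI ^ 3)).
Variable (k : nat) (T1 T2 T3 : nat -> R -> R).
Hypothesis (HT1 : tower T1) (HT2 : tower T2) (HT3 : tower T3).
Hypothesis (E1 : forall x, 0 < x < 1 -> rho (2 * k + 1) x = T1 0%nat x).
Hypothesis (E2 : forall x, 0 < x < 1 -> rho (2 * k + 2) x = T2 0%nat x).
Hypothesis (E3 : forall x, 0 < x < 1 -> rho (2 * k + 3) x = T3 0%nat x).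

(** Here m = k + 2, and [T1], [T2], [T3] stand for the polynomials of subscript 4 m - 6, 4 m - 4 and
    4 m - 2. *)
Let M := INR k + 2.
Let t10 := T1 0%nat (1 / 2).
Let t12 := T1 2%nat (1 / 2).
Let t14 := T1 4%nat (1 / 2).
Let t21 := T2 1%nat (1 / 2).
Let t30 := T3 0%nat (1 / 2).

Lemma tower_rho_sym j T : (forall x, 0 < x < 1 -> rho j x = T 0%nat x) ->
  forall x, 0 < x < 1 -> T 0%nat (1 - x) = (-1) ^ S j * T 0%nat x.
Proof. intros E x Hx. rewrite <- !E by lra. apply rho_sym; auto. Qed.

Lemma m1_even i : (-1) ^ (2 * i) = 1.
Proof. rewrite pow_mult. replace ((-1) ^ 2) with 1 by ring. apply pow1. Qed.

Lemma odd_zero j i T : (forall x, 0 < x < 1 -> rho (2 * i + 1) x = T 0%nat x) -> tower T -> Nat.odd j = true -> T j (1 / 2) = 0.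
Proof.
intros E HT Hj. apply Nat.odd_spec in Hj. destruct Hj as [l ->].
apply (tower_half_zero T _ _ HT (tower_rho_sym _ T E)).
replace (S (2 * i + 1)) with (2 * (i + 1))%nat by lia. rewrite pow_add, !m1_even. ring.
Qed.
Lemma even_zero j i T : (forall x, 0 < x < 1 -> rho (2 * i + 2) x = T 0%nat x) -> tower T -> Nat.even j = true -> T j (1 / 2) = 0.
Proof.
intros E HT Hj. apply Nat.even_spec in Hj. destruct Hj as [l ->].
apply (tower_half_zero T _ _ HT (tower_rho_sym _ T E)).
replace (S (2 * i + 2)) with (2 * (i + 1) + 1)%nat by lia. rewrite pow_add, !m1_even. ring.
Qed.

(** The series [csch_series i s] is the derivative of order [i] of the Lambert series with 2 j + 1 =
    s - i, so only j = 2 k + 1, 2 k + 2, 2 k + 3 occur. The value [0] of [csch_series 0 (4 k + 5)]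
    reflects the antisymmetry of [rho (2 * k + 2)] about 1/2. *)
Lemma csch_series_vals :
  let a := 2 * INR k + 2 in let A := / (4 * PI) in let Z := ellZ PI in
  let W := Z ^ (2 * k + 2) in let c := INR (fact (4 * k + 2)) in
  let f0 := t10 / 4 in let f2 := t12 / 4 - 2 * t10 in let f4 := t14 / 4 - 12 * t12 in
  csch_series 2 (4 * k + 5) PI = - c * (W * (8 * a * (2 * a + 1) * A ^ 2 * f0 + 2 * a * Z ^ 2 * f0 + Z ^ 2 * f2)) /\
  csch_series 3 (4 * k + 6) PI = - c * (W * (- 32 * a * (2 * a + 1) * (a + 1) * A ^ 3 * f0
     - 24 * a * (a + 1) * A * Z ^ 2 * f0 - 12 * (a + 1) * A * Z ^ 2 * f2)) /\
  csch_series 4 (4 * k + 7) PI = - c * (W * (64 * a * (a + 1) * (2 * a + 1) * (2 * a + 3) * A ^ 4 * f0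
     + 96 * a * (a + 1) * (2 * a + 3) * A ^ 2 * Z ^ 2 * f0 + 48 * (a + 1) * (2 * a + 3) * A ^ 2 * Z ^ 2 * f2
     + 4 * a * (3 * a - 1) * Z ^ 4 * f0 + 12 * (a - 2) * Z ^ 4 * f2 + Z ^ 4 * f4)) /\
  csch_series 0 (4 * k + 5) PI = 0 /\
  csch_series 1 (4 * k + 6) PI = c * (4 * INR k + 3) * (4 * INR k + 4) * (W * Z * Z * (t21 / 4)) /\
  csch_series 2 (4 * k + 7) PI = - c * (4 * INR k + 3) * (4 * INR k + 4) * (W * Z * (4 * (2 * (a + 1) + 1) * A * Z * (t21 / 4))) /\
  csch_series 0 (4 * k + 7) PI = - c * (4 * INR k + 3) * (4 * INR k + 4) * (4 * INR k + 5) * (4 * INR k + 6) * (W * Z ^ 2 * (t30 / 4)).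
Proof.
assert (HP := PI_ge3).
assert (S1 := fun i Hi => csch_series_lambert_diff rho (2 * k + 1) T1 Hr HT1 ltac:(lia) E1 i Hi PI HP).
assert (S2 := fun i Hi => csch_series_lambert_diff rho (2 * k + 2) T2 Hr HT2 ltac:(lia) E2 i Hi PI HP).
assert (S3 := fun i Hi => csch_series_lambert_diff rho (2 * k + 3) T3 Hr HT3 ltac:(lia) E3 i Hi PI HP).
destruct (lambert_diff_odd (2 * k + 1) T1) as (O0 & O2 & O3 & O4);
  [apply (odd_zero _ k); auto|apply (odd_zero _ k); auto|].
destruct (lambert_diff_even (2 * k + 2) T2) as (V0 & V1 & V2);
  [apply (even_zero _ k); auto|apply (even_zero _ k); auto|].
assert (E3' : forall x, 0 < x < 1 -> rho (2 * (k + 1) + 1) x = T3 0%nat x).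
{ replace (2 * (k + 1) + 1)%nat with (2 * k + 3)%nat by lia. exact E3. }
destruct (lambert_diff_odd (2 * k + 3) T3) as (U0 & _);
  [apply (odd_zero _ (k + 1)); auto|apply (odd_zero _ (k + 1)); auto|].
rewrite mu2_PI in *.
replace (INR (S (2 * k + 1))) with (2 * INR k + 2) in * by (rewrite S_INR, plus_INR, mult_INR; simpl; ring).
replace (INR (S (2 * k + 2))) with (2 * INR k + 2 + 1) in * by (rewrite S_INR, plus_INR, mult_INR; simpl; ring).
replace (S (2 * k + 1)) with (2 * k + 2)%nat in * by lia.
(* All factorials are reduced to that of 4 k + 2, so that a single one remains in the final
   identities. *)
assert (F2 : INR (fact (2 * (2 * k + 2))) = INR (fact (4 * k + 2)) * (4 * INR k + 3) * (4 * INR k + 4)).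
{ replace (2 * (2 * k + 2))%nat with (S (S (4 * k + 2))) by lia. rewrite !fact_simpl, !mult_INR, !S_INR, plus_INR, mult_INR.
  simpl (INR 4); simpl (INR 2). ring. }
assert (F3 : INR (fact (2 * (2 * k + 3))) = INR (fact (4 * k + 2)) * (4 * INR k + 3) * (4 * INR k + 4) * (4 * INR k + 5) * (4 * INR k + 6)).
{ replace (2 * (2 * k + 3))%nat with (S (S (S (S (4 * k + 2))))) by lia. rewrite !fact_simpl, !mult_INR, !S_INR, plus_INR, mult_INR.
  simpl (INR 4); simpl (INR 2). ring. }
replace (2 * (2 * k + 1))%nat with (4 * k + 2)%nat in * by lia.
cbv zeta.
assert (W1 : ellZ PI ^ S (2 * k + 2) = ellZ PI ^ (2 * k + 2) * ellZ PI) by (simpl; ring).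
assert (W2 : ellZ PI ^ S (2 * k + 3) = ellZ PI ^ (2 * k + 2) * ellZ PI ^ 2).
{ rewrite <- pow_add. f_equal; lia. }
repeat split.
- replace (4 * k + 5)%nat with (4 * k + 2 + 1 + 2)%nat by lia. rewrite S1 by lia. rewrite O2. reflexivity.
- replace (4 * k + 6)%nat with (4 * k + 2 + 1 + 3)%nat by lia. rewrite S1 by lia. rewrite O3. reflexivity.
- replace (4 * k + 7)%nat with (4 * k + 2 + 1 + 4)%nat by lia. rewrite S1 by lia. rewrite O4. reflexivity.
- replace (4 * k + 5)%nat with (2 * (2 * k + 2) + 1 + 0)%nat by lia. rewrite S2 by lia. rewrite V0. ring.
- replace (4 * k + 6)%nat with (2 * (2 * k + 2) + 1 + 1)%nat by lia. rewrite S2 by lia. rewrite V1, F2, W1.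
  fold t21. field.
- replace (4 * k + 7)%nat with (2 * (2 * k + 2) + 1 + 2)%nat by lia. rewrite S2 by lia. rewrite V2, F2, W1.
  fold t21. field. lra.
- replace (4 * k + 7)%nat with (2 * (2 * k + 3) + 1 + 0)%nat by lia. rewrite S3 by lia. rewrite U0, F3, W2.
  fold t30. field.
Qed.

Lemma csch_series_series i s : is_series (fun n => (-1) ^ S n * INR (S n) ^ s * csch_deriv i (INR (S n) * PI)) (csch_series i s PI).
Proof. apply Series_correct, csch_series_ex. generalize PI_ge3; lra. Qed.

Lemma is_series_lin (a b : nat -> R) (c d la lb : R) : is_series a la -> is_series b lb ->
  is_series (fun n => c * a n + d * b n) (c * la + d * lb).
Proof.
intros Ha Hb. apply (is_series_plus (V := R_NormedModule)).
- apply (is_series_scal (V := R_NormedModule) c a la Ha).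
- apply (is_series_scal (V := R_NormedModule) d b lb Hb).
Qed.

Lemma is_series_eq (a : nat -> R) (l l' : R) : is_series a l -> l = l' -> is_series a l'.
Proof. now intros H <-. Qed.

Lemma sinh_pos_n n : 0 < sinh (INR (S n) * PI).
Proof.
assert (H : 1 <= INR (S n) * PI).
{ generalize PI_ge3 (pos_INR n). rewrite S_INR. nra. }
generalize (sinh_lower _ H) (exp_pos (INR (S n) * PI)). lra.
Qed.

(** Separates the powers whose exponent depends on [k]; as indeterminates they turn each final
    evaluation into an identity of rational functions. *)
Let PW : ellZ PI ^ (2 * k + 2) = G ^ (8 * k) / (2 ^ (8 * k) * PI ^ (6 * k)) * ellZ PI ^ 2.
Proof.
rewrite pow_add. f_equal. rewrite HG. unfold Rdiv. rewrite Rpow_mult_distr, pow_inv, Rpow_mult_distr.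
rewrite <- !pow_mult. replace 16 with (2 ^ 4) by ring. rewrite <- pow_mult.
replace (4 * (2 * k))%nat with (8 * k)%nat by lia. replace (3 * (2 * k))%nat with (6 * k)%nat by lia. reflexivity.
Qed.

Let fold_pow (x : R) (a b : nat) : x ^ (a * (k + 2) + b) = x ^ (a * k) * x ^ (2 * a + b).
Proof. rewrite <- pow_add. f_equal. lia. Qed.

Ltac final_tac :=
  rewrite ?fold_pow; unfold M;
  assert (P := PI_RGT_0);
  assert (Q1 : 0 < 2 ^ (8 * k)) by (apply pow_lt; lra);
  assert (Q2 : 0 < PI ^ (6 * k)) by (apply pow_lt; lra);
  assert (K := pos_INR k); revert Q1 Q2 K;
  generalize (2 ^ (8 * k)) (PI ^ (6 * k)) (G ^ (8 * k)) (INR (fact (4 * k + 2))) (INR k);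
  intros q2 qp qg c kk Q1 Q2 K; cbn [Nat.mul Nat.add]; field; repeat split; lra.

Lemma csch3_series_1 : is_series
  (fun i => (-1) ^ S i * INR (S i) ^ (4 * k + 5) / sinh (INR (S i) * PI) ^ 3)
  (- (INR (fact (4 * k + 2)) * G ^ (8 * (k + 2) + 0) / (2 ^ (8 * (k + 2) + 3) * PI ^ (6 * (k + 2) + 0)))
   * (4 * (64 * (M - 1) * (4 * M - 3) * PI ^ 4 / G ^ 8 + M - 3) * t10 + t12)).
Proof.
destruct csch_series_vals as (V1 & V2 & V3 & V4 & V5 & V6 & V7).
(* With c = 1 / sinh one has c'' = c + 2 c^3, hence c^3 = (c'' - c) / 2. *)
apply (is_series_ext (fun n => / 2 * ((-1) ^ S n * INR (S n) ^ (4 * k + 5) * csch_deriv 2 (INR (S n) * PI))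
  + (- / 2) * ((-1) ^ S n * INR (S n) ^ (4 * k + 5) * csch_deriv 0 (INR (S n) * PI)))).
- intros n. generalize (sinh_pos_n n). intros S0. unfold csch_deriv.
  generalize (INR (S n) ^ (4 * k + 5)) ((-1) ^ S n). intros u v. Rgoal. field. lra.
- eapply is_series_eq; [apply is_series_lin; apply csch_series_series|].
  rewrite V1, V4, PW, HG. final_tac.
Qed.

Lemma csch3_series_2 : is_series
  (fun i => (-1) ^ S i * INR (S i) ^ (4 * k + 7) / sinh (INR (S i) * PI) ^ 3)
  (- ((4 * INR k + 4) * (4 * INR k + 3) * INR (fact (4 * k + 2)) * G ^ (8 * (k + 2) + 0)
      / (2 ^ (8 * (k + 2) + 3) * PI ^ (6 * (k + 2) + 1)))
   * ((4 * M - 1) * t21 - 2 * (3 + 2 * M * (4 * M - 5)) * PI * t30)).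
Proof.
destruct csch_series_vals as (V1 & V2 & V3 & V4 & V5 & V6 & V7).
apply (is_series_ext (fun n => / 2 * ((-1) ^ S n * INR (S n) ^ (4 * k + 7) * csch_deriv 2 (INR (S n) * PI))
  + (- / 2) * ((-1) ^ S n * INR (S n) ^ (4 * k + 7) * csch_deriv 0 (INR (S n) * PI)))).
- intros n. generalize (sinh_pos_n n). intros S0. unfold csch_deriv.
  generalize (INR (S n) ^ (4 * k + 7)) ((-1) ^ S n). intros u v. Rgoal. field. lra.
- eapply is_series_eq; [apply is_series_lin; apply csch_series_series|].
  rewrite V6, V7, PW, HG. final_tac.
Qed.

Lemma cosh_csch4_series : is_series
  (fun i => (-1) ^ S i * INR (S i) ^ (4 * k + 6) * cosh (INR (S i) * PI) / sinh (INR (S i) * PI) ^ 4)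
  (- (INR (fact (4 * k + 2)) * G ^ (8 * (k + 2) + 0) / (3 * 2 ^ (8 * (k + 2) + 3) * PI ^ (6 * (k + 2) + 0)))
   * (256 * (M - 1) * (2 * M - 1) * (4 * M - 3) * PI ^ 3 * t10 / G ^ 8
      - 4 * (M - 1) * (4 * M - 5) * t21
      + 3 * (2 * M - 1) / PI * (4 * (M - 3) * t10 + t12))).
Proof.
destruct csch_series_vals as (V1 & V2 & V3 & V4 & V5 & V6 & V7).
(* With c = 1 / sinh one has c''' = c' - 6 cosh / sinh^4. *)
apply (is_series_ext (fun n => (- / 6) * ((-1) ^ S n * INR (S n) ^ (4 * k + 6) * csch_deriv 3 (INR (S n) * PI))
  + / 6 * ((-1) ^ S n * INR (S n) ^ (4 * k + 6) * csch_deriv 1 (INR (S n) * PI)))).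
- intros n. generalize (sinh_pos_n n). intros S0. unfold csch_deriv.
  generalize (INR (S n) ^ (4 * k + 6)) ((-1) ^ S n). intros u v. Rgoal. field. lra.
- eapply is_series_eq; [apply is_series_lin; apply csch_series_series|].
  rewrite V2, V5, PW, HG. final_tac.
Qed.

Lemma csch5_series : is_series
  (fun i => (-1) ^ S i * INR (S i) ^ (4 * k + 7) / sinh (INR (S i) * PI) ^ 5)
  (- ((4 * INR k + 7) * (4 * INR k + 6) * (4 * INR k + 5) * (4 * INR k + 4) * (4 * INR k + 3) * INR (fact (4 * k + 2))
      * (G ^ (8 * k) * G ^ 8) * t10
      / (2 ^ (8 * (k + 2) + 1) * 3 * (4 * M - 5) * (PI ^ (6 * k) * PI ^ 10)))
   - INR (fact (4 * k + 2)) * G ^ (8 * (k + 2) + 0) / (3 * 2 ^ (8 * (k + 2) + 13) * PI ^ (6 * (k + 2) + 6))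
     * (256 * PI ^ 4
        * (72 * (M - 1) * (2 * M - 1) * (4 * M - 5) * (4 * M - 3) * PI ^ 2 * t30
           - 40 * (M - 1) * (4 * M - 5) * (4 * M - 1) * PI * t21
           + 3 * (8 * M ^ 2 - 6 * M + 1) * (4 * (M - 3) * t10 + t12))
        + G ^ 8 * (8 * (6 * M ^ 2 - 37 * M + 55) * t10 + 24 * (M - 4) * t12 + t14))).
Proof.
destruct csch_series_vals as (V1 & V2 & V3 & V4 & V5 & V6 & V7).
(* With c = 1 / sinh, eliminating c^3 from c'''' = c + 20 c^3 + 24 c^5 gives 24 c^5 = c'''' - 10 c''
   + 9 c. *)
apply (is_series_ext (fun n =>
  1 * (/ 24 * ((-1) ^ S n * INR (S n) ^ (4 * k + 7) * csch_deriv 4 (INR (S n) * PI))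
       + (9 / 24) * ((-1) ^ S n * INR (S n) ^ (4 * k + 7) * csch_deriv 0 (INR (S n) * PI)))
  + (- 10 / 24) * ((-1) ^ S n * INR (S n) ^ (4 * k + 7) * csch_deriv 2 (INR (S n) * PI)))).
- intros n. generalize (sinh_pos_n n). intros S0. unfold csch_deriv.
  generalize (INR (S n) ^ (4 * k + 7)) ((-1) ^ S n). intros u v. Rgoal. field. lra.
- eapply is_series_eq; [apply is_series_lin; [apply is_series_lin|]; apply csch_series_series|].
  rewrite V3, V6, V7, PW, HG. final_tac.
Qed.
End Sums.

(** * The coefficients of sn^2 *)

(** Otherwise a point midway between the radius and [d] would be a point of convergence outside the
    disk. *)
Lemma radius_ge (a : nat -> R) (d : posreal) :
  (forall u, Rabs u < d -> ex_pseries a u) -> Rbar_le d (CV_radius a).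
Proof.
intros Hd. apply Rbar_not_lt_le. intros L.
destruct (CV_radius a) as [r| |] eqn:Er; simpl in L; auto.
- set (z := (Rmax r 0 + d) / 2).
  assert (Hz : Rmax r 0 < z < d).
  { assert (Rmax r 0 < d) by (apply Rmax_lub_lt; [auto|apply cond_pos]). unfold z; lra. }
  assert (0 <= Rmax r 0) by apply Rmax_r. assert (r <= Rmax r 0) by apply Rmax_l.
  apply (CV_disk_outside a z).
  + rewrite Er. simpl. rewrite Rabs_pos_eq; lra.
  + assert (X : ex_pseries a z) by (apply Hd; rewrite Rabs_pos_eq; lra).
    apply ex_pseries_R in X. apply ex_series_lim_0 in X. exact X.
- generalize (CV_radius_ge_0 a). rewrite Er. simpl. auto.
Qed.

Lemma is_pseries_const (c u : R) : is_pseries (fun n => if Nat.eqb n 0 then c else 0) u c.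
Proof.
apply is_pseries_R.
apply (is_series_decr_1 (V := R_NormedModule)). simpl.
apply (is_series_ext (fun _ => 0)); [intros n; Rgoal; ring|].
assert (Z : c + - (c * 1) = 0) by ring. change (is_series (fun _ : nat => 0) (c + - (c * 1))). rewrite Z.
apply (filterlim_ext (fun _ => 0)); [|apply filterlim_const].
intros n. rewrite sum_n_const. Rgoal. ring.
Qed.

Section Sn.
Variables (k : R) (Hk : 0 < k < 1).

Definition sn_delta (t : R) : R := sqrt (1 - k ^ 2 * sin t ^ 2).

Lemma sn_delta_arg t : 0 < 1 - k ^ 2 * sin t ^ 2 <= 1.
Proof.
generalize (sin2_range t). assert (0 < k ^ 2 < 1) by (simpl; nra).
generalize (sin t ^ 2) (k ^ 2) H. intros; split; nra.
Qed.

Lemma sn_delta_bounds t : 0 < sn_delta t <= 1.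
Proof.
generalize (sn_delta_arg t); intros H. unfold sn_delta; split; [apply sqrt_lt_R0; lra|].
apply Rle_trans with (sqrt 1); [apply sqrt_le_1_alt; lra|rewrite sqrt_1; lra].
Qed.

Lemma sn_delta_sqr t : sn_delta t ^ 2 = 1 - k ^ 2 * sin t ^ 2.
Proof. unfold sn_delta. apply pow2_sqrt. generalize (sn_delta_arg t); lra. Qed.

Lemma sn_delta_derive t : is_derive sn_delta t (- k ^ 2 * sin t * cos t / sn_delta t).
Proof.
generalize (sn_delta_arg t) (sn_delta_bounds t); intros H P. unfold sn_delta in *. auto_derive; [simpl in H; lra|].
simpl in *. unfold Rminus in *. field. lra.
Qed.

Lemma inv_sn_delta_continuous t : continuous (fun t => / sn_delta t) t.
Proof.
generalize (sn_delta_bounds t) (sn_delta_derive t). intros P H.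
apply ex_derive_Rcontinuous. auto_derive. split; [eexists; exact H|lra].
Qed.

Lemma ellF_derive t : is_derive (ellF k) t (/ sn_delta t).
Proof. apply (RInt_cont_derive (fun t => / sn_delta t)). apply inv_sn_delta_continuous. Qed.

Lemma ellF_0 : ellF k 0 = 0.
Proof. apply (RInt_point (V := R_CompleteNormedModule)). Qed.

(** A slope of at least [1] gives both injectivity, which pins down the choice made in [am], and
    surjectivity. *)
Lemma ellF_expand x y : x < y -> y - x <= ellF k y - ellF k x.
Proof.
intros L. destruct (MVT_gen (ellF k) x y (fun t => / sn_delta t)) as [c [_ E]].
- intros; apply ellF_derive.
- intros c _. apply derivable_continuous_pt. eexists. apply is_derive_Reals, ellF_derive.
- rewrite E. destruct (sn_delta_bounds c) as [P Q].
  assert (1 <= / sn_delta c) by (rewrite <- Rinv_1; apply Rinv_le_contravar; auto). nra.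
Qed.

Lemma sn_ellF phi : sn (ellF k phi) k = sin phi.
Proof.
unfold sn. f_equal.
assert (E : ellF k (am (ellF k phi) k) = ellF k phi).
{ unfold am. apply (epsilon_spec (inhabits 0) (fun p => ellF k p = ellF k phi)). exists phi; reflexivity. }
destruct (Rtotal_order (am (ellF k phi) k) phi) as [L|[L|L]]; auto.
- generalize (ellF_expand _ _ L); lra.
- generalize (ellF_expand _ _ L); lra.
Qed.

Lemma ellF_onto u : exists phi, ellF k phi = u.
Proof.
assert (C : continuity (ellF k)).
{ intros x. apply derivable_continuous_pt. eexists. apply is_derive_Reals, ellF_derive. }
destruct (IVT_gen (ellF k) (- (Rabs u + 1)) (Rabs u + 1) u C) as [p [_ E]]; [|eauto].
assert (0 <= Rabs u) by apply Rabs_pos.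
assert (A := ellF_expand 0 (Rabs u + 1) ltac:(lra)). assert (B := ellF_expand (- (Rabs u + 1)) 0 ltac:(lra)).
rewrite ellF_0 in A, B. generalize (Rle_abs u) (Rle_abs (- u)). rewrite Rabs_Ropp. intros.
split; [eapply Rle_trans; [apply Rmin_l|]|eapply Rle_trans; [|apply Rmax_r]]; lra.
Qed.

(** The identities are checked along u = [ellF k t], where [sn] is [sin t] by [sn_ellF].
    Differentiability is a hypothesis on [f], to be supplied by a power series, so the amplitude
    never has to be differentiated. *)
Lemma sn_ode (f f1 f2 : R -> R) (d : posreal) :
  (forall u, Rabs u < d -> f u = sn u k) ->
  (forall u, Rabs u < d -> is_derive f u (f1 u)) ->
  (forall u, Rabs u < d -> is_derive f1 u (f2 u)) ->
  forall u, Rabs u < d ->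
    f1 u ^ 2 = (1 - f u ^ 2) * (1 - k ^ 2 * f u ^ 2) /\
    f2 u = - (1 + k ^ 2) * f u + 2 * k ^ 2 * f u ^ 3.
Proof.
intros Hf H1 H2 u Hu. destruct (ellF_onto u) as [phi E].
assert (Cont : forall t, Rabs (ellF k t) < d -> locally t (fun s => Rabs (ellF k s) < d)).
{ intros t Ht. apply Rabs_def2 in Ht.
  assert (C : continuous (ellF k) t) by (apply ex_derive_Rcontinuous; eexists; apply ellF_derive).
  apply (C (fun v => Rabs v < d)). apply (locally_interval _ (ellF k t) (- d) d); simpl; try lra.
  intros v Hv1 Hv2. apply Rabs_def1; auto. }
assert (F1 : forall t, Rabs (ellF k t) < d -> f1 (ellF k t) = cos t * sn_delta t).
{ intros t Ht. destruct (sn_delta_bounds t) as [P _].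
  assert (D1 : is_derive (fun s => f (ellF k s)) t (/ sn_delta t * f1 (ellF k t))).
  { apply (is_derive_comp f (ellF k)); [apply H1; auto|apply ellF_derive]. }
  assert (D2 : is_derive (fun s => f (ellF k s)) t (cos t)).
  { apply (is_derive_ext_loc sin).
    - generalize (Cont t Ht). apply filter_imp. intros s Hs. rewrite Hf by auto. symmetry; apply sn_ellF.
    - auto_derive; [auto|ring]. }
  apply (is_derive_inj _ _ _ _ D1) in D2.
  rewrite <- D2. field. lra. }
assert (F2 : forall t, Rabs (ellF k t) < d -> f2 (ellF k t) = (- sin t * sn_delta t - k ^ 2 * sin t * cos t ^ 2 / sn_delta t) * sn_delta t).
{ intros t Ht. destruct (sn_delta_bounds t) as [P _].
  assert (D1 : is_derive (fun s => f1 (ellF k s)) t (/ sn_delta t * f2 (ellF k t))).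
  { apply (is_derive_comp f1 (ellF k)); [apply H2; auto|apply ellF_derive]. }
  assert (D2 : is_derive (fun s => f1 (ellF k s)) t (- sin t * sn_delta t - k ^ 2 * sin t * cos t ^ 2 / sn_delta t)).
  { apply (is_derive_ext_loc (fun s => cos s * sn_delta s)).
    - generalize (Cont t Ht). apply filter_imp. intros s Hs. rewrite F1 by auto. reflexivity.
    - generalize (sn_delta_derive t); intros H. auto_derive; [eexists; exact H|]. subst_Derive H. Rgoal. field. lra. }
  apply (is_derive_inj _ _ _ _ D1) in D2.
  rewrite <- D2. field. lra. }
destruct (sn_delta_bounds phi) as [P _].
assert (S := sn_delta_sqr phi). assert (SC := sin2_cos2 phi). unfold Rsqr in SC.
assert (C2 : cos phi ^ 2 = 1 - sin phi ^ 2) by (simpl; lra).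
assert (Ef : f u = sin phi) by (rewrite Hf, <- E by auto; apply sn_ellF).
rewrite Ef. rewrite <- E in Hu |- *. rewrite F1, F2 by auto. split.
- rewrite Rpow_mult_distr, S, C2. ring.
- replace ((- sin phi * sn_delta phi - k ^ 2 * sin phi * cos phi ^ 2 / sn_delta phi) * sn_delta phi) with
    (- sin phi * sn_delta phi ^ 2 - k ^ 2 * sin phi * cos phi ^ 2) by (field; lra).
  rewrite S, C2. ring.
Qed.

(* Coefficients of sn^2, from w'' = 2 - 4 (1 + k^2) w + 6 k^2 w^2. *)
Lemma sn_sqr_recursion (a : nat -> R) :
  locally 0 (fun u => is_pseries a u (sn u k)) ->
  let b := PS_mult a a in
  forall n, INR (n + 2) * INR (n + 1) * b (n + 2)%nat =
    (if Nat.eqb n 0 then 2 else 0) - 4 * (1 + k ^ 2) * b n + 6 * k ^ 2 * PS_mult b b n.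
Proof.
intros [d Hd] b n.
assert (Hd' : forall u, Rabs u < d -> is_pseries a u (sn u k)).
{ intros u Hu. apply Hd. change (Rabs (u - 0) < d). now rewrite Rminus_0_r. }
assert (CV : Rbar_le d (CV_radius a)) by (apply radius_ge; intros u Hu; eexists; apply Hd', Hu).
assert (In : forall u, Rabs u < d -> Rbar_lt (Rabs u) (CV_radius a)).
{ intros u Hu. eapply Rbar_lt_le_trans; [|exact CV]. exact Hu. }
set (f := PSeries a). set (f1 := PSeries (PS_derive a)). set (f2 := PSeries (PS_derive (PS_derive a))).
assert (ODE := sn_ode f f1 f2 d).
assert (Hf : forall u, Rabs u < d -> f u = sn u k) by (intros u Hu; apply is_pseries_unique; auto).
assert (H1 : forall u, Rabs u < d -> is_derive f u (f1 u)) by (intros u Hu; apply is_derive_PSeries; auto).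
assert (H2 : forall u, Rabs u < d -> is_derive f1 u (f2 u)).
{ intros u Hu; apply is_derive_PSeries. rewrite CV_radius_derive. auto. }
specialize (ODE Hf H1 H2).
assert (Pb : forall u, Rabs u < d -> is_pseries b u (f u ^ 2)).
{ intros u Hu. replace (f u ^ 2) with (f u * f u) by ring.
  assert (Pa : is_pseries a u (f u)) by (rewrite Hf by auto; apply Hd', Hu).
  apply is_pseries_mult; auto. }
assert (CVb : Rbar_le d (CV_radius b)) by (apply radius_ge; intros u Hu; eexists; apply Pb, Hu).
assert (Inb : forall u, Rabs u < d -> Rbar_lt (Rabs u) (CV_radius b)).
{ intros u Hu. eapply Rbar_lt_le_trans; [|exact CVb]. exact Hu. }
assert (Loc : forall u, Rabs u < d -> locally u (fun v => Rabs v < d)).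
{ intros u Hu. apply Rabs_def2 in Hu. apply (locally_interval _ u (- d) d); simpl; try lra.
  intros v Hv1 Hv2. apply Rabs_def1; auto. }
assert (W1 : forall u, Rabs u < d -> PSeries (PS_derive b) u = 2 * f u * f1 u).
{ intros u Hu. assert (D1 := is_derive_PSeries b u (Inb u Hu)).
  assert (D2 : is_derive (PSeries b) u (2 * f u * f1 u)).
  { apply (is_derive_ext_loc (fun u => f u ^ 2)).
    - generalize (Loc u Hu). apply filter_imp. intros v Hv. symmetry. apply is_pseries_unique; auto.
    - generalize (H1 u Hu); intros H. auto_derive; [eexists; exact H|]. subst_Derive H. Rgoal. ring. }
  apply (is_derive_inj _ _ _ _ D1) in D2. exact D2. }
assert (W2 : forall u, Rabs u < d -> PSeries (PS_derive (PS_derive b)) u = 2 * f1 u ^ 2 + 2 * f u * f2 u).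
{ intros u Hu.
  assert (D1 : is_derive (PSeries (PS_derive b)) u (PSeries (PS_derive (PS_derive b)) u)).
  { apply is_derive_PSeries. rewrite CV_radius_derive. auto. }
  assert (D2 : is_derive (PSeries (PS_derive b)) u (2 * f1 u ^ 2 + 2 * f u * f2 u)).
  { apply (is_derive_ext_loc (fun u => 2 * f u * f1 u)).
    - generalize (Loc u Hu). apply filter_imp. intros v Hv. symmetry; auto.
    - generalize (H1 u Hu) (H2 u Hu); intros H H'. auto_derive; [repeat split; eexists; eassumption|].
      subst_Derive H; subst_Derive H'. Rgoal. ring. }
  apply (is_derive_inj _ _ _ _ D1) in D2. exact D2. }
set (e0 := fun n : nat => if Nat.eqb n 0 then 2 else 0).
set (rhs := PS_plus (PS_plus e0 (PS_scal (- 4 * (1 + k ^ 2)) b)) (PS_scal (6 * k ^ 2) (PS_mult b b))).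
assert (Pr : forall u, Rabs u < d -> is_pseries rhs u (2 + - 4 * (1 + k ^ 2) * f u ^ 2 + 6 * k ^ 2 * (f u ^ 2 * f u ^ 2))).
{ intros u Hu. apply (is_pseries_plus (V := R_NormedModule)); [apply (is_pseries_plus (V := R_NormedModule))|].
  - apply is_pseries_const.
  - apply (is_pseries_scal (V := R_NormedModule)); [apply Rmult_comm|auto].
  - apply (is_pseries_scal (V := R_NormedModule)); [apply Rmult_comm|]. apply is_pseries_mult; auto. }
assert (E : PS_derive (PS_derive b) n = rhs n).
{ apply PSeries_ext_recip.
  - rewrite !CV_radius_derive. eapply Rbar_lt_le_trans; [|exact CVb]. apply cond_pos.
  - apply Rbar_lt_le_trans with d; [apply cond_pos|]. apply radius_ge. intros u Hu; eexists; apply Pr, Hu.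
  - exists d. intros u Hu. assert (Hu' : Rabs u < d) by (rewrite <- (Rminus_0_r u); exact Hu).
    rewrite W2 by auto. rewrite (is_pseries_unique _ _ _ (Pr u Hu')).
    destruct (ODE u Hu') as [-> ->]. ring. }
unfold rhs, PS_plus, PS_scal, PS_derive, e0 in E. unfold plus, scal in E; simpl in E. unfold mult in E; simpl in E.
replace (n + 2)%nat with (S (S n)) by lia. replace (n + 1)%nat with (S n) by lia.
rewrite !S_INR in *. unfold b in *. destruct n; simpl in *; lra.
Qed.
End Sn.

(** Rewrites a series in the powers u^(2 i + 1) as a power series indexed by the exponent. *)
Definition odd_seq (c : nat -> R) (n : nat) : R := if Nat.odd n then c (Nat.div2 n) else 0.

Lemma odd_seq_even c i : odd_seq c (2 * i) = 0.
Proof. unfold odd_seq. now rewrite Nat.odd_even. Qed.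
Lemma odd_seq_odd c i : odd_seq c (2 * i + 1) = c i.
Proof.
unfold odd_seq. rewrite Nat.odd_odd. f_equal. replace (2 * i + 1)%nat with (S (2 * i)) by lia.
apply Nat.div2_succ_double.
Qed.

Lemma is_pseries_odd_seq c u l :
  is_series (fun i => c i * u ^ (2 * i + 1)) l -> is_pseries (odd_seq c) u l.
Proof.
intros H. assert (Z0 : forall z, is_pseries (fun _ : nat => 0) z 0).
{ intros z. apply is_pseries_R. apply (is_series_ext (fun _ => 0)); [intros n; Rgoal; ring|].
  apply (filterlim_ext (fun _ => 0)); [|apply filterlim_const].
  intros n. rewrite sum_n_const. Rgoal. ring. }
(* The odd part is u times a series in u^2, so recovering that series divides by [u]. *)
destruct (Req_dec u 0) as [-> |Hu].
- assert (l = 0).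
  { rewrite <- (is_series_unique _ _ H). rewrite (Series_ext _ (fun _ => 0 * 0)).
    - rewrite Series_scal_l. Rgoal; ring.
    - intros n. rewrite pow_add, pow_1. Rgoal. ring. }
  subst l. generalize (is_pseries_0 (V := R_NormedModule) (odd_seq c)). simpl. auto.
- replace l with (plus 0 (u * (/ u * l))) by (change (0 + u * (/ u * l) = l); field; auto).
  apply (is_pseries_odd_even (odd_seq c) u 0 (/ u * l)).
  + eapply is_pseries_ext; [|apply Z0]. intros n. symmetry; apply odd_seq_even.
  + apply is_pseries_R. apply (is_series_ext (fun i => / u * (c i * u ^ (2 * i + 1)))).
    * intros n. rewrite odd_seq_odd, pow_add, pow_mult, pow_1. Rgoal. field. auto.
    * apply (is_series_scal (V := R_NormedModule) (/ u) _ l H).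
Qed.

(** The coefficient of u^(2 n) in the square of the odd series; the shift by one is (2 i + 1) + (2 j
    + 1) = 2 (i + j + 1). *)
Definition odd_sqr (c : nat -> R) (n : nat) : R := match n with 0 => 0 | S n => conv c n end.

Lemma sum_odd_only (f : nat -> R) (j : nat) :
  (forall i, f (2 * i)%nat = 0) -> sum_f_R0 f (2 * S j) = sum_f_R0 (fun i => f (2 * i + 1)%nat) j.
Proof.
intros H; induction j as [|j IH].
- assert (A := H 0%nat). assert (B := H 1%nat). simpl in *. rewrite A, B. ring.
- replace (2 * S (S j))%nat with (S (S (2 * S j))) by lia. rewrite !tech5, IH.
  replace (S (S (2 * S j))) with (2 * (S (S j)))%nat by lia. rewrite H.
  replace (S (2 * S j)) with (2 * S j + 1)%nat by lia. ring.
Qed.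

Lemma PS_mult_odd_seq c n : PS_mult (odd_seq c) (odd_seq c) (2 * n) = odd_sqr c n.
Proof.
unfold PS_mult. destruct n as [|n]; [assert (A := odd_seq_even c 0); simpl in *; rewrite A; ring|].
rewrite sum_odd_only.
- unfold odd_sqr, conv. apply sum_eq. intros i Hi. rewrite odd_seq_odd.
  replace (2 * S n - (2 * i + 1))%nat with (2 * (n - i) + 1)%nat by lia. now rewrite odd_seq_odd.
- intros i. rewrite odd_seq_even. ring.
Qed.
Lemma PS_mult_odd_seq_odd c n : PS_mult (odd_seq c) (odd_seq c) (2 * n + 1) = 0.
Proof.
unfold PS_mult. apply sum_eq_R0. intros i Hi.
destruct (Nat.Even_or_Odd i) as [[l ->]|[l ->]].
- rewrite odd_seq_even; ring.
- replace (2 * n + 1 - (2 * l + 1))%nat with (2 * (n - l))%nat by lia. rewrite odd_seq_even; ring.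
Qed.

Lemma odd_sqr_recursion k c : 0 < k < 1 ->
  locally 0 (fun u => is_series (fun i => c i * u ^ (2 * i + 1)) (sn u k)) ->
  forall j, INR (2 * j + 2) * INR (2 * j + 1) * odd_sqr c (S j) =
    (if Nat.eqb j 0 then 2 else 0) - 4 * (1 + k ^ 2) * odd_sqr c j + 6 * k ^ 2 * conv (odd_sqr c) j.
Proof.
intros Hk H j.
assert (H' : locally 0 (fun u => is_pseries (odd_seq c) u (sn u k))).
{ generalize H. apply filter_imp. intros u. apply is_pseries_odd_seq. }
generalize (sn_sqr_recursion k Hk (odd_seq c) H' (2 * j)).
replace (2 * j + 2)%nat with (2 * S j)%nat at 2 by lia. rewrite !PS_mult_odd_seq.
replace (Nat.eqb (2 * j) 0) with (Nat.eqb j 0) by (destruct j; reflexivity).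
intros ->. f_equal. f_equal. unfold PS_mult at 1. rewrite sum_even_only.
- unfold conv. apply sum_eq. intros i Hi. replace (2 * j - 2 * i)%nat with (2 * (j - i))%nat by lia.
  now rewrite !PS_mult_odd_seq.
- intros i. rewrite PS_mult_odd_seq_odd. ring.
Qed.

(* The factor [(x - 1) ^ (n - 1)] turns the recursion for sn^2 at the modulus
   [x / (x - 1)] into [rho_rec]. *)
Lemma rho_rec_of_odd_sqr (be : nat -> R -> R) :
  (forall x, be 0%nat x = 0) ->
  (forall j x, INR (2 * j + 2) * INR (2 * j + 1) * be (S j) x =
    (if Nat.eqb j 0 then 2 else 0) - 4 * (1 + x) * be j x + 6 * x * conv (fun i => be i x) j) ->
  rho_rec (fun n x => (x - 1) ^ (n - 1) * be n (x / (x - 1))).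
Proof.
intros H0 HS x Hx. set (X := x / (x - 1)).
assert (HX : X * (x - 1) = x) by (unfold X; field; lra).
split; [rewrite H0; ring|]. split.
- generalize (HS 0%nat X). unfold conv. simpl. rewrite H0. lra.
- intros j Hj. destruct j as [|j]; [lia|].
  replace (INR (2 * S j + 2) * INR (2 * S j + 1) * ((x - 1) ^ (S (S j) - 1) * be (S (S j)) X)) with
   ((x - 1) ^ S j * (INR (2 * S j + 2) * INR (2 * S j + 1) * be (S (S j)) X))
   by (replace (S (S j) - 1)%nat with (S j) by lia; ring).
  rewrite HS. simpl (Nat.eqb (S j) 0). cbv iota.
  replace (S j - 1)%nat with j by lia.
  assert (CE : (x - 1) * ((x - 1) * conv (fun i => (x - 1) ^ (i - 1) * be i X) (S j)) = (x - 1) ^ S j * conv (fun i => be i X) (S j)).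
  { unfold conv. rewrite <- Rmult_assoc, !scal_sum. apply sum_eq. intros i Hi.
    (* At both ends the truncated exponents do not add up, but there one factor is [be 0], which
       vanishes. *)
    destruct (Nat.eq_dec i 0) as [-> |N0]; [rewrite H0; ring|].
    destruct (Nat.eq_dec i (S j)) as [-> |N1]; [rewrite Nat.sub_diag, H0; ring|].
    replace ((x - 1) ^ S j) with ((x - 1) ^ (i - 1) * (x - 1) ^ (S j - i - 1) * (x - 1) ^ 2).
    - ring.
    - rewrite <- !pow_add. f_equal. lia. }
  transitivity (-4 * ((x - 1) + X * (x - 1)) * ((x - 1) ^ j * be (S j) X)
     + 6 * X * ((x - 1) ^ S j * conv (fun i => be i X) (S j))); [simpl pow; ring|].
  rewrite <- CE.
  replace (6 * X * ((x - 1) * ((x - 1) * conv (fun i => (x - 1) ^ (i - 1) * be i X) (S j)))) with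
   (6 * (X * (x - 1)) * ((x - 1) * conv (fun i => (x - 1) ^ (i - 1) * be i X) (S j))) by ring.
  rewrite HX. ring.
Qed.

(* From the rational polynomials to the recursion, and the final assembly *)
From mathcomp Require Import all_boot all_order all_algebra.
From mathcomp Require Import Rstruct zify.
Import Order.TTheory GRing.Theory Num.Theory.

Local Open Scope R_scope.

Definition sn_coef (g : nat -> {poly rat}) (x : R) (i : nat) : R := evalR (g (2 * i + 1)%N) x / INR (2 * i + 1)`!.
Definition sn2_coef (g : nat -> {poly rat}) (n : nat) (x : R) : R := evalR (q_poly g n) x / INR (2 * n)`!.

Lemma natr_fact_neq0 n : (n`!%:R != 0 :> R)%R.
Proof. by rewrite pnatr_eq0 -lt0n fact_gt0. Qed.

Lemma frac_mul (c u v a b : R) : c <> 0 -> a <> 0 -> b <> 0 ->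
  c * (u * v) * / (c * (a * b)) = u * / a * (v * / b).
Proof. by move=> *; field. Qed.

(** The binomial coefficient in [q_poly], divided by (2n)!, splits into the two inverse factorials
    carried by [sn_coef]. *)
Lemma sn2_coef_odd_sqr g n x : sn2_coef g n x = odd_sqr (sn_coef g x) n.
Proof.
case: n => [|n]; first by rewrite /sn2_coef /q_poly big_geq // /evalR rmorph0 horner0 /Rdiv Rmult_0_l.
rewrite /odd_sqr /conv /sn2_coef sum_f_R0E /q_poly /evalR rmorph_sum horner_sum big_add1 /= RdivE mulr_suml.
rewrite !big_mkord; apply: eq_bigr => i _.
rewrite /sn_coef /evalR map_polyZ hornerZ rmorphM hornerM /= ratr_nat !RdivE !INRE RmultE.
have lein : (i <= n)%N by rewrite -ltnS.
have -> : (2 * i.+1 - 1 = 2 * i + 1)%N by lia.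
have -> : (2 * n.+1 - 2 * i.+1 + 1 = 2 * (n - i) + 1)%N by lia.
have lei2 : (2 * i + 1 <= 2 * n.+1)%N by lia.
have := bin_fact lei2.
have -> : (2 * n.+1 - (2 * i + 1) = 2 * (n - i) + 1)%N by lia.
move=> /(congr1 (fun n => n%:R : R)%R); rewrite !natrM => <-.
apply: frac_mul; apply/eqP; [by rewrite pnatr_eq0 -lt0n bin_gt0|exact: natr_fact_neq0|exact: natr_fact_neq0].
Qed.

Lemma poly_zero_01 (p : {poly R}) : (forall x, 0 < x < 1 -> p.[x]%R = 0) -> p = 0%R.
Proof.
(* As many distinct roots as the size of [p]; starting at 1/2 keeps them strictly below [1]. *)
move=> H; set rs := [seq / INR (i + 2)%coq_nat | i <- iota 0 (size p)].
apply: (@roots_geq_poly_eq0 _ p rs).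
- apply/allP => _ /mapP [i _ ->]; apply/rootP; apply: H.
  rewrite plus_INR /=; have := pos_INR i => Hi; split; first by apply: Rinv_0_lt_compat; lra.
  by rewrite -Rinv_1; apply: Rinv_lt_contravar; lra.
- rewrite map_inj_uniq ?iota_uniq // => i j /(f_equal Rinv); rewrite !Rinv_inv => /INR_eq.
  by lia.
- by rewrite size_map size_iota.
Qed.

(** The analytic recursion is available at x = k^2 in (0, 1), whereas [R_even] calls for it at x /
    (x - 1) < 0. Both sides are polynomials in [x], so it extends to all reals. *)
Lemma sn2_coef_recursion g : sn_maclaurin g -> forall j x,
  INR (2 * j + 2) * INR (2 * j + 1) * sn2_coef g (S j) x =
    (if Nat.eqb j 0 then 2 else 0) - 4 * (1 + x) * sn2_coef g j x + 6 * x * conv (fun i => sn2_coef g i x) j.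
Proof.
move=> hg j.
have [B BE] : exists B : nat -> {poly R}, forall n x, sn2_coef g n x = (B n).[x]%R.
  exists (fun n => (INR (2 * n)`!)^-1 *: map_poly ratr (q_poly g n))%R => n x.
  by rewrite hornerZ mulrC /sn2_coef RdivE.
pose d : R := if Nat.eqb j 0 then 2 else 0.
pose c : R := INR (2 * j + 2) * INR (2 * j + 1).
pose c4 : R := 4; pose c6 : R := 6.
pose P : {poly R} := (c *: B j.+1
  - (d%:P - c4 *: ((1 + 'X) * B j) + c6 *: ('X * \sum_(0 <= i < j.+1) B i * B (j - i)%N)))%R.
have PE x : P.[x]%R = c * sn2_coef g j.+1 x -
    (d - c4 * ((1 + x) * sn2_coef g j x) + c6 * (x * conv (fun i => sn2_coef g i x) j)).
  rewrite /P !(hornerD, hornerN, hornerZ, hornerM, hornerC, hornerX) horner_sum /conv sum_f_R0E -!BE.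
  by do 5 congr (_ _ _); apply: eq_bigr => i _; rewrite hornerM -!BE.
have P0 : P = 0%R.
  apply: poly_zero_01 => x Hx; rewrite PE.
  have Hk : 0 < sqrt x < 1.
    split; first by apply: sqrt_lt_R0; lra.
    by rewrite -sqrt_1; apply: sqrt_lt_1_alt; lra.
  have := odd_sqr_recursion (sqrt x) (sn_coef g x) Hk.
  have Ex : sqrt x ^ 2 = x by rewrite pow2_sqrt //; lra.
  rewrite Ex => /(_ _ j) H.
  have := hg (sqrt x) Hk; rewrite Ex => /H {}H.
  have CE : conv (odd_sqr (sn_coef g x)) j = conv (fun i => sn2_coef g i x) j.
    by rewrite /conv; apply: PartSum.sum_eq => i _; rewrite !sn2_coef_odd_sqr.
  rewrite CE -!sn2_coef_odd_sqr in H.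
  have {}H : c * sn2_coef g j.+1 x = d - 4 * (1 + x) * sn2_coef g j x + 6 * x * conv (fun i => sn2_coef g i x) j := H.
  by rewrite H /c4 /c6; Rgoal; ring.
move=> x; have := PE x; rewrite P0 horner0.
move=> /esym /Rminus_diag_uniq H.
have {}H : c * sn2_coef g j.+1 x = d - c4 * ((1 + x) * sn2_coef g j x) + c6 * (x * conv (fun i => sn2_coef g i x) j) := H.
by rewrite -/c -/d H /c4 /c6; Rgoal; ring.
Qed.

Lemma R_even_rho g : sn_maclaurin g -> rho_rec (R_even g).
Proof.
move=> hg x Hx.
have b0 y : sn2_coef g 0 y = 0 by rewrite sn2_coef_odd_sqr.
have := rho_rec_of_odd_sqr (sn2_coef g) b0 (sn2_coef_recursion g hg) x Hx.
have RE n y : R_even g n y = (y - 1) ^ (n - 1) * sn2_coef g n (y / (y - 1)).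
  by rewrite /R_even /sn2_coef /Rdiv; ring.
have CE j : conv (fun i => R_even g i x) j = conv (fun i => (x - 1) ^ (i - 1) * sn2_coef g i (x / (x - 1))) j.
  by rewrite /conv; apply: PartSum.sum_eq => i _; rewrite !RE.
move=> [h0 [h1 hS]]; split; first by rewrite RE.
split; first by rewrite RE.
by move=> j /hS; rewrite CE !RE.
Qed.

(** [R_even] contains the quotient x / (x - 1); agreement with a polynomial function on (0, 1), a
    neighbourhood of 1/2, is enough to identify all derivatives there. *)
Lemma R_even_tower g n : sn_maclaurin g -> exists T, [/\ tower T,
  forall x, 0 < x < 1 -> R_even g n x = T 0%N x &
  forall k, Derive_n (R_even g n) k (1 / 2) = T k (1 / 2)].
Proof.
move=> hg; have [f [Pf Ef]] := rho_polyfun (R_even g) (R_even_rho g hg) n.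
exists (Derive_n f); split; [exact: polyfun_tower|exact: Ef|move=> k].
apply: Derive_n_ext_loc.
by apply: (@locally_interval _ _ 0 1) => /= [||y y0 y1]; [lra|lra|apply: Ef].
Qed.

Theorem theorem3p16 (g : nat -> {poly rat}) (hg : sn_maclaurin g)
    (m : nat) (hm : (1 < m)%N) :
  let G := Gamma (1 / 4) in
  let M := INR m in
  let R4m_6 := R_even g (2 * m - 3)%N in
  let R4m_4 := R_even g (2 * m - 2)%N in
  let R4m_2 := R_even g (2 * m - 1)%N in
  let D f k := Derive_n f k (1 / 2) in
  is_series
    (fun i : nat => let n := INR i.+1 in
       (-1) ^ i.+1 * n ^ (4 * m - 3)%N / sinh (n * PI) ^ 3)
    (- (INR (4 * m - 6)`!%N * G ^ (8 * m)%N
        / (2 ^ (8 * m + 3)%N * PI ^ (6 * m)%N))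
     * (4 * (64 * (M - 1) * (4 * M - 3) * PI ^ 4 / G ^ 8 + M - 3) * R4m_6 (1 / 2)
        + D R4m_6 2%N))
  /\
  is_series
    (fun i : nat => let n := INR i.+1 in
       (-1) ^ i.+1 * n ^ (4 * m - 1)%N / sinh (n * PI) ^ 3)
    (- (INR (4 * m - 4)`!%N * G ^ (8 * m)%N
        / (2 ^ (8 * m + 3)%N * PI ^ (6 * m + 1)%N))
     * ((4 * M - 1) * D R4m_4 1%N
        - 2 * (3 + 2 * M * (4 * M - 5)) * PI * R4m_2 (1 / 2)))
  /\
  is_series
    (fun i : nat => let n := INR i.+1 in
       (-1) ^ i.+1 * n ^ (4 * m - 2)%N * cosh (n * PI) / sinh (n * PI) ^ 4)
    (- (INR (4 * m - 6)`!%N * G ^ (8 * m)%N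
        / (3 * 2 ^ (8 * m + 3)%N * PI ^ (6 * m)%N))
     * (256 * (M - 1) * (2 * M - 1) * (4 * M - 3) * PI ^ 3 * R4m_6 (1 / 2) / G ^ 8
        - 4 * (M - 1) * (4 * M - 5) * D R4m_4 1%N
        + 3 * (2 * M - 1) / PI
          * (4 * (M - 3) * R4m_6 (1 / 2) + D R4m_6 2%N)))
  /\
  is_series
    (fun i : nat => let n := INR i.+1 in
       (-1) ^ i.+1 * n ^ (4 * m - 1)%N / sinh (n * PI) ^ 5)
    (- (INR (4 * m - 1)`!%N * G ^ (8 * m - 8)%N * R4m_6 (1 / 2)
        / (2 ^ (8 * m + 1)%N * 3 * (4 * M - 5) * PI ^ (6 * m - 2)%N))
     - INR (4 * m - 6)`!%N * G ^ (8 * m)%N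
       / (3 * 2 ^ (8 * m + 13)%N * PI ^ (6 * m + 6)%N)
       * (256 * PI ^ 4
          * (72 * (M - 1) * (2 * M - 1) * (4 * M - 5) * (4 * M - 3) * PI ^ 2
               * R4m_2 (1 / 2)
             - 40 * (M - 1) * (4 * M - 5) * (4 * M - 1) * PI * D R4m_4 1%N
             + 3 * (8 * M ^ 2 - 6 * M + 1)
               * (4 * (M - 3) * R4m_6 (1 / 2) + D R4m_6 2%N))
          + G ^ 8
          * (8 * (6 * M ^ 2 - 37 * M + 55) * R4m_6 (1 / 2)
             + 24 * (M - 4) * D R4m_6 2%N + D R4m_6 4%N))).
Proof.
case: m hm => [|[|k]] // _.
have [T1 [HT1 E1 V1]] := R_even_tower g (2 * k + 1) hg.
have [T2 [HT2 E2 V2]] := R_even_tower g (2 * k + 2) hg.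
have [T3 [HT3 E3 V3]] := R_even_tower g (2 * k + 3) hg.
have GE : Gamma (1 / 4) = 4 * sqrt (sqrt PI / 2 * lemint) := Gamma_quarter.
have HG0 : Gamma (1 / 4) <> 0.
  rewrite GE; have K := lemint_pos; have P := sqrt_lt_R0 _ PI_RGT_0.
  have S : 0 < sqrt (sqrt PI / 2 * lemint) by apply: sqrt_lt_R0; apply: Rmult_lt_0_compat; lra.
  lra.
have HG : ellZ PI = Gamma (1 / 4) ^ 4 / (16 * PI ^ 3) by rewrite GE ellZ_PI.
have S1 := csch3_series_1 _ (R_even_rho g hg) _ HG0 HG k _ _ _ HT1 HT2 HT3 E1 E2 E3.
have S2 := csch3_series_2 _ (R_even_rho g hg) _ HG k _ _ _ HT1 HT2 HT3 E1 E2 E3.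
have S3 := cosh_csch4_series _ (R_even_rho g hg) _ HG0 HG k _ _ _ HT1 HT2 HT3 E1 E2 E3.
have S4 := csch5_series _ (R_even_rho g hg) _ HG k _ _ _ HT1 HT2 HT3 E1 E2 E3.
have n0 : ((8 * (k + 2)) + 0)%coq_nat = (8 * k.+2)%N by lia.
have n1 : ((8 * (k + 2)) + 1)%coq_nat = (8 * k.+2 + 1)%N by lia.
have n3 : ((8 * (k + 2)) + 3)%coq_nat = (8 * k.+2 + 3)%N by lia.
have n13 : ((8 * (k + 2)) + 13)%coq_nat = (8 * k.+2 + 13)%N by lia.
have p0 : ((6 * (k + 2)) + 0)%coq_nat = (6 * k.+2)%N by lia.
have p1 : ((6 * (k + 2)) + 1)%coq_nat = (6 * k.+2 + 1)%N by lia.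
have p6 : ((6 * (k + 2)) + 6)%coq_nat = (6 * k.+2 + 6)%N by lia.
have n8 : (8 * k.+2 - 8 = (8 * k + 8)%coq_nat)%N by lia.
have p2 : (6 * k.+2 - 2 = (6 * k + 10)%coq_nat)%N by lia.
have g8 x : x ^ (8 * k.+2 - 8)%N = x ^ (8 * k)%coq_nat * x ^ 8 by rewrite n8 pow_add.
have g10 x : x ^ (6 * k.+2 - 2)%N = x ^ (6 * k)%coq_nat * x ^ 10 by rewrite p2 pow_add.
rewrite ?n0 ?n1 ?n3 ?n13 ?p0 ?p1 ?p6 in S1 S2 S3 S4.
have e1 : (2 * k.+2 - 3 = 2 * k + 1)%N by lia.
have e2 : (2 * k.+2 - 2 = 2 * k + 2)%N by lia.
have e3 : (2 * k.+2 - 1 = 2 * k + 3)%N by lia.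
have e4 : (4 * k.+2 - 6 = 4 * k + 2)%N by lia.
have e5 : (4 * k.+2 - 3 = 4 * k + 5)%N by lia.
have e6 : (4 * k.+2 - 1 = 4 * k + 7)%N by lia.
have e7 : (4 * k.+2 - 2 = 4 * k + 6)%N by lia.
have e8 : (4 * k.+2 - 4 = (4 * k + 2).+2)%N by lia.
have e9 : (4 * k + 7 = (4 * k + 2).+4.+1)%N by lia.
have eM : INR k.+2 = INR k + 2 by rewrite !S_INR; ring.
have m42 : INR (4 * k + 2)%N = 4 * INR k + 2 by rewrite -plusE -multE plus_INR mult_INR /=; ring.
have f4 : INR (4 * k + 2).+2`! = (4 * INR k + 4) * (4 * INR k + 3) * INR (fact (4 * k + 2)).
  by rewrite -factE !fact_simpl !mult_INR !S_INR m42; ring.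
have f7 : INR (4 * k + 7)`! = (4 * INR k + 7) * (4 * INR k + 6) * (4 * INR k + 5) * (4 * INR k + 4)
    * (4 * INR k + 3) * INR (fact (4 * k + 2)).
  by rewrite e9 -factE !fact_simpl !mult_INR !S_INR m42; ring.
cbv zeta; rewrite e1 e2 e3 e4 e5 e7 e8 e6 eM f4 f7 g8 g10 -!factE.
rewrite -?V1 -?V2 -?V3 in S1 S2 S3 S4.
by split; [exact: S1|split; [exact: S2|split; [exact: S3|exact: S4]]].
Qed.
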